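(* (a) Fix $0\le s<1$, $0<\delta<1$ and $0<\lambda<1$, and put $\nu=1-\lambda$. When $s\le\delta$ and $n$ goes to infinity, $$\overline{\epsilon}_0(\lceil sn\rceil,n,\delta)=\frac{s}{\delta}+\Big(\frac{1-s+s^2-\delta}{\delta(1-s)}+\frac{\upsilon_n}{\delta}\Big)\frac1n+O\Big(\frac1{n^2}\Big),$$ where $\upsilon_n:=\lceil sn\rceil-sn\le 1$. When $s>\delta$ and $n$ is sufficiently large, $\overline{\epsilon}_0(\lceil sn\rceil,n,\delta)=1$. Moreover, when $n$ goes to infinity, $$\overline{\epsilon}_\lambda(\lceil \nu sn\rceil,n,\delta)=s+C(\lambda,s,\delta)\sqrt{\frac1n}+O\Big(\frac1n\Big),$$ and the coefficient $C(\lambda,s,\delta)$ takes a non-negative value when $\delta\le\psi^{-1}\big(\frac{\lambda}{\nu(1-s)}\big)$. (b) Fix $0\le s<1$, $r>0$ and $0<\lambda<1$, put $\nu=1-\lambda$, and let $\delta=\mathrm{e}^{-rn}$. When $n$ goes to infinity, $$\overline{\epsilon}_0(\lceil sn\rceil,n,\delta=\mathrm{e}^{-rn})=1,$$ $$\overline{\epsilon}_\lambda(\lceil\nu sn\rceil,n,\delta=\mathrm{e}^{-rn})=\begin{cases}1 & r>D(s\nu\|\nu),\\ E_{\lambda,s}(r)+o(1) & 0<r\le D(s\nu\|\nu),\end{cases}$$ where $$E_{\lambda,s}(r):=\frac{r\,t_{\mathrm D}(\frac{\nu s}{r},\nu)-\nu s}{\lambda-\nu s+\nu r\,t_{\mathrm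 D}(\frac{\nu s}{r},\nu)} .$$
   Context: Let $\mathcal Q_{n+1}$ be the set of permutation-invariant (exchangeable) probability distributions of $(Y_1,\dots,Y_{n+1})\in\{0,1\}^{n+1}$. For $0\le\lambda<1$ put $\nu:=1-\lambda$. Given $(Y_1,\dots,Y_{n+1})$, let $U_1,\dots,U_n\in\{0,1\}$ be conditionally independent, $U_i$ depending only on $Y_i$, with $P(U_i=0|Y_i=0)=1$, $P(U_i=1|Y_i=0)=0$, $P(U_i=0|Y_i=1)=\lambda$, $P(U_i=1|Y_i=1)=1-\lambda=\nu$. Put $L:=\sum_{i=1}^nU_i$. For $Q\in\mathcal Q_{n+1}$, $Q(\cdot)$ also denotes probability under the resulting joint law. For integers $0\le l\le n-1$ and $0<\delta\le1$ define $$\overline{\epsilon}_\lambda(l,n,\delta):=\max_{Q\in\mathcal Q_{n+1}}\{Q(Y_{n+1}=1|L\le l)\;:\;Q(L\le l)\ge\delta\}.$$ (For $\lambda=0$, $L=\sum_{i=1}^n Y_i$, which gives $\overline{\epsilon}_0$.) $\phi(x)=\frac1{\sqrt{2\pi}}\mathrm{e}^{-x^2/2}$, $\Phi(x)=\int_{-\infty}^x\phi(t)\,dt$, and $\Phi^{-1}$ is the inverse function of $\Phi$. Let $\psi(\delta):=\frac{\phi(\Phi^{-1}(\delta))}{\delta\,\Phi^{-1}(\delta)}$. On $(1/2,1)$ the function $\psi$ is a strictly decreasing bijection onto $(0,\infty)$, and $\psi^{-1}:(0,\infty)\to(1/2,1)$ denotes the corresponding inverse. Define $$C(\lambda,s,\delta):=\frac{\sqrt{(1-\lambda)s}\,(1-s)}{\sqrt\lambda}\,\Phi^{-1}(\delta)\Big[\psi(\delta)-\frac{\lambda}{(1-\lambda)(1-s)}\Big],$$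 where the product $\Phi^{-1}(\delta)\psi(\delta)$ is understood as $\phi(\Phi^{-1}(\delta))/\delta$ (relevant at $\delta=1/2$). $D(p\|q):=p\ln\frac pq+(1-p)\ln\frac{1-p}{1-q}$ (with $0\ln 0=0$). For $\gamma\ge0$ and $0<x<1$, $t_{\mathrm D}(\gamma,x)$ is the unique solution $t$ of $t\,D(\frac{\gamma}{t}\|x)=1$ with $t\ge\gamma/x$ (for $\gamma=0$, $t=1/\ln\frac1{1-x}$).
   Formalization: The boundary case s=δ is moved: the expansion of ε̄_0 is claimed for s<δ and the value 1 for s≥δ, since at s=δ one has ε̄_0=1 exactly while the printed expansion has a 1/n coefficient of at least (1−s)/s>0. *)

(* Defs.v *)
From mathcomp Require Import all_boot all_order all_algebra all_fingroup.
From mathcomp Require Import all_classical all_reals all_analysis.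

Set Implicit Arguments.
Unset Strict Implicit.
Unset Printing Implicit Defensive.

Import Order.TTheory GRing.Theory Num.Theory.
Import numFieldNormedType.Exports.

Local Open Scope classical_set_scope.
Local Open Scope ring_scope.

(* A value [y : outcome n.+1] is (Y_1, ..., Y_(n+1)) with indices shifted to
   start at 0: Y_(n+1) is [y ord_max], and Y_i for i <= n is the value of [y]
   at an index in the image of [widen_ord (leqnSn n) : 'I_n -> 'I_n.+1]. *)
Definition outcome (m : nat) := {ffun 'I_m -> bool}.

Definition is_distribution (R : realType) (T : finType) (Q : T -> R) : Prop :=
  (forall t, 0 <= Q t) /\ \sum_(t : T) Q t = 1.

Definition exchangeable (R : realType) (m : nat) (Q : outcome m -> R) : Prop :=
  is_distribution Q /\
  forall (sigma : {perm 'I_m}) (y : outcome m),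
    Q [ffun i => y (sigma i)] = Q y.

(* [channel lam y u] is P(U_i = u | Y_i = y). *)
Definition channel (R : realType) (lam : R) (y u : bool) : R :=
  if y then (if u then 1 - lam else lam) else (if u then 0 else 1).

Definition joint_law (R : realType) (n : nat) (lam : R)
    (Q : outcome n.+1 -> R) (y : outcome n.+1) (u : outcome n) : R :=
  Q y * \prod_(i < n) channel lam (y (widen_ord (leqnSn n) i)) (u i).

Definition prob (R : realType) (n : nat) (lam : R) (Q : outcome n.+1 -> R)
    (E : outcome n.+1 -> outcome n -> bool) : R :=
  \sum_(y : outcome n.+1) \sum_(u : outcome n | E y u) joint_law lam Q y u.

Definition count_ones (n : nat) (u : outcome n) : nat := (\sum_(i < n) u i)%N.

Definition prob_L_le (R : realType) (n : nat) (lam : R)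
    (Q : outcome n.+1 -> R) (l : nat) : R :=
  prob lam Q (fun _ u => (count_ones u <= l)%N).

Definition cond_prob_bad (R : realType) (n : nat) (lam : R)
    (Q : outcome n.+1 -> R) (l : nat) : R :=
  prob lam Q (fun y u => y ord_max && (count_ones u <= l)%N)
    / prob_L_le lam Q l.

Definition attainable (R : realType) (lam : R) (l n : nat) (delta : R)
    : set R :=
  [set e | exists Q : outcome n.+1 -> R,
     [/\ exchangeable Q, delta <= prob_L_le lam Q l
       & e = cond_prob_bad lam Q l]].

(* A genuine maximum: a member of the set that bounds it from above (unique if
   it exists; the value 0 is used if there is none). *)
Definition epsbar (R : realType) (lam : R) (l n : nat) (delta : R) : R :=
  xget 0 (attainable lam l n delta `&` ubound (attainable lam l n delta)).

Definition phi (R : realType) (x : R) : R :=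
  (Num.sqrt (2 * pi))^-1 * expR (- (x ^+ 2 / 2)).

Definition Phi (R : realType) (x : R) : R :=
  Rintegral (@lebesgue_measure R) `]-oo, x] (@phi R).

Definition Phi_inv (R : realType) (p : R) : R := xget 0 [set x | Phi x = p].

Definition psi (R : realType) (delta : R) : R :=
  phi (Phi_inv delta) / (delta * Phi_inv delta).

Definition psi_inv (R : realType) (y : R) : R :=
  xget 0 [set d | 2^-1 < d < 1 /\ psi d = y].

(* [Phi_inv delta] is distributed over the bracket, and the resulting product
   [Phi_inv delta * psi delta] is replaced by [phi (Phi_inv delta) / delta];
   only at delta = 1/2, where [Phi_inv delta = 0], does this matter. *)
Definition coef_sqrt (R : realType) (lam s delta : R) : R :=
  Num.sqrt ((1 - lam) * s) * (1 - s) / Num.sqrt lam *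
  (phi (Phi_inv delta) / delta
     - Phi_inv delta * (lam / ((1 - lam) * (1 - s)))).

(* Since [x / 0 = 0] and [ln 0 = 0], the convention 0 ln 0 = 0 holds for p = 0
   and p = 1. *)
Definition KL (R : realType) (p q : R) : R :=
  p * ln (p / q) + (1 - p) * ln ((1 - p) / (1 - q)).

Definition t_D (R : realType) (gamma x : R) : R :=
  xget 0 [set t | gamma / x <= t /\ t * KL (gamma / t) x = 1].

Definition rateE (R : realType) (lam s r : R) : R :=
  let nu := 1 - lam in
  (r * t_D (nu * s / r) nu - nu * s)
    / (lam - nu * s + nu * r * t_D (nu * s / r) nu).

Definition ceil_nat (R : realType) (x : R) : nat := `|Num.ceil x|%N.

Definition upsilon (R : realType) (s : R) (n : nat) : R :=
  (Num.ceil (s * n%:R))%:~R - s * n%:R.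

(* Main.v *)
From HB Require Import structures.
Require Import Defs.
From mathcomp Require Import all_boot all_order all_algebra all_fingroup.
From mathcomp Require Import all_classical all_reals all_analysis.
From mathcomp Require Import ring lra zify.

Import Order.TTheory GRing.Theory Num.Theory.
Import numFieldNormedType.Exports.

Local Open Scope classical_set_scope.
Local Open Scope ring_scope.

Set Implicit Arguments.
Unset Strict Implicit.
Unset Printing Implicit Defensive.

(** Write [v = 1 - lam] and let [bcdf v k l] be the probability of at most [l]
    successes in [k] trials of success probability [v].

    Exchangeability makes everything a function of the number [k] of ones among
    the [n + 1] outcomes. Given [k], averaging over the position of the last
    outcome yields the probability [accept_prob v n l k] of [L <= l] and the
    probability [accept_bad v n l k] of [L <= l] together with a final one. As
    [k] can have any distribution, the pairs of these two probabilities that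
    exchangeable laws produce fill the convex hull of [n + 2] points of the
    plane, and [epsbar] is the largest slope [bad / accept] over the part of the
    hull where [accept >= delta]. The geometric fact that decides everything is
    that the points are, in the order of [k], the vertices of a concave curve
    wherever acceptance is not certain: for [a <= 1] the map
    [k |-> accept_bad - a * accept_prob] increases and then decreases, because
    its increments have the sign of a quantity that decreases in [k], and this
    in turn because the hazard rate of the binomial law is monotone ([hazard],
    [unimodal]). Hence the maximum exists, and it can be bracketed without being
    computed: [epsbar_ge] and [epsbar_le] say that the conditional probability
    [accept_bad / accept_prob] given [k] ones is a lower bound of [epsbar] as
    soon as [delta <= accept_prob], and an upper bound as soon as
    [accept_prob < delta]. For [lam = 0] the points are explicit, the optimum is
    a mixture of [l] and [l + 1] ones ([epsbar0_value]), and expanding the closed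
    form gives the first claim.

    For [lam > 0] and fixed [delta] one has to follow the count [k] at which
    [accept_prob] crosses [delta]. It sits at [s n + x sqrt n] up to a bounded
    error, with [x] given by the central limit theorem. The remainder [O (1 / n)]
    requires the distribution function with an error [O (1 / sqrt n)] and the
    local probabilities with a relative error of that order. Both follow from one
    inequality, due to Zubkov and Serov, which puts [bcdf v k l] between the
    values of [Phi] at the signed roots of the relative entropy for [l / k] and
    [(l + 1) / k]. It is proved by differentiating the difference with respect to
    [v]: the derivative changes sign as a monotone ratio of relative entropy to
    squared relative distance crosses a level ([Phi_le_bcdf_at]), and the same
    computation bounds the local probability at success probability [l / k]
    ([binp_peak_bounds]). Moving [k] by a
    bounded amount then brings [accept_prob] to either side of [delta]
    ([clt_lower], [clt_upper]) without changing the expansion of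
    [accept_bad / accept_prob] up to [O (1 / n)] ([conditional_limit]).

    For [delta = exp (- r n)] the crossing sits at a proportion [kap n] of ones,
    where [kap * KL (v s / kap) v = r], that is [kap = r * t_D (v s / r) v]
    ([decay_t_D]). Exponential tilting bounds [bcdf] from above, and the
    inequality above from below, to exponential precision ([ld_upper],
    [ld_lower]); since the rate is strictly increasing in [kap] ([decay_lt]),
    counts slightly below and slightly above [kap n] bracket [epsbar]. The
    conditional probability there has a limit continuous in [kap], because the
    ratio of successive values of [bcdf] converges ([conditional_ld_limit]), and
    this limit is [rateE]. If [r] exceeds the rate at [kap = 1], even [n + 1] ones
    are accepted often enough and the maximum is one. *)

(** * Calculus on the line *)

Lemma is_derive_ge0_le (R : realType) (f df : R -> R) (a b : R) :
  a <= b ->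
  (forall x, a < x < b -> is_derive x (1 : R) f (df x)) ->
  (forall x, a <= x <= b -> {for x, continuous f}) ->
  (forall x, a < x < b -> 0 <= df x) -> f a <= f b.
Proof.
move=> ab fd fc df0.
have cf : {within `[a, b], continuous f}.
  by apply: continuous_in_subspaceT => x; rewrite inE/= in_itv/= => /fc.
have fd' x : x \in `]a, b[%R -> is_derive x (1 : R) f (df x).
  by rewrite in_itv/=; apply: fd.
have [<-//|ab0] := eqVneq a b.
have ab' : a < b by rewrite lt_neqAle ab0.
have [c] := MVT ab' fd' cf; rewrite in_itv/= => cab e.
by rewrite -subr_ge0 e mulr_ge0 ?df0// subr_ge0.
Qed.

Lemma is_derive_le0_ge (R : realType) (f df : R -> R) (a b : R) :
  a <= b ->
  (forall x, a < x < b -> is_derive x (1 : R) f (df x)) ->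
  (forall x, a <= x <= b -> {for x, continuous f}) ->
  (forall x, a < x < b -> df x <= 0) -> f b <= f a.
Proof.
move=> ab fd fc df0; rewrite -lerN2.
apply: (@is_derive_ge0_le _ (fun x => - f x) (fun x => - df x)) => //.
- by move=> x /fd fdx; exact: is_deriveN.
- by move=> x /fc fcx; exact: cvgN.
- by move=> x /df0; rewrite oppr_ge0.
Qed.

Lemma is_derive1_continuous (R : realType) (f : R -> R) (x l : R) :
  is_derive x (1 : R) f l -> {for x, continuous f}.
Proof.
move=> fx; apply: differentiable_continuous; apply/derivable1_diffP.
exact: ex_derive.
Qed.

(** Differentiation rules for functions written pointwise, with the value of
    the derivative left as an equation to be settled by [field]. *)
Section PointwiseDerivatives.
Context {R : realType}.
Implicit Types (f g : R -> R) (x a b c : R).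

Lemma derive_ptD f g x a b c : is_derive x (1 : R) f a ->
  is_derive x (1 : R) g b -> c = a + b ->
  is_derive x (1 : R) (fun y => f y + g y) c.
Proof. by move=> df dg ->; exact: is_deriveD. Qed.

Lemma derive_ptB f g x a b c : is_derive x (1 : R) f a ->
  is_derive x (1 : R) g b -> c = a - b ->
  is_derive x (1 : R) (fun y => f y - g y) c.
Proof. by move=> df dg ->; exact: is_deriveB. Qed.

Lemma derive_ptN f x a c : is_derive x (1 : R) f a -> c = - a ->
  is_derive x (1 : R) (fun y => - f y) c.
Proof. by move=> df ->; exact: is_deriveN. Qed.

Lemma derive_ptM f g x a b c : is_derive x (1 : R) f a ->
  is_derive x (1 : R) g b -> c = f x * b + g x * a ->
  is_derive x (1 : R) (fun y => f y * g y) c.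
Proof. by move=> df dg ->; exact: is_deriveM. Qed.

Lemma derive_ptZ f k x a c : is_derive x (1 : R) f a -> c = k * a ->
  is_derive x (1 : R) (fun y => k * f y) c.
Proof. by move=> df ->; exact: is_deriveZ. Qed.

Lemma derive_ptX f n x a c : is_derive x (1 : R) f a ->
  c = n%:R * f x ^+ n.-1 * a -> is_derive x (1 : R) (fun y => f y ^+ n) c.
Proof.
move=> df ->; rewrite (_ : (fun y => f y ^+ n) = f ^+ n).
  exact: is_deriveX.
by apply/funext => y; elim: n => [|n IH]; rewrite ?expr0// !exprS IH.
Qed.

Lemma derive_pt_comp f g x a b c : is_derive (g x) (1 : R) f a ->
  is_derive x (1 : R) g b -> c = a * b ->
  is_derive x (1 : R) (fun y => f (g y)) c.
Proof. by move=> df dg ->; exact: is_derive1_comp. Qed.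

Lemma derive_ptV f x a c : is_derive x (1 : R) f a -> f x != 0 ->
  c = - a / f x ^+ 2 -> is_derive x (1 : R) (fun y => (f y)^-1) c.
Proof.
move=> df fx0 ->; apply: (is_derive_eq (is_deriveV fx0 df)).
by rewrite /GRing.scale/= mulNr mulrC mulNr.
Qed.

Lemma derive_pt_id x : is_derive x (1 : R) (fun y => y) 1.
Proof. exact: is_derive_id. Qed.

Lemma derive_pt_cst k x : is_derive x (1 : R) (fun=> k) (0 : R).
Proof. exact: is_derive_cst. Qed.

End PointwiseDerivatives.

(** * The standard normal distribution function *)

Section Gaussian.
Context {R : realType}.
Implicit Types x y p w : R.

Lemma phiE x : phi x = normal_pdf 0 1 x.
Proof.
rewrite normal_pdfE ?oner_neq0// /phi /normal_peak /normal_fun subr0.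
congr (_^-1 * expR _); last by rewrite expr1n mulNr.
by rewrite expr1n mul1r mulr_natl.
Qed.

Lemma phi_fun : @phi R = normal_pdf 0 1.
Proof. by apply/funext => x; rewrite phiE. Qed.

(** The maximum of the normal density. *)
Definition phi0 : R := (Num.sqrt (2 * pi))^-1.

Lemma phi0_gt0 : 0 < phi0.
Proof. by rewrite invr_gt0 sqrtr_gt0 mulr_gt0// pi_gt0. Qed.

Lemma phi0_lt1 : phi0 < 1.
Proof.
rewrite invf_lt1 ?sqrtr_gt0 ?mulr_gt0 ?pi_gt0// -[ltLHS]sqrtr1.
rewrite ltr_sqrt; last by rewrite mulr_gt0 ?pi_gt0.
by have := @pi_ge2 R; lra.
Qed.

Lemma phi_gt0 x : 0 < phi x.
Proof. by rewrite mulr_gt0 ?phi0_gt0 ?expR_gt0. Qed.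

Lemma phi_le_phi0 x : phi x <= phi0.
Proof.
rewrite ler_piMr ?(ltW phi0_gt0)// -[leRHS]expR0 ler_expR oppr_le0.
by rewrite divr_ge0 ?sqr_ge0.
Qed.

Lemma phiN x : phi (- x) = phi x.
Proof. by rewrite /phi sqrrN. Qed.

Lemma phi_le x y : 0 <= x -> x <= y -> phi y <= phi x.
Proof.
move=> x0 xy; rewrite ler_wpM2l ?(ltW phi0_gt0)// ler_expR lerN2.
by rewrite ler_pM2r ?invr_gt0// lerXn2r ?nnegrE// (le_trans x0).
Qed.

Lemma integrable_phi (D : set (measurableTypeR R)) : measurable D ->
  (@lebesgue_measure R).-integrable D (EFin \o @phi R).
Proof.
move=> mD; apply: (@integrableS _ _ _ _ setT) => //.
by rewrite phi_fun; exact: integrable_normal_pdf.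
Qed.

Lemma PhiE x : (Phi x)%:E = normal_prob 0 1 `]-oo, x].
Proof.
rewrite /Phi /Rintegral fineK; last first.
  by apply: integrable_fin_num => //; exact: integrable_phi.
by apply: eq_integral => y _; rewrite phiE.
Qed.

(** The fundamental theorem of calculus on a half-line. *)
Lemma is_derive_Phi x : is_derive x (1 : R) (@Phi R) (phi x).
Proof.
have [] := @continuous_FTC1 R (@phi R) -oo%O x (x + 1) _ _ _ _.
- by rewrite ltrDl.
- by apply: integrable_phi.
- by rewrite ltNyr.
- by rewrite phi_fun; exact: continuous_normal_pdf (oner_neq0 _) x.
- by move=> + <-; rewrite derive1E => /derivableP.
Qed.

Lemma continuous_Phi : continuous (@Phi R).
Proof. by move=> x; apply: is_derive1_continuous (is_derive_Phi x). Qed.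

Lemma Phi_ge0 x : 0 <= Phi x.
Proof. by rewrite -lee_fin PhiE. Qed.

Lemma Phi_le1 x : Phi x <= 1.
Proof. by rewrite -lee_fin PhiE; exact: probability_le1. Qed.

Lemma Phi_MVT x y : x < y ->
  exists2 z, x < z < y & Phi y - Phi x = phi z * (y - x).
Proof.
move=> xy; have [] := @MVT R (@Phi R) (@phi R) x y xy.
- by move=> z _; exact: is_derive_Phi.
- by apply: continuous_subspaceT; exact: continuous_Phi.
- by move=> z; rewrite in_itv/= => zxy e; exists z.
Qed.

Lemma Phi_lt x y : x < y -> Phi x < Phi y.
Proof.
move=> xy; have [z _ e] := Phi_MVT xy.
by rewrite -subr_gt0 e mulr_gt0 ?phi_gt0 ?subr_gt0.
Qed.

Lemma ltr_Phi : {mono (@Phi R) : x y / x < y}.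
Proof.
move=> x y; apply/idP/idP; last exact: Phi_lt.
by apply: contraTT; rewrite -!leNgt le_eqVlt => /predU1P[->//|/Phi_lt/ltW].
Qed.

Lemma ler_Phi : {mono (@Phi R) : x y / x <= y}.
Proof. by move=> x y; rewrite !leNgt ltr_Phi. Qed.

Lemma Phi_lipschitz x y : `|Phi x - Phi y| <= `|x - y|.
Proof.
wlog xy : x y / x <= y.
  by move=> H; have [/H//|/ltW/H] := leP x y; rewrite distrC (distrC y).
have [->|/eqP xy'] := eqVneq x y; first by rewrite !subrr normr0.
have xy2 : x < y by rewrite lt_neqAle xy andbT; exact/eqP.
have [z _ e] := Phi_MVT xy2; rewrite distrC e normrM distrC ler_piMl//.
by rewrite gtr0_norm ?phi_gt0// (le_trans (phi_le_phi0 _))// ltW ?phi0_lt1.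
Qed.

(** The identity, as a random variable under the standard normal law: its
    distribution function is [Phi], whose limits are thereby those of a
    distribution function. *)
Definition std_normal_id : measurableTypeR R -> R := idfun.

HB.instance Definition _ :=
  @isMeasurableFun.Build _ _ _ _ std_normal_id (@measurable_id _ _ setT).

Lemma Phi_small (e : R) : 0 < e -> exists M : R, forall x, x <= M -> Phi x < e.
Proof.
move=> e0.
have := @cvg_cdfNy0 _ _ _ (normal_prob (0:R) 1)
   (std_normal_id : {RV (normal_prob (0:R) 1) >-> R}).
move=> /fine_cvgP[_ /cvgrPdist_lt/(_ e e0)].
move=> [M [_ HM]]; exists (M - 1) => x xM.
have xM' : x < M by lra.
have := HM x xM'.
rewrite sub0r normrN /= /cdf /= (_ : _ @^-1` _ = `]-oo, x]%classic)//.
by rewrite -PhiE /= ger0_norm ?Phi_ge0.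
Qed.

Lemma Phi_large (e : R) : 0 < e -> exists M : R, forall x, M <= x -> 1 - e < Phi x.
Proof.
move=> e0.
have := @cvg_cdfy1 _ _ _ (normal_prob (0:R) 1)
   (std_normal_id : {RV (normal_prob (0:R) 1) >-> R}).
move=> /fine_cvgP[_ /cvgrPdist_lt/(_ e e0)].
move=> [M [_ HM]]; exists (M + 1) => x xM.
have xM' : M < x by lra.
have := HM x xM'.
rewrite /= /cdf /= (_ : _ @^-1` _ = `]-oo, x]%classic)//.
rewrite -PhiE /= ger0_norm ?subr_ge0 ?Phi_le1//; lra.
Qed.

(** The derivative vanishes by symmetry of [phi], and the constant is read off
    far away from the origin. *)
Lemma PhiDN x : Phi x + Phi (- x) = 1.
Proof.
pose S y : R := Phi y + Phi (- y).
have dS y : is_derive y (1 : R) S 0.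
  apply: (derive_ptD (is_derive_Phi y)).
    apply: (derive_pt_comp (is_derive_Phi _) (is_deriveNid y 1)).
    by rewrite phiN mulrN1.
  by rewrite subrr.
have cst y : S y = S x by exact: is_derive_0_is_cst.
rewrite -/(S x); apply/eqP; rewrite eq_le; apply/andP; split.
  apply/ler_addgt0Pl => e e0; have [M HM] := Phi_small e0.
  by rewrite -(cst M) /S lerD ?Phi_le1// ltW// HM.
apply/ler_addgt0Pl => e e0; have [M HM] := Phi_large e0.
rewrite -lerBlDl -(cst M) /S -[leLHS]addr0 lerD ?Phi_ge0//.
by rewrite ltW// HM.
Qed.

Lemma Phi_opp x : Phi (- x) = 1 - Phi x.
Proof. by have := PhiDN x; lra. Qed.

Lemma Phi0 : Phi 0 = 2^-1 :> R.
Proof. by have := PhiDN 0; rewrite oppr0; lra. Qed.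

Lemma Phi_invK p : 0 < p < 1 -> Phi (Phi_inv p) = p.
Proof.
move=> /andP[p0 p1]; rewrite /Phi_inv; case: xgetP => [y -> //|/(_ _)/= np].
have [M1 HM1] := Phi_small p0.
have p1' : 0 < 1 - p by rewrite subr_gt0.
have [M2 HM2] := Phi_large p1'.
have [c _ cp] : exists2 c, c \in `[Num.min M1 M2, Num.max M1 M2] & Phi c = p.
  apply: IVT.
  - by rewrite ge_min le_max lexx.
  - by apply: continuous_subspaceT; exact: continuous_Phi.
  - have h1 := HM1 (Num.min M1 M2); have h2 := HM2 (Num.max M1 M2).
    rewrite ge_min lexx /= in h1; rewrite le_max lexx orbT in h2.
    have {}h1 := h1 isT; have {}h2 := h2 isT.
    by rewrite ge_min (ltW h1)/= le_max; apply/orP; right; lra.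
by case: (np c).
Qed.

(** A tail lower bound too weak by a factor [expR (O w)], which is harmless on
    the exponential scale: the unit interval left of [-w] already suffices. *)
Lemma Phi_opp_ge w : 0 <= w -> phi0 * expR (- ((w + 1) ^+ 2 / 2)) <= Phi (- w).
Proof.
move=> w0; have lt : - (w + 1) < - w by lra.
have [z /andP[z1 z2] e] := Phi_MVT lt.
have h : phi (w + 1) <= phi z by rewrite -(phiN z) phi_le//; lra.
have := Phi_ge0 (- (w + 1)); rewrite -/(phi (w + 1)).
have -> : Phi (- w) = Phi (- (w + 1)) + phi z by move: e; lra.
lra.
Qed.

Lemma is_derive_phi y : is_derive y (1 : R) (@phi R) (- y * phi y).
Proof.
have d : is_derive y (1 : R) (fun z : R => - (z ^+ 2 / 2)) (- y).
  have d := derive_ptN (derive_ptM (derive_ptX (n := 2) (derive_pt_id y) erefl)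
             (derive_pt_cst 2^-1 y) erefl) erefl.
  by apply: (is_derive_eq d); rewrite /=; field.
apply: (derive_ptZ (derive_pt_comp (is_derive_expR _) d erefl)).
by rewrite /phi /phi0; ring.
Qed.

End Gaussian.

(** * Binomial probabilities *)

Section Binomial.
Context {R : realType}.
Implicit Types (x : R) (m j l k : nat).

(** Probability of exactly [j] successes in [m] independent trials of success
    probability [x]. *)
Definition binp x m j : R := 'C(m, j)%:R * (x ^+ j * (1 - x) ^+ (m - j)).

(** Probability of at most [l] successes. *)
Definition bcdf x m l : R := \sum_(j < l.+1) binp x m j.

Lemma binp_ge0 x m j : 0 <= x <= 1 -> 0 <= binp x m j.
Proof.
by move=> /andP[x0 x1]; rewrite !mulr_ge0// exprn_ge0// subr_ge0.
Qed.

Lemma binp_gt0 x m j : 0 < x < 1 -> (j <= m)%N -> 0 < binp x m j.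
Proof.
move=> /andP[x0 x1] jm; rewrite !mulr_gt0 ?exprn_gt0// ?subr_gt0//.
by rewrite ltr0n bin_gt0.
Qed.

Lemma binp_small x m j : (m < j)%N -> binp x m j = 0.
Proof. by move=> mj; rewrite /binp bin_small// mul0r. Qed.

Lemma binpS0 x m : binp x m.+1 0 = (1 - x) * binp x m 0.
Proof. by rewrite /binp !bin0 !subn0 !expr0 exprS; ring. Qed.

Lemma binpSS x m j :
  binp x m.+1 j.+1 = (1 - x) * binp x m j.+1 + x * binp x m j.
Proof.
rewrite /binp binS natrD subSS.
have [jm|mj] := ltnP j m; last by rewrite (bin_small (_ : (m < j.+1)%N))// exprS; ring.
by rewrite -(@subnSK j m)// !exprS; ring.
Qed.

Lemma bcdfS x m l : bcdf x m l.+1 = bcdf x m l + binp x m l.+1.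
Proof. by rewrite /bcdf big_ord_recr. Qed.

Lemma bcdf0 x m : bcdf x m 0 = (1 - x) ^+ m.
Proof. by rewrite /bcdf big_ord1 /binp bin0 subn0 !mul1r. Qed.

(** One more trial: the running count leaves [0..l] exactly when it equals [l]
    and the new trial succeeds. *)
Lemma bcdf_trialS x m l : bcdf x m.+1 l = bcdf x m l - x * binp x m l.
Proof.
elim: l => [|l IH].
  by rewrite !bcdf0 /binp bin0 subn0 exprS; ring.
by rewrite !bcdfS IH binpSS; ring.
Qed.

Lemma bcdf_ge0 x m l : 0 <= x <= 1 -> 0 <= bcdf x m l.
Proof. by move=> x01; apply: sumr_ge0 => j _; exact: binp_ge0. Qed.

Lemma bcdf_gt0 x m l : 0 <= x < 1 -> 0 < bcdf x m l.
Proof.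
move=> /andP[x0 x1]; rewrite /bcdf big_ord_recl ltr_wpDr//.
  by apply: sumr_ge0 => j _; apply: binp_ge0; rewrite x0 ltW.
by rewrite /binp bin0 !mul1r exprn_gt0// subr_gt0.
Qed.

Lemma bcdf_trials_le x m k l : 0 <= x <= 1 -> (m <= k)%N ->
  bcdf x k l <= bcdf x m l.
Proof.
move=> x01; elim: k => [|k IH]; first by rewrite leqn0 => /eqP->.
rewrite leq_eqVlt => /predU1P[->//|/IH]; apply: le_trans.
by rewrite bcdf_trialS gerBl mulr_ge0 ?binp_ge0//; case/andP: x01.
Qed.

Lemma bcdf_all x m l : (m <= l)%N -> bcdf x m l = 1.
Proof.
elim: m => [|m IH] ml.
  rewrite /bcdf big_ord_recl big1 => [|i _]; last first.
    by rewrite binp_small// lift0.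
  by rewrite addr0 /binp bin0 subn0 !expr0 !mulr1.
by rewrite bcdf_trialS IH ?(ltnW ml)// binp_small// mulr0 subr0.
Qed.

Lemma bcdf_le1 x m l : 0 <= x <= 1 -> bcdf x m l <= 1.
Proof. by move=> x01; rewrite -(@bcdf_all x 0 l)// bcdf_trials_le. Qed.

(** Telescoped form: the number of the trial that produces success [l + 1]
    follows the negative binomial law. *)
Lemma bcdf_sub x m i l :
  bcdf x m l - bcdf x (m + i) l = \sum_(j < i) x * binp x (m + j) l.
Proof.
elim: i => [|i IH]; first by rewrite addn0 subrr big_ord0.
by rewrite big_ord_recr -IH addnS bcdf_trialS /=; ring.
Qed.

Lemma binp_trialS x m l : (l <= m)%N ->
  binp x m.+1 l * (m.+1 - l)%:R = (1 - x) * m.+1%:R * binp x m l.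
Proof.
move=> lm; rewrite /binp.
have h : ('C(m.+1, l)%:R * (m.+1 - l)%:R = m.+1%:R * 'C(m, l)%:R :> R).
  by rewrite -!natrM mulnC mul_bin_down.
rewrite mulrAC h subSn// exprS; ring.
Qed.

(** A binomial law conditioned on at most [l] successes still has at most [l]
    of them, which caps what one more trial can keep. *)
Lemma bcdf_trialS_le x m l : 0 <= x <= 1 -> (l <= m)%N ->
  bcdf x m.+1 l * (m.+1 - l)%:R <= (1 - x) * m.+1%:R * bcdf x m l.
Proof.
move=> x01 lm; rewrite /bcdf mulr_suml mulr_sumr; apply: ler_sum => i _.
have il : (i <= l)%N by rewrite -ltnS.
rewrite -binp_trialS ?(leq_trans il)// ler_wpM2l ?binp_ge0// ler_nat.
exact: leq_sub2l.
Qed.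

Lemma is_derive_binp x m j : is_derive x (1 : R) (fun y => binp y m j)
  (m%:R * ((if j is j'.+1 then binp x m.-1 j' else 0) - binp x m.-1 j)).
Proof.
have dx : is_derive x (1 : R) (fun y : R => y ^+ j) (j%:R * x ^+ j.-1).
  by apply: (derive_ptX (derive_pt_id x)); rewrite mulr1.
have d1x : is_derive x (1 : R) (fun y : R => (1 - y) ^+ (m - j))
    (- ((m - j)%:R * (1 - x) ^+ (m - j).-1)).
  apply: (derive_ptX (derive_ptB (derive_pt_cst 1 x) (derive_pt_id x) erefl)).
  by rewrite sub0r mulrN1.
apply: (derive_ptZ (derive_ptM dx d1x erefl)).
case: m {dx d1x} => [|m] /=.
  by rewrite !mul0r; case: j => [|j]; rewrite ?bin0n ?mul0r//=; ring.
have hd : ('C(m.+1, j)%:R * (m.+1 - j)%:R = m.+1%:R * 'C(m, j)%:R :> R).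
  by rewrite -!natrM mulnC mul_bin_down.
have -> : (m.+1 - j).-1 = (m - j)%N by lia.
rewrite mulrBr /binp; case: j hd => [|j] hd.
  by rewrite !bin0 !subn0 /=; ring.
have hl : ('C(m.+1, j.+1)%:R * j.+1%:R = m.+1%:R * 'C(m, j)%:R :> R).
  by rewrite -!natrM mulnC -mul_bin_diag.
rewrite [LHS](_ : _ = (m.+1%:R * 'C(m, j)%:R) * (x ^+ j * (1 - x) ^+ (m - j)) -
   (m.+1%:R * 'C(m, j.+1)%:R) * (x ^+ j.+1 * (1 - x) ^+ (m - j.+1))); last by ring.
by rewrite -hl -hd subSS /=; ring.
Qed.

(** The derivatives of the individual probabilities telescope. *)
Lemma is_derive_bcdf x m l : is_derive x (1 : R) (fun y => bcdf y m l)
  (- (m%:R * binp x m.-1 l)).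
Proof.
elim: l => [|l IH].
  rewrite (_ : (fun y => _) = (fun y => binp y m 0)); last first.
    by apply/funext => y; rewrite /bcdf big_ord1.
  by apply: (is_derive_eq (is_derive_binp x m 0)); rewrite sub0r mulrN.
rewrite (_ : (fun y => _) = (fun y => bcdf y m l + binp y m l.+1)); last first.
  by apply/funext => y; rewrite bcdfS.
by apply: (derive_ptD IH (is_derive_binp x m l.+1)); ring.
Qed.

Lemma binp_rev x m j : (j <= m)%N -> binp (1 - x) m (m - j) = binp x m j.
Proof.
by move=> jm; rewrite /binp bin_sub// subKn// subKr [X in _ * X]mulrC.
Qed.

(** Counting failures instead of successes. *)
Lemma bcdf_rev x m l : (l < m)%N ->
  bcdf x m l = 1 - bcdf (1 - x) m (m - l.+1).
Proof.
move=> lm; suff : bcdf x m m = bcdf x m l + bcdf (1 - x) m (m - l.+1).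
  by rewrite bcdf_all// => e; apply/esym/eqP; rewrite subr_eq; apply/eqP.
rewrite /bcdf -!(big_mkord xpredT (binp x m)) (big_cat_nat (n := l.+1))//=; last first.
  by rewrite ltnS ltnW.
congr (_ + _).
rewrite big_nat_rev /= -(big_mkord xpredT (binp (1 - x) m)).
rewrite -{1}[l.+1]add0n big_addn.
have -> : (m.+1 - l.+1 = (m - l.+1).+1)%N by lia.
rewrite big_nat_cond [RHS]big_nat_cond; apply: eq_bigr => j /andP[/andP[_ jm] _].
rewrite -binp_rev ?subKr; last by lia.
by congr binp; lia.
Qed.

End Binomial.

(** * Relative entropy *)

Ltac sign_tac := repeat first
  [ assumption | by [] | exact: sqr_ge0 | (apply: ltW; assumption)
  | apply: mulr_gt0 | apply: addr_gt0 | apply: exprn_gt0 | rewrite invr_gt0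
  | apply: mulr_ge0 | apply: addr_ge0 | apply: exprn_ge0 | rewrite invr_ge0 ].

Section RelativeEntropy.
Context {R : realType}.
Implicit Types (a x y : R).

Lemma KL_refl a : 0 < a < 1 -> KL a a = 0.
Proof.
move=> /andP[a0 a1]; rewrite /KL !divff ?gt_eqF ?subr_gt0// ln1.
by rewrite !mulr0 addr0.
Qed.

Lemma is_derive_KL a x : 0 < a < 1 -> 0 < x < 1 ->
  is_derive x (1 : R) (KL a) ((x - a) / (x * (1 - x))).
Proof.
move=> /andP[a0 a1] /andP[x0 x1].
have x1' : 0 < 1 - x by rewrite subr_gt0.
have a1' : 0 < 1 - a by rewrite subr_gt0.
have d1 : is_derive x (1 : R) (fun y => a / y) (- a / x ^+ 2).
  have d := derive_ptZ (k := a) (derive_ptV (derive_pt_id x) (lt0r_neq0 x0) erefl)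
    erefl.
  by apply: (is_derive_eq d); field; rewrite gt_eqF.
have d2 : is_derive x (1 : R) (fun y => (1 - a) / (1 - y)) ((1 - a) / (1 - x) ^+ 2).
  have d0 := derive_ptB (derive_pt_cst 1 x) (derive_pt_id x) erefl.
  have d := derive_ptZ (k := 1 - a) (derive_ptV d0 (lt0r_neq0 x1') erefl)
    erefl.
  by apply: (is_derive_eq d); field; rewrite gt_eqF.
have l1 := is_derive1_ln (divr_gt0 a0 x0).
have l2 := is_derive1_ln (divr_gt0 a1' x1').
have d := derive_ptD (derive_ptZ (k := a) (derive_pt_comp (g := fun y => a / y) l1 d1 erefl) erefl)
  (derive_ptZ (k := 1 - a)
    (derive_pt_comp (g := fun y => (1 - a) / (1 - y)) l2 d2 erefl) erefl) erefl.
apply: (is_derive_eq d); field.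
by rewrite !gt_eqF.
Qed.

Lemma KL_continuous a x : 0 < a < 1 -> 0 < x < 1 -> {for x, continuous (KL a)}.
Proof. by move=> a01 x01; apply: is_derive1_continuous (is_derive_KL a01 x01). Qed.

(** Gibbs' inequality. *)
Lemma KL_ge0 a x : 0 <= a <= 1 -> 0 < x < 1 -> 0 <= KL a x.
Proof.
have aux (p q : R) : 0 <= p -> 0 < q -> p - q <= p * ln (p / q).
  rewrite le_eqVlt => /predU1P[<-|p0] q0; first by rewrite mul0r; lra.
  have := @le_ln1Dx _ (q / p - 1) _.
  rewrite [1 + _]addrC subrK -[q / p]invf_div lnV ?posrE ?divr_gt0// invf_div.
  have qp : 0 < q / p by rewrite divr_gt0.
  have -> : (-1 < q / p - 1) = true by apply/idP; lra.
  move=> /(_ isT) h; have := ler_wpM2l (ltW p0) h.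
  rewrite mulrBr mulr1 mulrCA divff ?gt_eqF// mulr1 mulrN; lra.
move=> /andP[a0 a1] /andP[x0 x1].
have a1' : 0 <= 1 - a by rewrite subr_ge0.
have x1' : 0 < 1 - x by rewrite subr_gt0.
by have := aux a x a0 x0; have := aux _ _ a1' x1'; rewrite /KL; lra.
Qed.

(** Two quadratic approximations of [KL a x], exact to second order at [x = a].
    The gaps vanish at [x = a] and increase with [x], so that each of them turns
    into an upper bound on one side of [a] and a lower bound on the other. *)
Definition KL_chi2_gap a x := (x - a) ^+ 2 / (1 - x) - 2 * a * KL a x.
Definition KL_var_gap a x := 2 * KL a x - a / (1 - a) * ((x - a) ^+ 2 / x ^+ 2).

Lemma is_derive_KL_chi2_gap a x : 0 < a < 1 -> 0 < x < 1 ->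
  is_derive x (1 : R) (KL_chi2_gap a)
    ((x - a) ^+ 2 * (2 / (x * (1 - x)) + (1 - x) ^- 2)).
Proof.
move=> a01 x01; have /andP[x0 x1] := x01.
have x1' : 0 < 1 - x by rewrite subr_gt0.
have d0 := derive_ptB (derive_pt_id x) (derive_pt_cst a x) erefl.
have d1 := derive_ptX (n := 2) d0 erefl.
have d2 := derive_ptB (derive_pt_cst 1 x) (derive_pt_id x) erefl.
have d3 := derive_ptM d1 (derive_ptV d2 (lt0r_neq0 x1') erefl) erefl.
have d := derive_ptB d3 (derive_ptZ (k := 2 * a) (is_derive_KL a01 x01) erefl) erefl.
by apply: (is_derive_eq d); rewrite /=; field; rewrite !gt_eqF.
Qed.

Lemma is_derive_KL_var_gap a x : 0 < a < 1 -> 0 < x < 1 ->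
  is_derive x (1 : R) (KL_var_gap a)
    (2 * (x - a) ^+ 2 * ((x + a * (1 - x)) / (x ^+ 3 * (1 - x) * (1 - a)))).
Proof.
move=> a01 x01; have /andP[x0 x1] := x01.
have x1' : 0 < 1 - x by rewrite subr_gt0.
have a1' : 0 < 1 - a by case/andP: a01 => _; rewrite subr_gt0.
have d0 := derive_ptB (derive_pt_id x) (derive_pt_cst a x) erefl.
have d1 := derive_ptX (n := 2) d0 erefl.
have d2 := derive_ptX (n := 2) (derive_pt_id x) erefl.
have x20 : x ^+ 2 != 0 by rewrite expf_neq0// gt_eqF.
have d3 := derive_ptM d1 (derive_ptV d2 x20 erefl) erefl.
have d := derive_ptB (derive_ptZ (k := 2) (is_derive_KL a01 x01) erefl)
   (derive_ptZ (k := a / (1 - a)) d3 erefl) erefl.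
by apply: (is_derive_eq d); rewrite /=; field; rewrite !gt_eqF.
Qed.

Lemma KL_chi2_gap_mono a x y : 0 < a < 1 -> 0 < x -> x <= y -> y < 1 ->
  KL_chi2_gap a x <= KL_chi2_gap a y.
Proof.
move=> a01 x0 xy y1.
apply: (@is_derive_ge0_le _ _
  (fun x => (x - a) ^+ 2 * (2 / (x * (1 - x)) + (1 - x) ^- 2))).
- by [].
- by move=> z /andP[xz zy]; apply: is_derive_KL_chi2_gap => //; lra.
- move=> z /andP[xz zy]; have z01 : 0 < z < 1 by lra.
  exact: is_derive1_continuous (is_derive_KL_chi2_gap a01 z01).
- move=> z /andP[xz zy]; have [z0 z1] : 0 < z /\ 0 < 1 - z by lra.
  by sign_tac.
Qed.

Lemma KL_var_gap_mono a x y : 0 < a < 1 -> 0 < x -> x <= y -> y < 1 ->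
  KL_var_gap a x <= KL_var_gap a y.
Proof.
move=> a01 x0 xy y1; have [a0 a1] : 0 < a /\ 0 < 1 - a by lra.
apply: (@is_derive_ge0_le _ _
  (fun x => 2 * (x - a) ^+ 2 *
     ((x + a * (1 - x)) / (x ^+ 3 * (1 - x) * (1 - a))))).
- by [].
- by move=> z /andP[xz zy]; apply: is_derive_KL_var_gap => //; lra.
- move=> z /andP[xz zy]; have z01 : 0 < z < 1 by lra.
  exact: is_derive1_continuous (is_derive_KL_var_gap a01 z01).
- move=> z /andP[xz zy]; have [z0 z1] : 0 < z /\ 0 < 1 - z by lra.
  by sign_tac.
Qed.

Lemma KL_chi2_gap_refl a : 0 < a < 1 -> KL_chi2_gap a a = 0.
Proof. by move=> a01; rewrite /KL_chi2_gap subrr KL_refl// expr2 !mul0r mulr0 subrr. Qed.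

Lemma KL_var_gap_refl a : 0 < a < 1 -> KL_var_gap a a = 0.
Proof. by move=> a01; rewrite /KL_var_gap subrr KL_refl// expr2 !mul0r !mulr0 subrr. Qed.

Lemma KL_le_chi2 a x : 0 < a < 1 -> a <= x < 1 ->
  2 * KL a x <= (x - a) ^+ 2 / (a * (1 - x)).
Proof.
move=> a01 /andP[ax x1]; have [a0 a1] : 0 < a /\ 0 < 1 - x by lra.
have := KL_chi2_gap_mono a01 a0 ax x1; rewrite KL_chi2_gap_refl// /KL_chi2_gap.
by rewrite invfM mulrCA ler_pdivlMl// subr_ge0 mulrA [a * 2]mulrC.
Qed.

Lemma KL_ge_chi2 a x : 0 < a < 1 -> 0 < x <= a ->
  (x - a) ^+ 2 / (a * (1 - x)) <= 2 * KL a x.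
Proof.
move=> a01 /andP[x0 xa]; have [a0 a1] : 0 < a /\ a < 1 by lra.
have := KL_chi2_gap_mono a01 x0 xa a1; rewrite KL_chi2_gap_refl// /KL_chi2_gap.
by rewrite invfM mulrCA ler_pdivrMl// subr_le0 mulrA [a * 2]mulrC.
Qed.

Lemma KL_ge_var a x : 0 < a < 1 -> a <= x < 1 ->
  a / (1 - a) * ((x - a) ^+ 2 / x ^+ 2) <= 2 * KL a x.
Proof.
move=> a01 /andP[ax x1]; have [a0 a1] : 0 < a /\ 0 < 1 - x by lra.
have := KL_var_gap_mono a01 a0 ax x1; rewrite KL_var_gap_refl// /KL_var_gap.
by rewrite subr_ge0.
Qed.

Lemma KL_le_var a x : 0 < a < 1 -> 0 < x <= a ->
  2 * KL a x <= a / (1 - a) * ((x - a) ^+ 2 / x ^+ 2).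
Proof.
move=> a01 /andP[x0 xa]; have [a0 a1] : 0 < a /\ a < 1 by lra.
have := KL_var_gap_mono a01 x0 xa a1; rewrite KL_var_gap_refl// /KL_var_gap.
by rewrite subr_le0.
Qed.

Lemma KL_gt0 a x : 0 < a < 1 -> 0 < x < 1 -> x != a -> 0 < KL a x.
Proof.
move=> a01 /andP[x0 x1] xa.
have [[a0 a1] x1'] : (0 < a /\ 0 < 1 - a) /\ 0 < 1 - x by lra.
have sq : 0 < (x - a) ^+ 2 by rewrite exprn_even_gt0//= subr_eq0.
suff : 0 < 2 * KL a x by rewrite pmulr_rgt0.
have [ax|xa'] := leP a x.
  apply: lt_le_trans (KL_ge_var a01 _); last by rewrite ax.
  by sign_tac.
apply: lt_le_trans (KL_ge_chi2 a01 _); last by rewrite x0 ltW.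
by sign_tac.
Qed.

Lemma KL_rev a x : KL (1 - a) (1 - x) = KL a x.
Proof. by rewrite /KL !subKr addrC. Qed.

(** The comparison of the binomial distribution function with the normal one
    is governed by this ratio; its monotonicity is what gives the former
    a single crossing. *)
Definition KL_ratio a x := x ^+ 2 * KL a x / (x - a) ^+ 2.

Lemma is_derive_KL_ratio a x : 0 < a < 1 -> 0 < x < 1 -> x != a ->
  is_derive x (1 : R) (KL_ratio a) (x * KL_chi2_gap a x / (x - a) ^+ 3).
Proof.
move=> a01 x01 xa; have /andP[x0 x1] := x01.
have x1' : 0 < 1 - x by rewrite subr_gt0.
have xa0 : x - a != 0 by rewrite subr_eq0.
have d0 := derive_ptB (derive_pt_id x) (derive_pt_cst a x) erefl.
have d1 := derive_ptX (n := 2) d0 erefl.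
have d2 := derive_ptX (n := 2) (derive_pt_id x) erefl.
have d3 := derive_ptM d2 (is_derive_KL a01 x01) erefl.
have xa2 : (x - a) ^+ 2 != 0 by rewrite expf_neq0.
have d := derive_ptM d3 (derive_ptV d1 xa2 erefl) erefl.
apply: (is_derive_eq d); rewrite /KL_chi2_gap/=; field.
by rewrite xa0 !gt_eqF.
Qed.

(** The derivative has the sign of [KL_chi2_gap a x / (x - a) ^ 3]. *)
Lemma KL_ratio_mono a x y : 0 < a < 1 -> 0 < x -> x <= y -> y < 1 ->
  (a < x) || (y < a) -> KL_ratio a x <= KL_ratio a y.
Proof.
move=> a01 x0 xy y1 side; have [a0 a1] : 0 < a /\ 0 < 1 - a by lra.
have nz z : x <= z <= y -> z != a.
  move=> /andP[xz zy]; case/orP: side => h.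
    by rewrite gt_eqF// (lt_le_trans h).
  by rewrite lt_eqF// (le_lt_trans zy).
have z01 z : x <= z <= y -> 0 < z < 1 by move=> /andP[xz zy]; lra.
have sub z : x < z < y -> x <= z <= y by move=> /andP[/ltW-> /ltW->].
apply: (@is_derive_ge0_le _ _
  (fun x => x * KL_chi2_gap a x / (x - a) ^+ 3)).
- by [].
- by move=> z /sub h; exact: is_derive_KL_ratio a01 (z01 z h) (nz z h).
- move=> z h; apply: is_derive1_continuous.
  exact: is_derive_KL_ratio a01 (z01 z h) (nz z h).
- move=> z /sub h; have /andP[z0 z1] := z01 _ h.
  rewrite -mulrA mulr_ge0 ?(ltW z0)// exprS invfM.
  have sq : 0 <= ((z - a) ^+ 2)^-1 by rewrite invr_ge0 sqr_ge0.
  rewrite mulrA mulr_ge0//; case/orP: side => hs; case/andP: h => xz zy.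
    have az : a <= z by rewrite (le_trans (ltW hs)).
    apply: mulr_ge0; last by rewrite invr_ge0 subr_ge0.
    by rewrite -(KL_chi2_gap_refl a01) KL_chi2_gap_mono//; lra.
  have az : z <= a by rewrite (le_trans zy (ltW hs)).
  apply: mulr_le0; last by rewrite invr_le0 subr_le0.
  by rewrite -(KL_chi2_gap_refl a01) KL_chi2_gap_mono//; lra.
Qed.

End RelativeEntropy.

(** * Normal bounds for the binomial distribution function *)

Section ZubkovSerov.
Context {R : realType}.
Variables (l k : nat) (a : R).
Hypothesis l_gt0 : (0 < l)%N.
Hypothesis l_lt_k : (l < k)%N.
Hypothesis ka : k%:R * a = l%:R.
Implicit Types x y z s c u v e : R.

Let k_gt0 : 0 < k%:R :> R.
Proof. by rewrite ltr0n (ltn_trans l_gt0). Qed.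

Let a_gt0 : 0 < a. Proof. by rewrite -(pmulr_rgt0 _ k_gt0) ka ltr0n. Qed.

Let a_lt1 : 0 < 1 - a.
Proof. by rewrite subr_gt0 -(ltr_pM2l k_gt0) mulr1 ka ltr_nat. Qed.

Let a01 : 0 < a < 1. Proof. by rewrite a_gt0 -subr_gt0 a_lt1. Qed.

Let ka' : k%:R * (1 - a) = (k - l)%:R.
Proof. by rewrite mulrBr mulr1 ka natrB// ltnW. Qed.

(** Likelihood ratio of the success probabilities [x] and [a] at [l] successes. *)
Let expR_KL x : 0 < x < 1 -> expR (- (k%:R * KL a x)) =
  x ^+ l * (1 - x) ^+ (k - l) / (a ^+ l * (1 - a) ^+ (k - l)).
Proof.
move=> /andP[x0 x1]; have x1' : 0 < 1 - x by rewrite subr_gt0.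
rewrite /KL mulrDr !mulrA ka ka' opprD expRD -!mulrN -!lnV ?posrE ?divr_gt0//.
rewrite !invf_div !expRM_natl !lnK ?posrE ?divr_gt0// !expr_div_n.
by rewrite mulrACA invfM.
Qed.

Let Kc : R := k%:R * (1 - a) * binp a k.-1 l.

Let Kc_gt0 : 0 < Kc.
Proof.
apply: mulr_gt0; first exact: mulr_gt0.
by apply: binp_gt0 => //; lia.
Qed.

Let binp_Kc x : 0 < x < 1 ->
  k%:R * binp x k.-1 l = Kc * expR (- (k%:R * KL a x)) / (1 - x).
Proof.
move=> x01; have /andP[x0 x1] := x01.
have x1' : 0 < 1 - x by rewrite subr_gt0.
rewrite expR_KL// /Kc /binp.
have -> : (k - l = (k.-1 - l).+1)%N by lia.
rewrite !exprS; field.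
by rewrite !expf_neq0 ?gt_eqF.
Qed.

(** The argument of [Phi] is [sqrt k * S x * (x - a) / x] up to sign; [S] is
    monotone on each side of [a] and separated by its limit [J0] there. *)
Let S x : R := Num.sqrt (2 * KL_ratio a x).
Let J0 : R := Num.sqrt (a / (1 - a)).
Let T : R := phi0 * Num.sqrt k%:R.

Let T_gt0 : 0 < T. Proof. by rewrite mulr_gt0 ?phi0_gt0 ?sqrtr_gt0. Qed.
Let J0_gt0 : 0 < J0. Proof. by rewrite sqrtr_gt0 divr_gt0. Qed.

Let w x : R := Num.sqrt (2 * k%:R * KL a x).

Let w_S x : 0 < x < 1 -> x != a ->
  w x = Num.sqrt k%:R * S x * (`|x - a| / x).
Proof.
move=> x01 xa; have /andP[x0 x1] := x01.
have e : `|x - a| / x = Num.sqrt (((x - a) / x) ^+ 2).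
  by rewrite sqrtr_sqr normrM normfV [`|x|]gtr0_norm.
have r0 : 0 <= 2 * KL_ratio a x.
  by have := KL_gt0 a01 x01 xa; rewrite /KL_ratio; move=> ?; sign_tac.
have kr0 : 0 <= k%:R * (2 * KL_ratio a x) by rewrite mulr_ge0 ?(ltW k_gt0).
rewrite /w /S e -(sqrtrM _ (ltW k_gt0)) -(sqrtrM _ kr0); congr Num.sqrt.
rewrite /KL_ratio; field.
by rewrite subr_eq0 xa gt_eqF.
Qed.

Let S_gt0 x : 0 < x < 1 -> x != a -> 0 < S x.
Proof.
move=> x01 xa; have /andP[x0 x1] := x01.
rewrite sqrtr_gt0 mulr_gt0// /KL_ratio divr_gt0//.
  by rewrite mulr_gt0 ?exprn_gt0// KL_gt0.
by rewrite exprn_even_gt0//= subr_eq0.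
Qed.

Let S_right x : a < x -> x < 1 -> J0 <= S x.
Proof.
move=> ax x1; have x0 : 0 < x by rewrite (lt_trans a_gt0).
have /(KL_ge_var a01) h : a <= x < 1 by rewrite (ltW ax).
rewrite ler_wsqrtr// /KL_ratio.
have r0 : 0 <= x ^+ 2 / (x - a) ^+ 2 by rewrite divr_ge0 ?sqr_ge0.
have := ler_wpM2r r0 h; congr (_ <= _); last by ring.
have n1 : x - a != 0 by rewrite subr_eq0 gt_eqF.
by field; rewrite n1 !gt_eqF.
Qed.

Let S_left x : 0 < x -> x < a -> S x <= J0.
Proof.
move=> x0 xa; have /(KL_le_var a01) h : 0 < x <= a by rewrite x0 ltW.
rewrite ler_wsqrtr// /KL_ratio.
have r0 : 0 <= x ^+ 2 / (x - a) ^+ 2 by rewrite divr_ge0 ?sqr_ge0.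
have := ler_wpM2r r0 h; congr (_ <= _); first by ring.
have n1 : x - a != 0 by rewrite subr_eq0 lt_eqF.
by field; rewrite n1 !gt_eqF.
Qed.

Let S_mono x y : 0 < x -> x <= y -> y < 1 -> (a < x) || (y < a) -> S x <= S y.
Proof. by move=> x0 xy y1 h; rewrite ler_wsqrtr// ler_pM2l// KL_ratio_mono. Qed.

(** The two branches, [s = 1] right of [a] and [s = -1] left of [a], of the
    normal approximation, whose difference [H] to the binomial distribution
    function, for [c = 1], is to be shown nonnegative. The factor [c] serves
    [binp_peak_bounds], where it is chosen so that [H] is monotone on a whole
    side of [a]. *)
Let G (s : R) x : R := Phi (- (s * w x)).
Let H (s c : R) x : R := bcdf x k l - c * G s x.
Let dH (c x : R) : R :=
  expR (- (k%:R * KL a x)) / ((1 - x) * S x) * (c * T - Kc * S x).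

Let w_cont x : 0 < x < 1 -> {for x, continuous w}.
Proof.
move=> x01; apply: (continuous_comp (f := fun x => 2 * k%:R * KL a x)).
  by apply: cvgM; [exact: cvg_cst|exact: KL_continuous].
exact: sqrt_continuous.
Qed.

Let H_cont s c x : 0 < x < 1 -> {for x, continuous (H s c)}.
Proof.
move=> x01; apply: cvgB.
  exact: is_derive1_continuous (is_derive_bcdf x k l).
apply: cvgM; first exact: cvg_cst.
apply: (continuous_comp (f := fun x => - (s * w x))); last exact: continuous_Phi.
by apply: cvgN; apply: cvgM; [exact: cvg_cst|exact: w_cont].
Qed.

Let H_derive s c x : 0 < x < 1 -> s * `|x - a| = x - a -> x != a ->
  s * s = 1 -> is_derive x (1 : R) (H s c) (dH c x).
Proof.
move=> x01 sx xa ss; have /andP[x0 x1] := x01.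
have x1' : 0 < 1 - x by rewrite subr_gt0.
have KLp : 0 < 2 * k%:R * KL a x by rewrite mulr_gt0 ?mulr_gt0 ?KL_gt0.
have wp : 0 < w x by rewrite sqrtr_gt0.
have dw : is_derive x (1 : R) w (k%:R * ((x - a) / (x * (1 - x))) / w x).
  have ds := is_derive1_sqrt KLp.
  have dk := derive_ptZ (k := 2 * k%:R) (is_derive_KL a01 x01) erefl.
  have d := derive_pt_comp (g := fun x => 2 * k%:R * KL a x) ds dk erefl.
  apply: (is_derive_eq d); rewrite -/(w x); field.
  by rewrite !gt_eqF.
have dG := derive_pt_comp (g := fun x => - (s * w x)) (is_derive_Phi _)
  (derive_ptN (derive_ptZ (k := s) dw erefl) erefl) erefl.
have d := derive_ptB (is_derive_bcdf x k l) (derive_ptZ (k := c) dG erefl) erefl.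
apply: (is_derive_eq d).
have phiw : phi (- (s * w x)) = phi0 * expR (- (k%:R * KL a x)).
  rewrite /phi -/phi0 sqrrN exprMn [s ^+ 2]expr2 ss mul1r /w sqr_sqrtr ?ltW//.
  by congr (_ * expR (- _)); field.
rewrite phiw binp_Kc// /dH w_S// /T -[X in k%:R * (X / _)]sx.
have kk : k%:R = Num.sqrt k%:R * Num.sqrt k%:R :> R by rewrite -expr2 sqr_sqrtr// ltW.
rewrite {3}kk.
have nx : `|x - a| != 0 by rewrite normr_eq0 subr_eq0.
have Sx := S_gt0 x01 xa; have sk : 0 < Num.sqrt k%:R :> R by rewrite sqrtr_gt0.
have sse : s ^+ 2 = 1 by rewrite expr2.
field: sse.
by rewrite nx !gt_eqF.
Qed.

Let dH_sign x : 0 < x < 1 -> x != a ->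
  0 <= expR (- (k%:R * KL a x)) / ((1 - x) * S x).
Proof.
move=> x01 xa; have Sx := S_gt0 x01 xa; have /andP[x0 x1] := x01.
have x1' : 0 < 1 - x by rewrite subr_gt0.
by have := expR_gt0 (- (k%:R * KL a x)) => ?; sign_tac.
Qed.

Let H_le s c u v : 0 < u -> u <= v -> v < 1 -> s * s = 1 ->
  (forall x, u < x < v -> s * `|x - a| = x - a /\ x != a) ->
  (forall x, u < x < v -> Kc * S x <= c * T) -> H s c u <= H s c v.
Proof.
move=> u0 uv v1 ss side dp.
have x01 x : u <= x <= v -> 0 < x < 1.
  by move=> /andP[ux xv]; rewrite (lt_le_trans u0)// (le_lt_trans xv).
have sub x : u < x < v -> u <= x <= v by move=> /andP[/ltW-> /ltW->].
apply: (@is_derive_ge0_le _ _ (dH c)).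
- by [].
- by move=> x h; have [sx xa] := side x h; exact: H_derive (x01 x (sub x h)) sx xa ss.
- by move=> x h; exact: H_cont (x01 x h).
- move=> x h; have [sx xa] := side x h.
  by rewrite mulr_ge0 ?subr_ge0 ?dp// dH_sign// (x01 x (sub x h)).
Qed.

Let H_ge s c u v : 0 < u -> u <= v -> v < 1 -> s * s = 1 ->
  (forall x, u < x < v -> s * `|x - a| = x - a /\ x != a) ->
  (forall x, u < x < v -> c * T <= Kc * S x) -> H s c v <= H s c u.
Proof.
move=> u0 uv v1 ss side dp.
have x01 x : u <= x <= v -> 0 < x < 1.
  by move=> /andP[ux xv]; rewrite (lt_le_trans u0)// (le_lt_trans xv).
have sub x : u < x < v -> u <= x <= v by move=> /andP[/ltW-> /ltW->].
apply: (@is_derive_le0_ge _ _ (dH c)).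
- by [].
- by move=> x h; have [sx xa] := side x h; exact: H_derive (x01 x (sub x h)) sx xa ss.
- by move=> x h; exact: H_cont (x01 x h).
- move=> x h; have [sx xa] := side x h.
  by rewrite mulr_ge0_le0 ?subr_le0 ?dp// dH_sign// (x01 x (sub x h)).
Qed.

Let near_0 (e : R) : 0 < e -> exists2 y : R, 0 < y & forall z, 0 < z <= y -> 1 - e < bcdf z k l.
Proof.
move=> e0.
have bc : bcdf z k l @[z --> (0 : R)] --> bcdf 0 k l.
  exact: is_derive1_continuous (is_derive_bcdf 0 k l).
move/cvgrPdist_lt: bc => /(_ e e0)[d /= d0 hd].
have b0 : bcdf 0 k l = 1 :> R.
  rewrite /bcdf big_ord_recl big1 => [|j _].
    by rewrite addr0 /binp bin0 expr0 subr0 expr1n !mulr1.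
  by rewrite /binp exprS mul0r mul0r mulr0.
exists (d / 2); first by rewrite divr_gt0.
move=> z /andP[z0 zd]; have := hd z.
rewrite /ball_/= sub0r normrN gtr0_norm// b0 ltr_norml => /(_ _)/andP[]; lra.
Qed.

Let near_1 (e : R) : 0 < e -> exists2 y, y < 1 & forall z, y <= z < 1 -> Phi (- w z) < e.
Proof.
move=> e0; have [M HM] := @Phi_small R e e0.
pose P (y : R) : R := y ^+ l * (1 - y) ^+ (k - l) / (a ^+ l * (1 - a) ^+ (k - l)).
have P1 : P 1 = 0.
  have kl : (0 < k - l)%N by rewrite subn_gt0.
  by rewrite /P subrr expr0n gtn_eqF//= mulr0n mulr0 mul0r.
have Pc : P z @[z --> (1 : R)] --> P 1.
  apply: cvgM; last exact: cvg_cst.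
  apply: cvgM; first exact: exprn_continuous.
  exact: is_derive1_continuous (derive_ptX (n := k - l)
    (derive_ptB (derive_pt_cst 1 1) (derive_pt_id 1) erefl) erefl).
have m0 : 0 < expR (- (M ^+ 2 / 2)) by exact: expR_gt0.
move/cvgrPdist_lt: Pc => /(_ _ m0)[d /= d0 hd].
exists (Num.max (1 - d / 2) 2^-1); first by rewrite gt_max; lra.
move=> z /andP[]; rewrite ge_max => /andP[dz z2] z1.
have z01 : 0 < z < 1 by lra.
have := hd z; rewrite /ball_/= P1 sub0r normrN => /(_ _).
have -> : P z = expR (- (k%:R * KL a z)) by rewrite expR_KL.
rewrite [`|expR _|]gtr0_norm ?expR_gt0// ltr_expR ltrN2 => h.
have zd : `|1 - z| < d by rewrite gtr0_norm; lra.
have {}h := h zd.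
apply: HM; rewrite lerNl.
have [M0|M0] := leP 0 M; first by apply: (@le_trans _ _ 0); rewrite ?oppr_le0// sqrtr_ge0.
rewrite -[leLHS]gtr0_norm ?oppr_gt0// -sqrtr_sqr sqrrN ler_wsqrtr//.
by move: h; rewrite ltr_pdivrMr//; lra.
Qed.

Let right_side u v : a <= u -> forall x, u < x < v -> 1 * `|x - a| = x - a /\ x != a.
Proof.
move=> au x /andP[ux _]; have ax : a < x by exact: le_lt_trans ux.
by rewrite mul1r gtr0_norm ?subr_gt0// gt_eqF.
Qed.

Let left_side u v : v <= a -> forall x, u < x < v -> -1 * `|x - a| = x - a /\ x != a.
Proof.
move=> va x /andP[_ xv]; have ax : x < a by exact: lt_le_trans va.
by rewrite ltr0_norm ?subr_lt0// mulN1r opprK lt_eqF.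
Qed.

Let w_a : w a = 0.
Proof. by rewrite /w KL_refl// mulr0 sqrtr0. Qed.

Let H_a s c : H s c a = bcdf a k l - c / 2.
Proof. by rewrite /H /G w_a mulr0 oppr0 Phi0. Qed.

Let H_left_end c e : 0 <= c -> 0 < e -> exists2 y, 0 < y & forall z, 0 < z <= y ->
  1 - c - e < H (-1) c z.
Proof.
move=> c0 /near_0[y y0 hy]; exists y => // z hz; have := hy z hz.
rewrite /H; have : c * G (-1) z <= c by rewrite ler_piMr// Phi_le1.
lra.
Qed.

Let H_right_end c e : 0 <= c -> 0 < e -> exists2 y, y < 1 & forall z, y <= z < 1 ->
  0 < z -> - (c * e) <= H 1 c z.
Proof.
move=> c0 /near_1[y y0 hy]; exists y => // z hz z0; have := hy z hz.
have z01 : 0 <= z <= 1 by case/andP: hz => _ /ltW->; rewrite ltW.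
have := bcdf_ge0 k l z01; rewrite /H /G mul1r => b0 h.
have := ler_wpM2l c0 (ltW h); lra.
Qed.

(** If the derivative is nonnegative all the way down to [0], then [H] is at least
    its limit [0] there. *)
Let H_ge0_by_left x : 0 < x <= a ->
  (forall y, 0 < y < x -> Kc * S y <= T) -> 0 <= H (-1) 1 x.
Proof.
move=> /andP[x0 xa] d; apply/ler_addgt0Pl => e e0.
have [y y0 hy] := H_left_end ler01 e0.
pose z := Num.min x y.
have z0 : 0 < z by rewrite lt_min x0.
have zy : 0 < z <= y by rewrite z0 ge_min lexx orbT.
have zx : z <= x by rewrite ge_min lexx.
have : H (-1) 1 z <= H (-1) 1 x.
  have x1 : x < 1 by rewrite (le_lt_trans xa)// -subr_gt0.
  apply: H_le => //.
  - by rewrite mulrNN mulr1.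
  - exact: left_side xa.
  - by move=> t /andP[zt tx]; rewrite mul1r d// tx (lt_trans z0).
have := hy z zy; rewrite subrr sub0r => /ltW hz h.
by rewrite -lerBlDl sub0r (le_trans hz).
Qed.

(** Symmetrically, if the derivative is nonpositive all the way up to [1]. *)
Let H_ge0_by_right x : a <= x < 1 ->
  (forall y, x < y < 1 -> T <= Kc * S y) -> 0 <= H 1 1 x.
Proof.
move=> /andP[ax x1] d; apply/ler_addgt0Pl => e e0.
have [y y1 hy] := H_right_end ler01 e0.
pose z := Num.max x y.
have z1 : z < 1 by rewrite gt_max x1.
have zy : y <= z < 1 by rewrite z1 le_max lexx orbT.
have zx : x <= z by rewrite le_max lexx.
have x0 : 0 < x by exact: lt_le_trans ax.
have : H 1 1 z <= H 1 1 x.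
  apply: H_ge => //; first by rewrite mulr1.
  - exact: right_side ax.
  - by move=> t /andP[xt tz]; rewrite mul1r d// xt (lt_trans tz).
have := hy z zy (lt_le_trans x0 zx); rewrite mul1r => hz h.
by rewrite -lerBlDl sub0r (le_trans hz).
Qed.

(** [Kc * S] compares with [T] in the same way on at least one whole side of
    [a], according to the sign of [Kc * J0 - T]. *)
Let H_ge0_a : 0 <= H 1 1 a.
Proof.
have [h|h] := leP (Kc * J0) T.
  rewrite H_a -(H_a (-1)); apply: H_ge0_by_left; first by rewrite a_gt0 lexx.
  by move=> y /andP[y0 ya]; apply: le_trans h; rewrite ler_pM2l// S_left.
apply: H_ge0_by_right; first by rewrite lexx -subr_gt0.
move=> y /andP[ay y1]; apply: (le_trans (ltW h)).
by rewrite ler_pM2l// S_right.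
Qed.

(** As [S] is monotone left of [a], either the derivative has the good sign
    between [0] and [x], or it has the opposite one between [x] and [a]; in both
    cases [H] is compared with a point where it is known to be nonnegative. *)
Let H_ge0_left x : 0 < x <= a -> 0 <= H (-1) 1 x.
Proof.
move=> /andP[x0 xa].
have [->|xna] := eqVneq x a; first by rewrite H_a -(H_a 1) H_ge0_a.
have xlt : x < a by rewrite lt_neqAle xna.
have [h|h] := leP (Kc * S x) T.
  apply: H_ge0_by_left; first by rewrite x0.
  move=> y /andP[y0 yx]; apply: le_trans h; rewrite ler_pM2l// S_mono ?ltW//.
    by rewrite (lt_trans xlt)// -subr_gt0.
  by rewrite xlt orbT.
apply: (@le_trans _ _ (H (-1) 1 a)); first by rewrite H_a -(H_a 1) H_ge0_a.
apply: H_ge => //; first by rewrite -subr_gt0.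
- by rewrite mulrNN mulr1.
- exact: left_side.
- move=> y /andP[xy ya]; rewrite mul1r; apply: (le_trans (ltW h)).
  rewrite ler_pM2l// S_mono ?(ltW xy)//; first by rewrite (lt_trans ya)// -subr_gt0.
  by rewrite ya orbT.
Qed.

Let H_ge0_right x : a <= x < 1 -> 0 <= H 1 1 x.
Proof.
move=> /andP[ax x1].
have [->|xna] := eqVneq x a; first exact: H_ge0_a.
have xlt : a < x by rewrite lt_neqAle eq_sym xna.
have x0 : 0 < x by exact: lt_trans xlt.
have [h|h] := leP (Kc * S x) T.
  apply: (le_trans H_ge0_a); apply: H_le => //; first by rewrite mulr1.
  - exact: right_side.
  - move=> y /andP[ay yx]; rewrite mul1r; apply: le_trans h.
    by rewrite ler_pM2l// S_mono ?(ltW yx) ?ay// (lt_trans a_gt0).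
apply: H_ge0_by_right; first by rewrite ax.
move=> y /andP[xy y1]; apply: (le_trans (ltW h)).
by rewrite ler_pM2l// S_mono ?(ltW xy) ?xlt.
Qed.

(** Lower half of the Zubkov-Serov inequality. As a function of the success
    probability, the difference of the two sides vanishes at both ends, is
    nonnegative at [a], and increases before it decreases on each side of [a]. *)
Lemma Phi_le_bcdf_at x : 0 < x < 1 ->
  Phi (Num.sg (a - x) * Num.sqrt (2 * k%:R * KL a x)) <= bcdf x k l.
Proof.
move=> /andP[x0 x1]; rewrite -subr_ge0.
have [xa|ax] := ltP x a.
  have h : 0 < x <= a by rewrite x0 ltW.
  by have := H_ge0_left h; rewrite /H /G mul1r mulN1r opprK gtr0_sg ?subr_gt0// mul1r.
have h : a <= x < 1 by rewrite ax.
have := H_ge0_right h; rewrite /H /G !mul1r.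
have [->|xna] := eqVneq x a.
  by rewrite -/(w a) w_a oppr0 subrr mulr0.
by rewrite ltr0_sg ?mulN1r// subr_lt0 lt_neqAle eq_sym xna.
Qed.

Let c0 : R := Kc * J0 / T.

(** With the factor [c] in front of the normal distribution function the
    derivative of [H] tends to zero at [a] and has a constant sign on each side of
    [a]. Comparing the value at [a] with the two limits pins [c] between the two
    halves of the distribution. *)
Lemma binp_peak_bounds :
  let c := k%:R * (1 - a) * binp a k.-1 l * Num.sqrt (a / (1 - a)) /
             (phi0 * Num.sqrt k%:R) in
  2 * (1 - bcdf a k l) <= c <= 2 * bcdf a k l.
Proof.
rewrite /= -/Kc -/J0 -/T -/c0.
have c0p : 0 < c0 by rewrite divr_gt0// mulr_gt0.
have cT : c0 * T = Kc * J0 by rewrite /c0 divfK// gt_eqF.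
apply/andP; split.
  suff : 1 - c0 <= H (-1) c0 a by rewrite H_a; lra.
  apply/ler_addgt0Pl => e e0.
  have [y y0 hy] := H_left_end (ltW c0p) e0.
  pose z := Num.min a y.
  have z0 : 0 < z by rewrite lt_min a_gt0.
  have zy : 0 < z <= y by rewrite z0 ge_min lexx orbT.
  have za : z <= a by rewrite ge_min lexx.
  have : H (-1) c0 z <= H (-1) c0 a.
    apply: H_le => //; first by rewrite -subr_gt0.
    - by rewrite mulrNN mulr1.
    - exact: left_side.
    - move=> t /andP[zt ta].
      by rewrite cT ler_pM2l// S_left// (lt_trans z0).
  by move=> h; rewrite -lerBlDl (le_trans (ltW (hy z zy))).
suff : 0 <= H 1 c0 a by rewrite H_a; lra.
apply/ler_addgt0Pl => e e0.
have ec0 : 0 < e / c0 by rewrite divr_gt0.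
have [y y1 hy] := H_right_end (ltW c0p) ec0.
pose z := Num.max a y.
have z1 : z < 1 by rewrite gt_max y1 -subr_gt0 a_lt1.
have zy : y <= z < 1 by rewrite z1 le_max lexx orbT.
have za : a <= z by rewrite le_max lexx.
have : H 1 c0 z <= H 1 c0 a.
  apply: H_ge => //; first by rewrite mulr1.
  - exact: right_side.
  - move=> t /andP[at_ tz].
    by rewrite cT ler_pM2l// S_right// (lt_trans tz).
have := hy z zy (lt_le_trans a_gt0 za).
rewrite mulrCA divff ?gt_eqF// mulr1 => hz h.
by rewrite -lerBlDl sub0r (le_trans hz).
Qed.

Lemma binp_tilt x : 0 < x < 1 ->
  k%:R * binp x k.-1 l =
  k%:R * (1 - a) * binp a k.-1 l * expR (- (k%:R * KL a x)) / (1 - x).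
Proof. exact: binp_Kc. Qed.

End ZubkovSerov.

(** * Normal approximation of counts *)

Section NormalBounds.
Context {R : realType}.
Implicit Types (x : R) (k l : nat).

(** Signed root of the scaled relative entropy: the argument at which the normal
    distribution function sandwiches the binomial one. *)
Definition zdev k l x : R :=
  Num.sg (l%:R / k%:R - x) * Num.sqrt (2 * k%:R * KL (l%:R / k%:R) x).

Lemma bcdf_ge_Phi k l x : (0 < l < k)%N -> 0 < x < 1 ->
  Phi (zdev k l x) <= bcdf x k l.
Proof.
move=> /andP[l0 lk] x01; apply: Phi_le_bcdf_at => //.
by rewrite mulrC divfK// pnatr_eq0 -lt0n (ltn_trans l0).
Qed.

(** The other half follows by exchanging successes and failures. *)
Lemma bcdf_le_Phi k l x : (l.+1 < k)%N -> 0 < x < 1 ->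
  bcdf x k l <= Phi (zdev k l.+1 x).
Proof.
move=> lk x01; have k0 : k%:R != 0 :> R by rewrite pnatr_eq0; lia.
have x01' : 0 < 1 - x < 1 by lra.
have lk' : (0 < k - l.+1 < k)%N by lia.
have := bcdf_ge_Phi lk' x01'.
have -> : zdev k (k - l.+1) (1 - x) = - zdev k l.+1 x.
  rewrite /zdev natrB; last by lia.
  have -> : (k%:R - l.+1%:R) / k%:R = 1 - l.+1%:R / k%:R :> R.
    by rewrite mulrBl divff.
  have -> : 1 - l.+1%:R / k%:R - (1 - x) = - (l.+1%:R / k%:R - x) by ring.
  by rewrite KL_rev sgrN mulNr.
by rewrite Phi_opp (@bcdf_rev _ x k l)//; [lra|lia].
Qed.

(** From the quadratic upper bound [KL_le_var] on the relative entropy. *)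
Lemma zdev_le k l x : (0 < l < k)%N -> 0 < x < 1 -> x <= l%:R / k%:R ->
  zdev k l x <= Num.sqrt (k%:R * (l%:R / (k - l)%:R)) * ((l%:R / k%:R - x) / x).
Proof.
move=> /andP[l0 lk] /andP[x0 x1] xa.
have k0 : 0 < k%:R :> R by rewrite ltr0n; lia.
have kl0 : 0 < (k - l)%:R :> R by rewrite ltr0n; lia.
have lr0 : 0 < l%:R :> R by rewrite ltr0n.
have a01 : 0 < (l%:R / k%:R : R) < 1.
  by rewrite divr_gt0// ltr_pdivrMr// mul1r ltr_nat.
have := @KL_le_var _ _ x a01; rewrite x0 xa => /(_ isT) h.
set a := l%:R / k%:R in xa a01 h *.
have ka : l%:R / (k - l)%:R = a / (1 - a).
  rewrite /a natrB; last by lia.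
  field; rewrite gt_eqF// -natrB; last by lia.
  by rewrite gt_eqF.
have r0 : 0 <= k%:R * (l%:R / (k - l)%:R) :> R by sign_tac.
have e : (a - x) / x = Num.sqrt (((x - a) / x) ^+ 2).
  by rewrite sqrtr_sqr normrM normfV [`|x|]gtr0_norm// distrC ger0_norm// subr_ge0.
rewrite e -sqrtrM// /zdev -/a.
apply: (@le_trans _ _ (Num.sqrt (2 * k%:R * KL a x))).
  rewrite -[leRHS]mul1r ler_wpM2r ?sqrtr_ge0//.
  by case: sgrP => //; lra.
rewrite ler_wsqrtr// ka.
have := ler_wpM2l (ltW k0) h; congr (_ <= _); first by ring.
by field; rewrite !gt_eqF//; lra.
Qed.

(** The factor by which the binomial mass at its peak differs from the
    normal density. *)
Definition peak_factor k l : R :=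
  k%:R * (1 - l%:R / k%:R) * binp (l%:R / k%:R) k.-1 l *
    Num.sqrt ((l%:R / k%:R) / (1 - l%:R / k%:R)) / (phi0 * Num.sqrt k%:R).

(** At success probability [l / k] the lower normal bound is exactly [1 / 2] and
    the upper one exceeds it by at most the argument of [Phi], which is of order
    [1 / sqrt k]. *)
Lemma peak_factor_near1 k l : (0 < l)%N -> (l.+1 < k)%N ->
  `|peak_factor k l - 1| <=
    2 * (Num.sqrt (k%:R * (l.+1%:R / (k - l.+1)%:R)) / l%:R).
Proof.
move=> l0 lk; have k0 : 0 < k%:R :> R by rewrite ltr0n; lia.
have lr0 : 0 < l%:R :> R by rewrite ltr0n.
have lk1 : (l < k)%N by lia.
have ka : k%:R * (l%:R / k%:R) = l%:R :> R by rewrite mulrC divfK// gt_eqF.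
have a01 : 0 < (l%:R / k%:R : R) < 1.
  by rewrite divr_gt0// ltr_pdivrMr// mul1r ltr_nat.
have /= /andP[] := binp_peak_bounds l0 lk1 ka.
rewrite -/(peak_factor k l).
have lb : 2^-1 <= bcdf (l%:R / k%:R) k l :> R.
  have := @bcdf_ge_Phi k l (l%:R / k%:R); rewrite l0 lk1 => /(_ isT a01).
  by rewrite /zdev subrr sgr0 mul0r Phi0.
have ub := bcdf_le_Phi lk a01.
have := @zdev_le k l.+1 _ _ a01; rewrite lk /= => /(_ isT).
rewrite ler_pM2r ?invr_gt0// ler_nat leqnSn => /(_ isT).
have -> : (l.+1%:R / k%:R - l%:R / k%:R) / (l%:R / k%:R) = l%:R^-1 :> R.
  by rewrite -natr1; field; rewrite !gt_eqF.
move=> z; have z0 : 0 <= zdev k l.+1 (l%:R / k%:R) :> R.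
  rewrite /zdev gtr0_sg ?mul1r ?sqrtr_ge0// subr_gt0 ltr_pM2r ?invr_gt0//.
  by rewrite ltr_nat.
have := @Phi_lipschitz R (zdev k l.+1 (l%:R / k%:R)) 0.
rewrite Phi0 subr0 (ger0_norm z0) ler_norml => /andP[_ zl] c1 c2.
set W := Num.sqrt _ / _ in z *.
by rewrite ler_norml; apply/andP; split; lra.
Qed.

(** Tilting from [l / k] to [x] multiplies the local probability by the very
    exponential that [phi] has at [zdev]. *)
Lemma binp_normal k l x : (0 < l < k)%N -> 0 < x < 1 ->
  binp x k.-1 l = peak_factor k l / Num.sqrt k%:R *
    Num.sqrt ((1 - l%:R / k%:R) / (l%:R / k%:R)) * phi (zdev k l x) / (1 - x).
Proof.
move=> /andP[l0 lk] x01; have k0 : 0 < k%:R :> R by rewrite ltr0n; lia.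
have ka : k%:R * (l%:R / k%:R) = l%:R :> R by rewrite mulrC divfK// gt_eqF.
have a01 : 0 < (l%:R / k%:R : R) < 1.
  by rewrite divr_gt0// ?ltr0n// ltr_pdivrMr// mul1r ltr_nat.
have h := binp_tilt l0 lk ka x01.
apply: (mulfI (lt0r_neq0 k0)); rewrite h /peak_factor {h}.
set a := l%:R / k%:R in a01 *; have /andP[a0 a1] := a01.
have a1' : 0 < 1 - a by rewrite subr_gt0.
have -> : (1 - a) / a = (a / (1 - a))^-1 by rewrite (invf_div a (1 - a)).
rewrite sqrtrV; last exact: divr_ge0 (ltW a0) (ltW a1').
have -> : phi (zdev k l x) = phi0 * expR (- (k%:R * KL a x)).
  rewrite /phi -/phi0 /zdev -/a exprMn sqr_sqrtr; last first.
    by rewrite mulr_ge0 ?mulr_ge0 ?(ltW k0)// KL_ge0 ?a0 ?ltW.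
  have [->|xa] := eqVneq x a.
    by rewrite KL_refl// !mulr0 mul0r.
  rewrite sqr_sg subr_eq0 eq_sym xa mul1r; by congr (_ * expR (- _)); field.
have sk : 0 < Num.sqrt k%:R :> R by rewrite sqrtr_gt0.
have sa : 0 < Num.sqrt (a / (1 - a)) by rewrite sqrtr_gt0 divr_gt0.
have kk : Num.sqrt k%:R ^+ 2 = k%:R :> R by rewrite sqr_sqrtr// ltW.
field: kk.
by rewrite !gt_eqF ?phi0_gt0//; case/andP: x01; lra.
Qed.

End NormalBounds.

(** * Expansions in powers of [1 / sqrt n] *)

Section Expansions.
Context {R : realType}.
Implicit Types (f g : nat -> R) (c e : R) (i j : nat).

Definition tau (n : nat) : R := (Num.sqrt n%:R)^-1.

(** A remainder of order [j] in [1 / sqrt n]; a predicate that composes by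
    lemmas on the index, unlike the Landau equations. *)
Definition Otau j f := exists C : R, \forall n \near \oo, `|f n| <= C * tau n ^+ j.

Lemma tau_gt0 n : (0 < n)%N -> 0 < tau n.
Proof. by move=> n0; rewrite invr_gt0 sqrtr_gt0 ltr0n. Qed.

Lemma tau_ge0 n : 0 <= tau n.
Proof. by rewrite invr_ge0 sqrtr_ge0. Qed.

Lemma tau_le1 n : tau n <= 1.
Proof.
rewrite /tau; case: n => [|n]; first by rewrite sqrtr0 invr0.
rewrite invf_le1 ?sqrtr_gt0 ?ltr0n// -[leLHS]sqrtr1 ler_wsqrtr//.
by rewrite ler1n.
Qed.

Lemma tau_sqr n : tau n ^+ 2 = n%:R^-1.
Proof. by rewrite /tau exprVn sqr_sqrtr// ler0n. Qed.

Lemma sqrt_inv_nat n : Num.sqrt (n%:R^-1 : R) = tau n.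
Proof. by rewrite sqrtrV// ler0n. Qed.

Lemma Otau_ext j f g : (\forall n \near \oo, f n = g n) -> Otau j f -> Otau j g.
Proof.
move=> fg [C hC]; exists C.
by apply: filterS2 fg hC => n ->.
Qed.

Lemma OtauD j f g : Otau j f -> Otau j g -> Otau j (fun n => f n + g n).
Proof.
move=> [C hC] [D hD]; exists (C + D); apply: filterS2 hC hD => n hf hg.
by rewrite mulrDl (le_trans (ler_normD _ _))// lerD.
Qed.

Lemma OtauN j f : Otau j f -> Otau j (fun n => - f n).
Proof. by move=> [C hC]; exists C; apply: filterS hC => n; rewrite normrN. Qed.

Lemma OtauB j f g : Otau j f -> Otau j g -> Otau j (fun n => f n - g n).
Proof. by move=> hf hg; apply: OtauD hf _; exact: OtauN. Qed.

Lemma OtauM i j f g : Otau i f -> Otau j g -> Otau (i + j) (fun n => f n * g n).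
Proof.
move=> [C hC] [D hD]; exists (C * D); apply: filterS2 hC hD => n hf hg.
by rewrite exprD mulrACA normrM ler_pM.
Qed.

Lemma OtauW i j f : (j <= i)%N -> Otau i f -> Otau j f.
Proof.
move=> ji [C hC]; exists `|C|; apply: filterS hC => n hf.
apply: (le_trans hf); apply: (@le_trans _ _ (`|C| * tau n ^+ i)).
  by rewrite ler_wpM2r ?exprn_ge0 ?tau_ge0// ler_norm.
by rewrite ler_wpM2l// ler_wiXn2l ?tau_ge0 ?tau_le1.
Qed.

Lemma Otau_cst c : Otau 0 (fun=> c).
Proof. by exists `|c|; apply: nearW => n; rewrite expr0 mulr1. Qed.

Lemma OtauZ j c f : Otau j f -> Otau j (fun n => c * f n).
Proof. by move=> hf; exact: OtauM (Otau_cst c) hf. Qed.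

Lemma Otau_tauX j : Otau j (fun n => tau n ^+ j).
Proof.
exists 1; apply: nearW => n.
by rewrite mul1r ger0_norm// exprn_ge0// tau_ge0.
Qed.

Lemma Otau_tau : Otau 1 tau.
Proof. by have := Otau_tauX 1; apply: Otau_ext; apply: nearW => n; rewrite expr1. Qed.

Lemma Otau_inv_nat : Otau 2 (fun n => n%:R^-1).
Proof. by have := Otau_tauX 2; apply: Otau_ext; apply: nearW => n; rewrite tau_sqr. Qed.

Lemma Otau_div_tau j f : Otau j.+1 f -> Otau j (fun n => f n / tau n).
Proof.
move=> [C hC]; exists C; apply: filterS2 (nbhs_infty_gt 0) hC => n n0 hf.
have t0 := tau_gt0 n0.
rewrite normrM normfV (gtr0_norm t0) ler_pdivrMr// (le_trans hf)//.
by rewrite exprSr mulrA.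
Qed.

Lemma tau_near_lt e : 0 < e -> \forall n \near \oo, tau n < e.
Proof.
move=> e0; near=> n.
have n0 : (0 < n)%N by near: n; exact: nbhs_infty_gt.
rewrite /tau invf_plt ?posrE ?sqrtr_gt0 ?ltr0n// -[ltLHS]gtr0_norm ?invr_gt0//.
rewrite -sqrtr_sqr ltr_sqrt ?ltr0n//.
by near: n; exact: nbhs_infty_gtr.
Unshelve. all: by end_near. Qed.

Lemma Otau_near_lt f e : Otau 1 f -> 0 < e -> \forall n \near \oo, `|f n| < e.
Proof.
move=> [C hC] e0; have C0 : 0 < `|C| + 1 by rewrite ltr_wpDl.
have := tau_near_lt (divr_gt0 e0 C0).
apply: filterS2 hC => n hf; rewrite ltr_pdivlMr// mulrC; apply: le_lt_trans.
apply: (le_trans hf); rewrite expr1 ler_wpM2r ?tau_ge0//.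
by rewrite (le_trans (ler_norm _))// lerDl.
Qed.

Lemma Otau_bounded f c : Otau 1 (fun n => f n - c) -> Otau 0 f.
Proof.
move=> h; have := OtauD (OtauW (leq0n 1) h) (Otau_cst c).
by apply: Otau_ext; apply: nearW => n; rewrite subrK.
Qed.

Lemma Otau_mul_approx j f g c d : Otau j (fun n => f n - c) ->
  Otau j (fun n => g n - d) -> Otau 0 g ->
  Otau j (fun n => f n * g n - c * d).
Proof.
move=> hf hg g0.
have h1 : Otau j (fun n => (f n - c) * g n) by have := OtauM hf g0; rewrite addn0.
have := OtauD h1 (OtauZ c hg); apply: Otau_ext; apply: nearW => n; ring.
Qed.

Lemma near_far0 f c : c != 0 -> Otau 1 (fun n => f n - c) ->
  \forall n \near \oo, `|c| / 2 <= `|f n|.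
Proof.
move=> c0 h; have c20 : 0 < `|c| / 2 by rewrite divr_gt0 ?normr_gt0.
apply: filterS (Otau_near_lt h c20) => n hf.
have := ler_normB (f n) (f n - c); rewrite opprB addrC subrK; lra.
Qed.

Lemma Otau_inv f c : c != 0 -> Otau 1 (fun n => f n - c) -> Otau 0 (fun n => (f n)^-1).
Proof.
move=> c0 h; have c20 : 0 < `|c| / 2 by rewrite divr_gt0 ?normr_gt0.
exists (`|c| / 2)^-1; apply: filterS (near_far0 c0 h) => n hf.
by rewrite expr0 mulr1 normfV lef_pV2 ?posrE// (lt_le_trans c20).
Qed.

Lemma Otau_inv_approx f c : c != 0 -> Otau 1 (fun n => f n - c) ->
  Otau 1 (fun n => (f n)^-1 - c^-1).
Proof.
move=> c0 h; have c20 : 0 < `|c| / 2 by rewrite divr_gt0 ?normr_gt0.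
have hi := Otau_inv c0 h.
have := OtauM (OtauZ (- c^-1) h) hi; rewrite addn0; apply: Otau_ext.
apply: filterS (near_far0 c0 h) => n hf.
have fn0 : f n != 0 by rewrite -normr_gt0 (lt_le_trans c20).
by field; rewrite c0 fn0.
Qed.

Lemma Otau_sqrt_approx f c : 0 < c -> Otau 1 (fun n => f n - c) ->
  Otau 1 (fun n => Num.sqrt (f n) - Num.sqrt c).
Proof.
move=> c0 h; have sc0 : 0 < Num.sqrt c by rewrite sqrtr_gt0.
have [C hC] := OtauZ (Num.sqrt c)^-1 h.
exists C; apply: filterS2 (Otau_near_lt h c0) hC => n fc; apply: le_trans.
have fn0 : 0 <= f n by move: fc; rewrite ltr_norml; lra.
have e : (Num.sqrt c)^-1 * (f n - c) =
   (Num.sqrt (f n) - Num.sqrt c) * ((Num.sqrt (f n) + Num.sqrt c) / Num.sqrt c).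
  rewrite mulrA -subr_sqr !sqr_sqrtr ?(ltW c0)//; ring.
rewrite e normrM ler_peMr// ger0_norm; last by rewrite divr_ge0 ?addr_ge0 ?sqrtr_ge0.
by rewrite ler_pdivlMr// mul1r lerDr sqrtr_ge0.
Qed.

Lemma Otau_lip (F : R -> R) f c j : (forall x y, `|F x - F y| <= `|x - y|) ->
  Otau j (fun n => f n - c) -> Otau j (fun n => F (f n) - F c).
Proof.
by move=> hF [C hC]; exists C; apply: filterS hC => n; apply: le_trans.
Qed.

Lemma phi_lipschitz (x y : R) : `|phi x - phi y| <= `|x - y|.
Proof.
wlog xy : x y / x <= y.
  by move=> H; have [/H//|/ltW/H] := leP x y; rewrite distrC (distrC y).
have [->|xy'] := eqVneq x y; first by rewrite !subrr normr0.
have xy2 : x < y by rewrite lt_neqAle xy' xy.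
have dphi (z : R) : is_derive z (1 : R) (@phi R) (- z * phi z).
  exact: is_derive_phi.
have cphi : {within `[x, y], continuous (@phi R)}.
  by apply: continuous_subspaceT => z; apply: is_derive1_continuous (dphi z).
have [z _ e] := MVT xy2 (fun z _ => dphi z) cphi.
rewrite distrC e normrM distrC ler_piMl// normrM normrN.
rewrite (ger0_norm (ltW (phi_gt0 z))) /phi mulrCA -[leRHS]mulr1 ler_pM//.
- exact: (ltW phi0_lt1).
rewrite expRN ler_pdivrMr ?expR_gt0// mul1r.
apply: le_trans (expR_ge1Dx _); have := sqr_ge0 (`|z| - 1).
rewrite -(real_normK (num_real z)); lra.
Qed.

End Expansions.

(** * Reduction to the number of ones *)

Section ExchangeableSums.
Context {R : realType}.
Implicit Types (lam : R) (l n k : nat).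

(** [lam + (1 - lam) X] is the generating polynomial of one channel output on
    input one, and outputs are independent. *)
Lemma coef_binp lam m j :
  ((lam%:P + (1 - lam) *: 'X) ^+ m)`_j = binp (1 - lam) m j.
Proof.
elim: m j => [|m IH] j.
  by rewrite expr0 coef1 /binp bin0n sub0n expr0 mulr1; case: j => [|j];
    rewrite ?expr0 ?mulr1 ?mul0r.
rewrite exprS mulrDl coefD coefCM -scalerAl coefZ coefXM.
case: j => [|j] /=; first by rewrite IH binpS0 subKr mulr0 addr0.
by rewrite !IH binpSS subKr.
Qed.

(** Zeros pass unchanged, so only the ones of [y] contribute a trial. *)
Lemma sum_channel lam n l (y : outcome n) :
  \sum_(u : outcome n | (count_ones u <= l)%N) \prod_(i < n) channel lam (y i) (u i)
  = bcdf (1 - lam) (count_ones y) l.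
Proof.
pose F (u : outcome n) : R := \prod_(i < n) channel lam (y i) (u i).
have gen : \sum_(u : outcome n) F u *: 'X^(count_ones u) =
    (lam%:P + (1 - lam) *: 'X) ^+ (count_ones y) :> {poly R}.
  transitivity (\prod_(i < n) \sum_(b : bool) (channel lam (y i) b *: 'X^b : {poly R})).
    rewrite bigA_distr_bigA /=; apply: eq_bigr => u _.
    by rewrite scaler_prod /count_ones expr_sum.
  rewrite /count_ones expr_sum; apply: eq_bigr => i _.
  rewrite big_bool /= expr0 expr1; case: (y i); rewrite /= ?expr1 ?expr0.
    by rewrite addrC alg_polyC.
  by rewrite scale0r add0r scale1r.
rewrite (partition_big (fun u => inord (count_ones u) : 'I_l.+1) xpredT)//=.
apply: eq_bigr => j _; rewrite -coef_binp -gen coef_sum.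
rewrite [RHS](bigID (fun u => count_ones u == j :> nat))/= [X in _ + X]big1 ?addr0; last first.
  by move=> u uj; rewrite coefZ coefXn eq_sym (negbTE uj) mulr0.
apply: eq_big => [u|u].
  have [ul|lu] := leqP (count_ones u) l.
    by rewrite -(inj_eq val_inj) /= inordK.
  by apply/esym/negbTE; rewrite neq_ltn orbC (leq_trans (ltn_ord j)).
move=> /andP[ul /eqP <-]; rewrite coefZ coefXn inordK// eqxx mulr1//.
Qed.

Definition first_ones n (y : outcome n.+1) : outcome n :=
  [ffun i => y (widen_ord (leqnSn n) i)].

Lemma count_ones_last n (y : outcome n.+1) :
  count_ones y = (count_ones (first_ones y) + y ord_max)%N.
Proof.
rewrite /count_ones big_ord_recr /=; congr (_ + _)%N.
by apply: eq_bigr => i _; rewrite ffunE.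
Qed.

Lemma prob_split lam n (Q : outcome n.+1 -> R) l (P : pred (outcome n.+1)) :
  prob lam Q (fun y u => P y && (count_ones u <= l)%N) =
  \sum_(y : outcome n.+1 | P y) Q y * bcdf (1 - lam) (count_ones (first_ones y)) l.
Proof.
rewrite /prob [RHS]big_mkcond; apply: eq_bigr => y _.
case: (P y) => /=; last by rewrite big_pred0.
rewrite -sum_channel mulr_sumr; apply: eq_bigr => u _; rewrite /joint_law.
by congr (_ * _); apply: eq_bigr => i _; rewrite ffunE.
Qed.

Lemma count_ones_perm m (y : outcome m) (sigma : {perm 'I_m}) :
  count_ones [ffun i => y (sigma i)] = count_ones y.
Proof.
rewrite /count_ones [RHS](reindex_inj (@perm_inj _ sigma)).
by apply: eq_bigr => i _; rewrite ffunE.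
Qed.

Lemma exchangeable_swap m (Q : outcome m -> R) (F : bool -> nat -> R) (i j : 'I_m) :
  exchangeable Q ->
  \sum_(y : outcome m) Q y * F (y i) (count_ones y) =
  \sum_(y : outcome m) Q y * F (y j) (count_ones y).
Proof.
move=> [_ hQ]; pose sw (y : outcome m) : outcome m := [ffun t => y (tperm i j t)].
have swK : involutive sw by move=> y; apply/ffunP => t; rewrite !ffunE tpermK.
rewrite [LHS](reindex_inj (inv_inj swK)); apply: eq_bigr => y _.
by rewrite /sw hQ count_ones_perm ffunE tpermL.
Qed.

(** A summand that looks only at one coordinate and at the number of ones has the
    same expectation for all coordinates; averaging over them leaves a function
    of the number of ones alone. *)
Lemma exchangeable_average n (Q : outcome n.+1 -> R) (F G : nat -> R) :
  exchangeable Q ->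
  \sum_(y : outcome n.+1) Q y *
     (if y ord_max then F (count_ones y) else G (count_ones y)) =
  \sum_(y : outcome n.+1) Q y *
     (((count_ones y)%:R * F (count_ones y) +
       (n.+1%:R - (count_ones y)%:R) * G (count_ones y)) / n.+1%:R).
Proof.
move=> hQ; pose H (b : bool) k := if b then F k else G k.
have n0 : n.+1%:R != 0 :> R by rewrite pnatr_eq0.
apply: (mulIf n0); rewrite mulr_suml [RHS]mulr_suml.
transitivity (\sum_(i < n.+1) \sum_(y : outcome n.+1) Q y * H (y i) (count_ones y)).
  under [RHS]eq_bigr do rewrite (exchangeable_swap H _ ord_max hQ).
  by rewrite sumr_const card_ord -[RHS]mulr_natr mulr_suml.
rewrite exchange_big /=; apply: eq_bigr => y _.
rewrite -mulr_sumr -mulrA divfK//; congr (_ * _).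
transitivity (\sum_(i < n.+1) ((y i)%:R * F (count_ones y) +
    (1 - (y i)%:R) * G (count_ones y))).
  by apply: eq_bigr => i _; rewrite /H; case: (y i); rewrite /=; ring.
rewrite big_split /= -!mulr_suml sumrB sumr_const card_ord.
by rewrite /count_ones natr_sum.
Qed.

(** Probabilities of acceptance, and of acceptance together with a final one,
    given that [k] of the [n + 1] outcomes are ones. *)
Definition accept_prob (v : R) n l k : R :=
  (k%:R * bcdf v k.-1 l + (n.+1%:R - k%:R) * bcdf v k l) / n.+1%:R.

Definition accept_bad (v : R) n l k : R := k%:R * bcdf v k.-1 l / n.+1%:R.

Lemma prob_L_le_mix lam n (Q : outcome n.+1 -> R) l : exchangeable Q ->
  prob_L_le lam Q l = \sum_y Q y * accept_prob (1 - lam) n l (count_ones y).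
Proof.
move=> hQ.
rewrite -(exchangeable_average (fun k => bcdf (1 - lam) k.-1 l)
  (fun k => bcdf (1 - lam) k l) hQ).
rewrite /prob_L_le (prob_split _ _ _ xpredT); apply: eq_bigr => y _.
rewrite [in RHS]count_ones_last; case: (y ord_max) => /=; last by rewrite addn0.
by rewrite addn1.
Qed.

Lemma prob_bad_mix lam n (Q : outcome n.+1 -> R) l : exchangeable Q ->
  prob lam Q (fun y u => y ord_max && (count_ones u <= l)%N) =
  \sum_y Q y * accept_bad (1 - lam) n l (count_ones y).
Proof.
move=> hQ; transitivity (\sum_y Q y * (((count_ones y)%:R * bcdf (1 - lam) (count_ones y).-1 l +
       (n.+1%:R - (count_ones y)%:R) * 0) / n.+1%:R)); last first.
  by apply: eq_bigr => y _; rewrite mulr0 addr0.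
rewrite -(exchangeable_average (fun k => bcdf (1 - lam) k.-1 l) (fun=> 0) hQ).
rewrite (prob_split _ _ _ (fun y => y ord_max)) big_mkcond; apply: eq_bigr => y _.
rewrite [in RHS]count_ones_last; case: (y ord_max) => /=; last by rewrite mulr0.
by rewrite addn1.
Qed.

(** The extreme points of the set of exchangeable laws. *)
Definition uniform_ones n k (y : outcome n) : R :=
  if count_ones y == k then (#|[pred z : outcome n | count_ones z == k]|%:R)^-1 else 0.

Lemma sum_uniform_ones n k (F : nat -> R) : (k <= n)%N ->
  \sum_(y : outcome n) uniform_ones k y * F (count_ones y) = F k.
Proof.
move=> kn; pose N := #|[pred z : outcome n | count_ones z == k]|.
have N0 : (0 < N)%N.
  apply/card_gt0P; exists [ffun i : 'I_n => (i < k)%N]; rewrite inE /count_ones.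
  under eq_bigr do rewrite ffunE.
  rewrite (_ : (\sum_(i < n) (i < k)%N)%N = (\sum_(i < n | (i < k)%N) 1)%N); last first.
    by rewrite [RHS]big_mkcond; apply: eq_bigr => i _; case: ltnP.
  by rewrite -(big_ord_widen n (fun=> 1%N) kn) sum1_card card_ord.
transitivity (\sum_(y : outcome n | count_ones y == k) N%:R^-1 * F k).
  rewrite [RHS]big_mkcond; apply: eq_bigr => y _; rewrite /uniform_ones.
  by case: eqP => [->|_]; rewrite ?mul0r.
by rewrite sumr_const -[LHS]mulr_natr mulrAC mulVf ?mul1r// pnatr_eq0 -lt0n.
Qed.

End ExchangeableSums.

(** * The optimisation over exchangeable laws *)

Section Optimum.
Context {R : realType}.
Implicit Types (lam delta a b v : R) (l n k : nat).

Lemma epsbar_unique lam l n delta (e : R) :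
  attainable lam l n delta e -> ubound (attainable lam l n delta) e ->
  epsbar lam l n delta = e.
Proof.
move=> ae ue; rewrite /epsbar; case: xgetP => [x _ [ax ux]|/(_ e)].
  by apply/eqP; rewrite eq_le ue// ux.
by case; split.
Qed.

Definition mix_ones (p : R) n k k' (y : outcome n) : R :=
  p * uniform_ones k y + (1 - p) * uniform_ones k' y.

Lemma sum_mix_ones p n k k' (F : nat -> R) : (k <= n)%N -> (k' <= n)%N ->
  \sum_(y : outcome n) mix_ones p k k' y * F (count_ones y) =
  p * F k + (1 - p) * F k'.
Proof.
move=> kn kn'; under eq_bigr do rewrite mulrDl -!mulrA.
by rewrite big_split /= -!mulr_sumr !sum_uniform_ones.
Qed.

Lemma mix_ones_exchangeable p n k k' : 0 <= p <= 1 -> (k <= n)%N -> (k' <= n)%N ->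
  exchangeable (mix_ones p (n := n) k k').
Proof.
move=> /andP[p0 p1] kn kn'; split; first split.
- move=> y; rewrite /mix_ones /uniform_ones.
  by rewrite addr_ge0// mulr_ge0 ?subr_ge0//; case: ifP; rewrite ?invr_ge0.
- have := sum_mix_ones p (fun=> 1) kn kn'.
  by under eq_bigr do rewrite mulr1; move=> ->; ring.
- by move=> sigma y; rewrite /mix_ones /uniform_ones count_ones_perm.
Qed.

Lemma mix_attainable lam l n delta p k k' : 0 <= p <= 1 ->
  (k <= n.+1)%N -> (k' <= n.+1)%N ->
  delta <= p * accept_prob (1 - lam) n l k + (1 - p) * accept_prob (1 - lam) n l k' ->
  attainable lam l n delta
    ((p * accept_bad (1 - lam) n l k + (1 - p) * accept_bad (1 - lam) n l k') /
     (p * accept_prob (1 - lam) n l k + (1 - p) * accept_prob (1 - lam) n l k')).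
Proof.
move=> p01 kn kn' h; have ex := mix_ones_exchangeable p01 kn kn'.
exists (mix_ones p k k'); split => //.
  by rewrite prob_L_le_mix// sum_mix_ones.
by rewrite /cond_prob_bad prob_L_le_mix// prob_bad_mix// !sum_mix_ones.
Qed.

Lemma count_ones_le m (y : outcome m) : (count_ones y <= m)%N.
Proof.
rewrite /count_ones -[X in (_ <= X)%N]card_ord -sum1_card leq_sum// => i _.
exact: leq_b1.
Qed.

(** Weak duality: a line with nonnegative intercept above the points of the
    extreme laws stays above their convex hull, and its slope [a + b / h] seen
    from the origin decreases in the acceptance probability [h]. *)
Lemma affine_bound lam l n delta a b : 0 < delta -> 0 <= b ->
  (forall k, (k <= n.+1)%N ->
     accept_bad (1 - lam) n l k <= a * accept_prob (1 - lam) n l k + b) ->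
  ubound (attainable lam l n delta) (a + b / delta).
Proof.
move=> d0 b0 h e [Q [hQ dQ ->]].
have L0 := lt_le_trans d0 dQ.
have le1 : prob lam Q (fun y u => y ord_max && (count_ones u <= l)%N) <=
    a * prob_L_le lam Q l + b.
  have [[Q0 Q1] _] := hQ.
  have eb : b = \sum_y b * Q y by rewrite -mulr_sumr Q1 mulr1.
  rewrite prob_L_le_mix// prob_bad_mix// mulr_sumr eb.
  apply: (@le_trans _ _ (\sum_y (a * (Q y * accept_prob (1 - lam) n l (count_ones y))
    + b * Q y))); last by rewrite big_split.
  apply: ler_sum => y _ /=.
  have := ler_wpM2l (Q0 y) (h _ (count_ones_le y)).
  by congr (_ <= _); ring.
rewrite /cond_prob_bad ler_pdivrMr// (le_trans le1)// mulrDl lerD2l.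
by rewrite mulrAC ler_pdivlMr// ler_wpM2l.
Qed.

(** Strong duality: the line is attained by the mixture of [k] and [k + 1] ones
    that is accepted with probability exactly [delta]. *)
Lemma epsbar_line lam l n delta a b k : 0 < delta -> 0 <= b -> (k <= n)%N ->
  accept_prob (1 - lam) n l k.+1 < delta <= accept_prob (1 - lam) n l k ->
  (forall j, (j <= n.+1)%N ->
     accept_bad (1 - lam) n l j <= a * accept_prob (1 - lam) n l j + b) ->
  accept_bad (1 - lam) n l k = a * accept_prob (1 - lam) n l k + b ->
  accept_bad (1 - lam) n l k.+1 = a * accept_prob (1 - lam) n l k.+1 + b ->
  attainable lam l n delta (a + b / delta) /\
  ubound (attainable lam l n delta) (a + b / delta).
Proof.
move=> d0 b0 kn /andP[h1 h2] hall e1 e2; split; last exact: affine_bound.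
set H1 := accept_prob _ _ _ k.+1 in h1 e2; set H0 := accept_prob _ _ _ k in h2 e1.
have H10 : 0 < H0 - H1 by lra.
pose p := (delta - H1) / (H0 - H1).
have p01 : 0 <= p <= 1.
  by rewrite divr_ge0 ?(ltW H10)//= ?ler_pdivrMr//; lra.
have pd : p * H0 + (1 - p) * H1 = delta by rewrite /p; field; rewrite gt_eqF.
have := @mix_attainable lam l n delta p k k.+1 p01 (leqW kn) kn.
rewrite -/H0 -/H1 pd lexx => /(_ isT); rewrite e1 e2.
by congr (attainable _ _ _ _ _); rewrite -pd; field; rewrite pd gt_eqF.
Qed.

Lemma accept_bad_le v n l k : 0 <= v <= 1 -> (k <= n.+1)%N ->
  accept_bad v n l k <= accept_prob v n l k.
Proof.
move=> v01 kn; rewrite /accept_bad /accept_prob ler_pM2r ?invr_gt0 ?ltr0n//.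
by rewrite lerDl mulr_ge0 ?bcdf_ge0// subr_ge0 ler_nat.
Qed.

(** Given such a number [k] of ones, acceptance excludes a final zero, so the
    trivial bound is attained. *)
Lemma epsbar_eq1 lam l n delta k : 0 <= lam <= 1 -> 0 < delta -> (k <= n.+1)%N ->
  delta <= accept_prob (1 - lam) n l k ->
  accept_bad (1 - lam) n l k = accept_prob (1 - lam) n l k ->
  attainable lam l n delta 1 /\ ubound (attainable lam l n delta) 1.
Proof.
move=> lam01 d0 kn hd e; have v01 : 0 <= 1 - lam <= 1 by lra.
split.
  have p01 : 0 <= (1 : R) <= 1 by rewrite ler01 lexx.
  have := @mix_attainable lam l n delta 1 k k p01 kn kn.
  rewrite subrr !mul0r !addr0 !mul1r hd e divff; first exact.
  by rewrite gt_eqF// (lt_le_trans d0).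
have := @affine_bound lam l n delta 1 0 d0 (lexx _).
by rewrite mul0r addr0; apply => j jn; rewrite mul1r addr0 accept_bad_le.
Qed.

Section PositiveLoss.
Variables (v : R) (n l : nat).
Hypotheses (v01 : 0 < v < 1) (ln : (l < n)%N).

Let B k := bcdf v k l.
Let b k := binp v k l.
Let v0 : 0 < v. Proof. by case/andP: v01. Qed.
Let v1 : 0 < 1 - v. Proof. by case/andP: v01; rewrite subr_gt0. Qed.
Let v01' : 0 <= v <= 1. Proof. by rewrite ltW//= -subr_ge0 ltW. Qed.

Let BS k : B k.+1 = B k - v * b k. Proof. exact: bcdf_trialS. Qed.
Let B0 k : 0 < B k. Proof. by apply: bcdf_gt0; rewrite ltW//= -subr_gt0. Qed.
Let b0 k : 0 <= b k. Proof. exact: binp_ge0. Qed.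

(** The points of the extreme laws, scaled by [n + 1]. *)
Let gs k : R := k%:R * B k.-1.
Let hs k : R := k%:R * B k.-1 + (n.+1%:R - k%:R) * B k.

Let n1 : 0 < n.+1%:R :> R. Proof. by rewrite ltr0n. Qed.

Let gsS k : gs k.+1 - gs k = B k - k%:R * v * b k.-1.
Proof.
rewrite /gs /=; case: k => [|k]; first by rewrite mul0r mul1r subr0 !mul0r subr0.
by rewrite /= BS -(natr1 k.+1); ring.
Qed.

Let hsS k : hs k.+1 - hs k = - (k%:R * v * b k.-1) - (n%:R - k%:R) * v * b k.
Proof.
have := gsS k; rewrite /gs /hs /= BS -(natr1 k) -(natr1 n) => h.
have e : k%:R * v * b k.-1 = B k - ((k%:R + 1) * B k - k%:R * B k.-1).
  by rewrite h; ring.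
by rewrite e; ring.
Qed.

Let b_below k : (l <= k)%N -> k%:R * b k.-1 * (1 - v) = (k - l)%:R * b k.
Proof.
case: k => [|k lk] /=; first by rewrite leqn0 => /eqP->; rewrite subnn !mul0r.
move: lk; rewrite leq_eqVlt => /predU1P[e|lk].
  by rewrite -e subnn mul0r /b binp_small ?e// mulr0 mul0r.
have h := @binp_trialS R v k l lk.
by rewrite [RHS]mulrC /b h; ring.
Qed.

(** [B / b] decreases in [k], because each ratio [binp v k i / binp v k l] with
    [i <= l] does. *)
Let hazard k : (l <= k)%N -> B k.+1 * b k <= B k * b k.+1.
Proof.
move=> lk; have kl : 0 < (k.+1 - l)%:R :> R by rewrite ltr0n subn_gt0.
rewrite -(ler_pM2r kl) -[leRHS]mulrA /b binp_trialS// -/(b k).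
have -> : B k.+1 * b k * (k.+1 - l)%:R = (B k.+1 * (k.+1 - l)%:R) * b k by ring.
have -> : B k * ((1 - v) * k.+1%:R * b k) = ((1 - v) * k.+1%:R * B k) * b k by ring.
by rewrite ler_wpM2r// bcdf_trialS_le.
Qed.

Let b_gt0 k : (l <= k)%N -> 0 < b k.
Proof. by move=> lk; apply: binp_gt0. Qed.

(** The bracket decreases in [k] when [a <= 1], by [hazard]; see [slope_mono]. *)
Let slope_sign a k : (l <= k)%N ->
  (gs k.+1 - a * hs k.+1) - (gs k - a * hs k) =
  b k * (B k / b k + a * v * (n%:R - k%:R) - (1 - a) * v * ((k - l)%:R / (1 - v))).
Proof.
move=> lk; have bk := b_gt0 lk.
rewrite [LHS](_ : _ = (gs k.+1 - gs k) - a * (hs k.+1 - hs k)); last by ring.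
rewrite gsS hsS.
have -> : k%:R * v * b k.-1 = v * ((k - l)%:R * b k) / (1 - v).
  by rewrite -b_below//; field; rewrite gt_eqF.
by field; rewrite !gt_eqF.
Qed.

Let slope_mono a k j : a <= 1 -> (l <= k)%N -> (k <= j)%N ->
  B j / b j + a * v * (n%:R - j%:R) - (1 - a) * v * ((j - l)%:R / (1 - v)) <=
  B k / b k + a * v * (n%:R - k%:R) - (1 - a) * v * ((k - l)%:R / (1 - v)).
Proof.
move=> a1 lk; elim: j => [|j IH]; first by rewrite leqn0 => /eqP->.
rewrite leq_eqVlt => /predU1P[->//|kj]; apply: le_trans (IH kj).
have lj : (l <= j)%N by exact: leq_trans lk _.
have r : B j.+1 / b j.+1 <= B j / b j.
  by rewrite ler_pdivrMr ?b_gt0// 1?leqW// mulrAC ler_pdivlMr ?b_gt0// hazard.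
rewrite subSn// -(natr1 j) -(natr1 (j - l)).
set X := B j.+1 / _ in r *; set Y := B j / _ in r *; set D := (j - l)%:R.
rewrite -subr_ge0.
have -> : Y + a * v * (n%:R - j%:R) - (1 - a) * v * (D / (1 - v)) -
  (X + a * v * (n%:R - (j%:R + 1)) - (1 - a) * v * ((D + 1) / (1 - v))) =
  (Y - X) + v * (1 + (1 - a) * (v / (1 - v))) by field; rewrite gt_eqF.
rewrite addr_ge0 ?subr_ge0// mulr_ge0 ?(ltW v0)// addr_ge0// mulr_ge0 ?subr_ge0//.
by rewrite divr_ge0 ?ltW.
Qed.

Let low k : (k <= l)%N -> hs k = n.+1%:R /\ gs k = k%:R.
Proof.
move=> kl; rewrite /hs /gs /B !bcdf_all//; first by split; ring.
by apply: leq_trans kl; exact: leq_pred.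
Qed.

(** The increments vanish at [k], hence are nonnegative before and nonpositive
    after; below [l], where acceptance is certain, they equal one. *)
Let unimodal a k j : a <= 1 -> (l <= k)%N ->
  gs k.+1 - a * hs k.+1 = gs k - a * hs k -> gs j - a * hs j <= gs k - a * hs k.
Proof.
move=> a1 lk e.
have ek : B k / b k + a * v * (n%:R - k%:R) - (1 - a) * v * ((k - l)%:R / (1 - v)) = 0.
  have := slope_sign a lk; rewrite e subrr => /esym/eqP; rewrite mulf_eq0.
  by rewrite gt_eqF ?b_gt0//= => /eqP.
have [jk|kj] := leqP j k.
  have : forall i, (i <= k)%N -> gs (k - i) - a * hs (k - i) <= gs k - a * hs k.
    elim => [|i IH] ik; first by rewrite subn0.
    apply: le_trans (IH (ltnW ik)); rewrite -subr_ge0.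
    have -> : (k - i = (k - i.+1).+1)%N by lia.
    have [lki|kil] := leqP l (k - i.+1).
      rewrite slope_sign// mulr_ge0 ?b0//.
      by rewrite -ek slope_mono//; lia.
    have [-> ->] := low (ltnW kil); have [-> ->] := low kil.
    by rewrite -natr1; have : 0 <= 1 :> R by []; lra.
  by move=> /(_ (k - j)%N (leq_subr _ _)); rewrite subKn.
have : forall i, gs (k.+1 + i) - a * hs (k.+1 + i) <= gs k - a * hs k.
  elim => [|i IH]; first by rewrite addn0 e.
  apply: le_trans IH; rewrite addnS -subr_le0 slope_sign; last by lia.
  by rewrite mulr_ge0_le0 ?b0// -ek slope_mono//; lia.
by move=> /(_ (j - k.+1)%N); rewrite subnKC.
Qed.

(** The line through two consecutive points lies above all points by [unimodal],
    which applies since its slope is at most one; evaluated at [n + 1] ones, where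
    both coordinates coincide, it gives the sign of the intercept. *)
Let support k : (k <= n)%N -> hs k.+1 < n.+1%:R ->
  exists a c : R, [/\ 0 <= c, hs k.+1 < hs k, gs k = a * hs k + c,
    gs k.+1 = a * hs k.+1 + c &
    forall j, gs j <= a * hs j + c].
Proof.
move=> kn hlt.
have lk : (l <= k)%N.
  rewrite leqNgt; apply/negP => kl; have [e _] := low kl.
  by rewrite e ltxx in hlt.
have hd : hs k.+1 < hs k.
  rewrite -subr_lt0 hsS; have bk := b_gt0 lk.
  have kn' : 0 <= n%:R - k%:R :> R by rewrite subr_ge0 ler_nat.
  have k1 : 0 <= k%:R * v * b k.-1 by exact: mulr_ge0 (mulr_ge0 (ler0n _ _) (ltW v0)) (b0 _).
  have [kn1|nk] := ltnP k n.
    have nk0 : 0 < n%:R - k%:R :> R by rewrite subr_gt0 ltr_nat.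
    by rewrite -opprD oppr_lt0 ltr_wpDl// mulr_gt0// mulr_gt0.
  have ekn : k = n by apply/eqP; rewrite eqn_leq kn.
  have n0 : (0 < n)%N by exact: leq_ltn_trans ln.
  have k0 : 0 < k%:R :> R by rewrite ekn ltr0n.
  have bk1 : 0 < b k.-1 by apply: b_gt0; rewrite ekn -ltnS prednK.
  rewrite -opprD oppr_lt0 ltr_pwDl//; first by rewrite mulr_gt0// mulr_gt0.
  exact: mulr_ge0 (mulr_ge0 kn' (ltW v0)) (b0 k).
pose a := (gs k.+1 - gs k) / (hs k.+1 - hs k).
have hn : hs k.+1 - hs k != 0 by rewrite lt_eqF// subr_lt0.
have a1 : a <= 1.
  rewrite /a ler_ndivrMr ?subr_lt0// mul1r gsS hsS.
  have kn' : 0 <= n%:R - k%:R :> R by rewrite subr_ge0 ler_nat.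
  rewrite [leLHS]addrC lerD2r (le_trans _ (ltW (B0 k)))// oppr_le0.
  exact: mulr_ge0 (mulr_ge0 kn' (ltW v0)) (b0 k).
have e : gs k.+1 - a * hs k.+1 = gs k - a * hs k.
  have h : a * (hs k.+1 - hs k) = gs k.+1 - gs k by rewrite /a divfK.
  by rewrite -[gs k.+1](subrK (gs k)) -h; ring.
have un j := unimodal j a1 lk e.
exists a, (gs k - a * hs k); split => //.
- have := un n.+1; apply: le_trans.
  rewrite /gs /hs /= subrr mul0r addr0.
  have -> : n.+1%:R * B n - a * (n.+1%:R * B n) = (1 - a) * (n.+1%:R * B n) by ring.
  by rewrite mulr_ge0 ?subr_ge0// mulr_ge0// ltW.
- by ring.
- by rewrite -e; ring.
- by move=> j; rewrite -lerBlDl; exact: un.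
Qed.

Let accE k : accept_prob v n l k = hs k / n.+1%:R. Proof. by []. Qed.
Let badE k : accept_bad v n l k = gs k / n.+1%:R. Proof. by []. Qed.

Lemma support_line k : (k <= n)%N -> accept_prob v n l k.+1 < 1 ->
  exists a c : R, [/\ 0 <= c,
    accept_bad v n l k = a * accept_prob v n l k + c,
    accept_bad v n l k.+1 = a * accept_prob v n l k.+1 + c &
    forall j, accept_bad v n l j <= a * accept_prob v n l j + c].
Proof.
move=> kn; rewrite accE ltr_pdivrMr// mul1r => /(support kn)[a [c [c0 _ e1 e2 h]]].
exists a, (c / n.+1%:R); rewrite !accE !badE.
have d (x : R) : a * (x / n.+1%:R) + c / n.+1%:R = (a * x + c) / n.+1%:R by ring.
split; rewrite ?d ?e1 ?e2//; first by rewrite divr_ge0// ltW.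
by move=> j; rewrite accE badE d ler_pM2r ?invr_gt0.
Qed.

Lemma accept_prob0 : accept_prob v n l 0 = 1.
Proof. by rewrite accE (low (leq0n l)).1 divff// gt_eqF. Qed.

Lemma accept_prob_gt0 k : (k <= n.+1)%N -> 0 < accept_prob v n l k.
Proof.
move=> kn; rewrite accE divr_gt0// /hs.
have [->|k0] := posnP k; first by rewrite mul0r add0r subr0 mulr_gt0.
by rewrite ltr_pwDl ?mulr_gt0 ?ltr0n// mulr_ge0 ?(ltW (B0 _))// subr_ge0 ler_nat.
Qed.

Lemma accept_prob_le k : (0 < k <= n.+1)%N -> accept_prob v n l k <= bcdf v k.-1 l.
Proof.
move=> /andP[k0 kn]; rewrite accE ler_pdivrMr// /hs.
have : (n.+1%:R - k%:R) * B k <= (n.+1%:R - k%:R) * B k.-1.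
  by rewrite ler_wpM2l ?subr_ge0 ?ler_nat// bcdf_trials_le ?leq_pred.
by rewrite -/(B _); lra.
Qed.

Lemma accept_prob_ge k : (k <= n.+1)%N -> bcdf v k l <= accept_prob v n l k.
Proof.
move=> kn; rewrite accE ler_pdivlMr// /hs.
have : k%:R * B k <= k%:R * B k.-1.
  by rewrite ler_wpM2l// bcdf_trials_le ?leq_pred.
by rewrite -/(B _); lra.
Qed.

End PositiveLoss.

Section EpsbarPositiveLoss.
Variables (lam delta : R) (n l : nat).
Hypotheses (lam01 : 0 < lam < 1) (ln : (l < n)%N) (d01 : 0 < delta <= 1).

Let v : R := 1 - lam.
Let v01 : 0 < v < 1.
Proof. by case/andP: lam01 => h0 h1; rewrite subr_gt0 h1 gtrBl. Qed.
Let v01W : 0 <= 1 - lam <= 1.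
Proof. by case/andP: lam01 => h0 h1; rewrite subr_ge0 (ltW h1) gerBl ltW. Qed.
Let lam01W : 0 <= lam <= 1. Proof. by case/andP: lam01 => /ltW-> /ltW->. Qed.
Let d0 : 0 < delta. Proof. by case/andP: d01. Qed.

(** Unless [n + 1] ones are accepted often enough, the optimum mixes the two
    consecutive counts between which the acceptance probability falls below
    [delta]. *)
Lemma epsbar_max : attainable lam l n delta (epsbar lam l n delta) /\
  ubound (attainable lam l n delta) (epsbar lam l n delta).
Proof.
suff [e [ae ue]] : exists e, attainable lam l n delta e /\
    ubound (attainable lam l n delta) e.
  by rewrite (epsbar_unique ae ue).
have [h|h] := leP delta (accept_prob v n l n.+1).
  exists 1; apply: (epsbar_eq1 lam01W d0 (leqnn _) h).
  by rewrite /accept_bad /accept_prob subrr mul0r addr0.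
have [k kn /andP[h1 h2]] : exists2 k, (k <= n)%N &
    (accept_prob v n l k.+1 < delta <= accept_prob v n l k).
  have ex : exists k, accept_prob v n l k < delta by exists n.+1.
  case: (ex_minnP ex) => -[|k] hk hmin.
    by rewrite accept_prob0// ltNge in hk; case/andP: d01 => _ d1; rewrite d1 in hk.
  exists k; first by rewrite -ltnS hmin.
  by rewrite hk/= leNgt; apply/negP => /hmin; rewrite ltnn.
have lt1 : accept_prob v n l k.+1 < 1 by case/andP: d01 => _; exact: lt_le_trans.
have [a [c [c0 e1 e2 hall]]] := support_line v01 ln kn lt1.
exists (a + c / delta); apply: (epsbar_line d0 c0 kn) e1 e2; last by move=> j _; exact: hall.
by rewrite -/v h1.
Qed.

(** The law with exactly [k] ones is admissible. *)
Lemma epsbar_ge k : (k <= n.+1)%N -> delta <= accept_prob v n l k ->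
  accept_bad v n l k / accept_prob v n l k <= epsbar lam l n delta.
Proof.
move=> kn h; apply: epsbar_max.2.
have p01 : 0 <= (1 : R) <= 1 by rewrite ler01 lexx.
have := @mix_attainable lam l n delta 1 k k p01 kn kn.
by rewrite subrr !mul0r !addr0 !mul1r; apply.
Qed.

(** The supporting line at [k] has a larger slope from the origin at its own
    acceptance probability than at [delta]. *)
Lemma epsbar_le k : (0 < k <= n.+1)%N -> accept_prob v n l k < delta ->
  epsbar lam l n delta <= accept_bad v n l k / accept_prob v n l k.
Proof.
case: k => // k kn h.
have lt1 : accept_prob v n l k.+1 < 1 by case/andP: d01 => _; exact: lt_le_trans.
have [a [c [c0 _ e2 hall]]] := support_line v01 ln kn lt1.
have p0 : 0 < accept_prob v n l k.+1 by exact: accept_prob_gt0.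
have := @affine_bound lam l n delta a c d0 c0 (fun j _ => hall j).
move=> /(_ _ epsbar_max.1)/le_trans; apply.
rewrite e2 mulrDl mulfK ?gt_eqF// lerD2l ler_wpM2l// lef_pV2 ?posrE// ltW//.
Qed.

Lemma epsbar_le1 : epsbar lam l n delta <= 1.
Proof.
have := @affine_bound lam l n delta 1 0 d0 (lexx _).
rewrite mul0r addr0 => /(_ _ _ epsbar_max.1); apply => j jn.
by rewrite mul1r addr0 accept_bad_le.
Qed.

Lemma epsbar_one : delta <= bcdf v n l -> epsbar lam l n delta = 1.
Proof.
move=> h; have [||a u] := @epsbar_eq1 lam l n delta n.+1 lam01W d0 (leqnn _).
- apply: (le_trans h); rewrite /accept_prob subrr mul0r addr0 /=.
  by rewrite mulrAC divff ?mul1r// pnatr_eq0.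
- by rewrite /accept_bad /accept_prob subrr mul0r addr0.
exact: epsbar_unique.
Qed.

End EpsbarPositiveLoss.

End Optimum.

(** * Rounding and Landau notation *)

Section LandauNotation.
Context {R : realType}.

Lemma Otau_eqaddO j (f g h : nat -> R) : (forall n, h n = tau n ^+ j) ->
  Otau j (fun n => f n - g n) -> f = g +O_\oo h.
Proof.
move=> hE [C hC]; apply/eqaddOP/bigO_exP; exists (`|C| + 1); first by rewrite ltr_wpDl.
apply: filterS hC => n; rewrite -[(f - g) n]/(f n - g n) hE => hn.
rewrite (le_trans hn)// (ger0_norm (exprn_ge0 _ (tau_ge0 _))).
rewrite ler_wpM2r ?exprn_ge0 ?tau_ge0// (le_trans (ler_norm _))// lerDl//.
Qed.

Lemma ceil_nat_itv (x : R) : 0 <= x -> x <= (ceil_nat x)%:R < x + 1.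
Proof.
move=> x0; have c0 : 0 <= Num.ceil x by rewrite ceil_ge0; lra.
have -> : (ceil_nat x)%:R = (Num.ceil x)%:~R :> R.
  by rewrite /ceil_nat natr_absz ger0_norm.
have := ceil_itv x; rewrite intrB; lra.
Qed.

Lemma ceil_natE (s : R) n : 0 <= s ->
  (ceil_nat (s * n%:R))%:R = s * n%:R + upsilon s n.
Proof.
move=> s0; have x0 : 0 <= s * n%:R by rewrite mulr_ge0.
have c0 : 0 <= Num.ceil (s * n%:R) by rewrite ceil_ge0; lra.
by rewrite /upsilon addrC subrK /ceil_nat natr_absz ger0_norm.
Qed.

Lemma upsilon_itv (s : R) n : 0 <= upsilon s n <= 1.
Proof.
by rewrite /upsilon; have := ceil_itv (s * n%:R); rewrite intrB; lra.
Qed.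

Lemma near_nat_gt (x : R) : \forall n \near \oo, x < n%:R.
Proof. exact: nbhs_infty_gtr. Qed.

Lemma ceil_nat_lt_near (s : R) : 0 <= s < 1 ->
  \forall n \near \oo, (ceil_nat (s * n%:R) < n)%N.
Proof.
move=> /andP[s0 s1]; have s1' : 0 < 1 - s by rewrite subr_gt0.
apply: filterS (near_nat_gt (1 - s)^-1) => n hn.
rewrite -(ltr_nat R).
have /andP[_ h] := ceil_nat_itv (mulr_ge0 s0 (ler0n R n)).
apply: (lt_trans h); rewrite -ltrBrDl -[X in _ < X - _]mul1r -mulrBl.
by rewrite -ltr_pdivrMl// mulr1.
Qed.

End LandauNotation.

(** * The lossless case *)

Section Lossless.
Context {R : realType}.
Implicit Types (delta s : R) (l n k : nat).

Lemma binp1 m l : binp (1 : R) m l = (m == l)%:R.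
Proof.
rewrite /binp expr1n mul1r subrr expr0n subn_eq0.
by case: ltngtP => [ml|ml|->]; rewrite ?mulr0 ?binn ?mulr1// bin_small ?mul0r.
Qed.

Lemma bcdf1 m l : bcdf (1 : R) m l = (m <= l)%:R.
Proof.
elim: m => [|m IH]; first by rewrite bcdf_all.
by rewrite bcdf_trialS IH binp1 mul1r; case: ltngtP => _ /=; lra.
Qed.

Lemma accept_low n l k : (k <= l)%N -> accept_prob (1 : R) n l k = 1.
Proof.
move=> kl; rewrite /accept_prob !bcdf1 kl (leq_trans (leq_pred _) kl).
by rewrite !mulr1 addrC subrK divff// pnatr_eq0.
Qed.

Lemma bad_low n l k : (k <= l)%N -> accept_bad (1 : R) n l k = k%:R / n.+1%:R.
Proof. by move=> kl; rewrite /accept_bad bcdf1 (leq_trans (leq_pred _) kl) mulr1. Qed.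

Lemma accept_mid n l : accept_prob (1 : R) n l l.+1 = l.+1%:R / n.+1%:R.
Proof. by rewrite /accept_prob !bcdf1 leqnn ltnn mulr1 mulr0 addr0. Qed.

Lemma bad_mid n l : accept_bad (1 : R) n l l.+1 = l.+1%:R / n.+1%:R.
Proof. by rewrite /accept_bad bcdf1 leqnn mulr1. Qed.

Lemma accept_high n l k : (l.+1 < k)%N ->
  accept_prob (1 : R) n l k = 0 /\ accept_bad (1 : R) n l k = 0.
Proof.
case: k => // k lk; rewrite /accept_prob /accept_bad !bcdf1 /=.
have lk' : (l < k)%N by rewrite -ltnS.
have -> : (k <= l)%N = false by rewrite leqNgt lk'.
have -> : (k < l)%N = false by rewrite ltnNge (ltnW lk').
by rewrite !mulr0 addr0 mul0r.
Qed.

Lemma epsbar0_one n l delta : (l <= n)%N -> 0 < delta <= l.+1%:R / n.+1%:R ->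
  epsbar 0 l n delta = 1.
Proof.
move=> ln /andP[d0 hd].
have l01 : 0 <= (0 : R) <= 1 by rewrite lexx ler01.
have [||a u] := @epsbar_eq1 R 0 l n delta l.+1 l01 d0 ln.
- by rewrite subr0 accept_mid.
- by rewrite subr0 accept_mid bad_mid.
exact: epsbar_unique.
Qed.

(** The optimal law mixes [l] and [l + 1] ones, so as to be accepted with
    probability exactly [delta]. *)
Lemma epsbar0_value n l delta : (l < n)%N -> l.+1%:R / n.+1%:R < delta <= 1 ->
  epsbar 0 l n delta =
    (l.+1%:R / n.+1%:R - (delta - l.+1%:R / n.+1%:R) / (n - l)%:R) / delta.
Proof.
move=> ln /andP[hd d1]; set t := l.+1%:R / n.+1%:R in hd *.
have t0 : 0 < t by rewrite divr_gt0 ?ltr0n.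
have d0 : 0 < delta by exact: lt_trans hd.
have nl0 : 0 < (n - l)%:R :> R by rewrite ltr0n subn_gt0.
have n0 : 0 < n.+1%:R :> R by rewrite ltr0n.
pose a : R := - (n - l)%:R^-1; pose b := t * (1 + (n - l)%:R^-1).
have b0 : 0 <= b by rewrite mulr_ge0 ?addr_ge0 ?invr_ge0// ltW.
have nE : (n - l)%:R = n.+1%:R - l.+1%:R :> R by rewrite natrB 1?ltnW// -natr1 -(natr1 l); ring.
have nl0' : n.+1%:R - l.+1%:R != 0 :> R by rewrite -nE gt_eqF.
have el : l%:R / n.+1%:R = a * 1 + b.
  rewrite /a /b /t nE -(natr1 l); rewrite -(natr1 l) in nl0'.
  move: (n.+1%:R : R) (l%:R : R) (gt_eqF n0) nl0' => N L hN hNL.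
  by field; rewrite hNL hN.
have em : t = a * t + b by rewrite /a /b; ring.
have [] := @epsbar_line R 0 l n delta a b l d0 b0 (ltnW ln).
- by rewrite subr0 accept_mid accept_low// hd.
- move=> j jn; rewrite subr0; have [jl|] := leqP j l.
    rewrite accept_low// bad_low// -el ler_pM2r ?invr_gt0// ler_nat//.
  rewrite leq_eqVlt => /predU1P[<-|lj]; first by rewrite accept_mid bad_mid -em.
  by have [-> ->] := accept_high n lj; rewrite mulr0 add0r.
- by rewrite subr0 accept_low// bad_low.
- by rewrite subr0 accept_mid bad_mid -em.
move=> at_ ub; rewrite (epsbar_unique at_ ub) /a /b; field.
by rewrite !gt_eqF.
Qed.

(** The closed form is rational in [1 / n] and the bounded [upsilon s n]; the
    remainder splits into three terms [E1], [E2], [E3] of order [1 / n ^ 2], which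
    come from [1 / (n + 1)], from [1 / (n - l)] and from their product. *)
Lemma epsbar0_asymp s delta : 0 <= s < 1 -> 0 < delta < 1 -> s < delta ->
  Otau 4 (fun n => epsbar 0 (ceil_nat (s * n%:R)) n delta -
     (s / delta + ((1 - s + s ^+ 2 - delta) / (delta * (1 - s))
                  + upsilon s n / delta) * n%:R^-1)).
Proof.
move=> /andP[s0 s1] /andP[d0 d1] sd.
have s1' : 0 < 1 - s by rewrite subr_gt0.
pose u (n : nat) : R := n%:R^-1; pose y n := upsilon s n.
have Ou : Otau 2 u := Otau_inv_nat.
have Oy : Otau 0 y.
  exists 1; apply: nearW => n; rewrite expr0 mulr1 ger0_norm; by have /andP[] := upsilon_itv s n.
have Ou1 : Otau 1 (fun n => (1 + u n) - 1).
  apply: (@Otau_ext _ 1 u); last exact: OtauW Ou.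
  by apply: nearW => n; ring.
have O1 : Otau 1 (fun n => ((1 - s) - y n * u n) - (1 - s)).
  apply: (@Otau_ext _ 1 (fun n => - (y n * u n))).
    by apply: nearW => n; ring.
  by apply: OtauN; apply: (@OtauW _ (0 + 2)) => //; exact: OtauM.
have Oi1 := Otau_inv (oner_neq0 _) Ou1.
have Oi2 := Otau_inv (lt0r_neq0 s1') O1.
pose t n := s + (y n + 1 - s) * u n / (1 + u n).
have Ot : Otau 2 (fun n => t n - s).
  apply: (@Otau_ext _ 2 (fun n => (y n + 1 - s) * (u n * (1 + u n)^-1))).
    by apply: nearW => n; rewrite /t; ring.
  apply: (@OtauM _ 0 2); first by do 2?[apply: OtauB || apply: OtauD] => //; exact: Otau_cst.
  exact: (@OtauM _ 2 0).
pose E1 n := - ((y n + 1 - s) * (u n * u n * (1 + u n)^-1)) / delta.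
pose E2 n := - ((delta - s) / (1 - s) * (y n * (u n * u n) * ((1 - s) - y n * u n)^-1)) / delta.
pose E3 n := ((t n - s) * (u n * ((1 - s) - y n * u n)^-1)) / delta.
apply: (@Otau_ext _ 4 (fun n => E1 n + E2 n + E3 n)); last first.
  have Ouu : Otau 4 (fun n => u n * u n) by exact: (@OtauM _ 2 2).
  apply: OtauD; first apply: OtauD.
  - rewrite /E1; apply: (@OtauM _ 4 0); last exact: Otau_cst.
    apply: OtauN; apply: (@OtauM _ 0 4).
      by do 2?[apply: OtauB || apply: OtauD] => //; exact: Otau_cst.
    exact: (@OtauM _ 4 0).
  - rewrite /E2; apply: (@OtauM _ 4 0); last exact: Otau_cst.
    apply: OtauN; apply: OtauZ; apply: (@OtauM _ 4 0) => //.
    exact: (@OtauM _ 0 4).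
  - rewrite /E3; apply: (@OtauM _ 4 0); last exact: Otau_cst.
    by apply: (@OtauM _ 2 2) => //; exact: (@OtauM _ 2 0).
have ds : 0 < delta - s by rewrite subr_gt0.
have hlt : \forall n \near \oo, (ceil_nat (s * n%:R) < n)%N.
  by apply: ceil_nat_lt_near; rewrite s0.
apply: filterS3 (near_nat_gt (2 / (delta - s))) hlt (nbhs_infty_gt 0) => n hn ln n0.
have n0R : 0 < n%:R :> R by rewrite ltr0n.
have lE := ceil_natE n s0; rewrite -/(y n) in lE.
have /andP[y0 y1] := upsilon_itv s n; rewrite -/(y n) in y0 y1.
have tE : (ceil_nat (s * n%:R)).+1%:R / n.+1%:R = t n.
  rewrite /t /u -natr1 -(natr1 n) lE; field.
  by rewrite !gt_eqF ?addr_gt0// ltW.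
rewrite epsbar0_value//; last first.
  rewrite ltW// andbT ltr_pdivrMr ?ltr0n// -natr1 -(natr1 n) lE.
  move: hn; rewrite ltr_pdivrMr// => hn; lra.
rewrite tE natrB 1?ltnW// lE.
have nl : n%:R - (s * n%:R + y n) = n%:R * ((1 - s) - y n * u n).
  by rewrite /u; field; rewrite gt_eqF.
have nl0 : n%:R * ((1 - s) - y n * u n) != 0 :> R.
  by rewrite -nl subr_eq0 -lE gt_eqF// ltr_nat.
have nl1 : (1 - s) - y n * u n != 0 by move: nl0; rewrite mulf_eq0 negb_or => /andP[].
have u1 : 1 + u n != 0 by rewrite gt_eqF// addr_gt0// invr_gt0.
rewrite nl -/(u n) -/(y n) /E1 /E2 /E3 /t.
have -> : n%:R = (u n)^-1 by rewrite invrK.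
have un : u n != 0 by rewrite invr_eq0 gt_eqF.
by field; rewrite un nl1 u1 !gt_eqF.
Qed.

End Lossless.

(** * The central limit scale *)

Lemma distr_between {R : realType} (A B Q q : R) : A <= Q <= B ->
  `|Q - q| <= `|A - q| + `|B - q|.
Proof.
move=> /andP[AQ QB]; have h1 := ler_norm (B - q); have h2 := ler_norm (q - A).
rewrite distrC in h2; have := normr_ge0 (A - q); have := normr_ge0 (B - q).
by rewrite ler_norml => h3 h4; apply/andP; split; lra.
Qed.

Section LocalLimit.
Context {R : realType}.
Variables (v s x : R) (k l : nat -> nat).
Hypotheses (v01 : 0 < v < 1) (s01 : 0 < s < 1).
Hypothesis Hk : Otau 2 (fun n => (k n)%:R / n%:R - (s + x * tau n)).
Hypothesis Hl : Otau 2 (fun n => (l n)%:R / n%:R - v * s).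

Let v0 : 0 < v. Proof. by case/andP: v01. Qed.
Let v1 : 0 < 1 - v. Proof. by case/andP: v01 => _; rewrite subr_gt0. Qed.
Let s0 : 0 < s. Proof. by case/andP: s01. Qed.
Let s1 : 0 < 1 - s. Proof. by case/andP: s01 => _; rewrite subr_gt0. Qed.

Let K (n : nat) : R := (k n)%:R / n%:R.
Let L (n : nat) : R := (l n)%:R / n%:R.
Let a (n : nat) : R := (l n)%:R / (k n)%:R.

Let K1 : Otau 1 (fun n => K n - s).
Proof.
have h := OtauD (OtauW (isT : (1 <= 2)%N) Hk) (OtauZ x Otau_tau).
by apply: (Otau_ext _ h); apply: nearW => n; rewrite -/(K n); ring.
Qed.

Let L1 : Otau 1 (fun n => L n - v * s).
Proof. exact: OtauW Hl. Qed.

Lemma near_scale : \forall n \near \oo,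
  [/\ (0 < n)%N, (0 < l n)%N, ((l n).+1 < k n)%N & (k n < n)%N].
Proof.
have vs0 : 0 < v * s by rewrite mulr_gt0.
have e1 : 0 < s * (1 - v) / 4 by rewrite !mulr_gt0 ?invr_gt0.
have e2 : 0 < v * s / 2 by rewrite divr_gt0.
have e3 : 0 < (1 - s) / 2 by rewrite divr_gt0.
apply: filterS3 (Otau_near_lt L1 e2) (filterI (Otau_near_lt K1 e1) (Otau_near_lt L1 e1)) _.
  2: exact: (filterI (Otau_near_lt K1 e3) (filterI (nbhs_infty_gt 0) (near_nat_gt (2 / (s * (1 - v)))))).
move=> n hL [hK hL'] [hK' [n0 hn]]; have n0R : 0 < n%:R :> R by rewrite ltr0n.
move: hL hK hL' hK'; rewrite !ltr_norml => /andP[h1 _] /andP[h2 _] /andP[_ h3] /andP[_ h4].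
split => //.
- rewrite -(ltr_nat R) -(ltr_pM2r (x := n%:R^-1)) ?invr_gt0// mul0r -/(L n); lra.
- rewrite -(ltr_nat R) -natr1 -(ltr_pM2r (x := n%:R^-1)) ?invr_gt0// mulrDl mul1r.
  rewrite -/(L n) -/(K n).
  have : n%:R^-1 < s * (1 - v) / 2 :> R.
    rewrite invf_plt ?posrE ?divr_gt0 ?mulr_gt0//.
    by rewrite invf_div.
  lra.
- rewrite -(ltr_nat R) -(ltr_pM2r (x := n%:R^-1)) ?invr_gt0// divff ?gt_eqF//.
  rewrite -/(K n); lra.
Qed.

Let KV0 : Otau 0 (fun n => (K n)^-1). Proof. exact: Otau_inv (lt0r_neq0 s0) K1. Qed.
Let KV1 : Otau 1 (fun n => (K n)^-1 - s^-1).
Proof. exact: Otau_inv_approx (lt0r_neq0 s0) K1. Qed.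

Let a2 : Otau 2 (fun n => a n - v + v * x / s * tau n).
Proof.
have h1 : Otau 2 (fun n => ((L n - v * s) - v * (K n - (s + x * tau n))) * (K n)^-1).
  by apply: (@OtauM _ 2 0) => //; apply: OtauB => //; exact: OtauZ.
have h2 : Otau 2 (fun n => (v * x) * (tau n * ((K n)^-1 - s^-1))).
  by apply: OtauZ; apply: (@OtauM _ 1 1) => //; exact: Otau_tau.
apply: (Otau_ext _ (OtauB h1 h2)); apply: filterS near_scale => n [n0 l0 lk kn].
have kR : (k n)%:R != 0 :> R by rewrite pnatr_eq0 -lt0n (ltn_trans _ lk).
have nR : n%:R != 0 :> R by rewrite pnatr_eq0 -lt0n.
rewrite /a /K /L.
by field; rewrite kR nR gt_eqF.
Qed.

Let a1 : Otau 1 (fun n => a n - v).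
Proof.
have h := OtauB (OtauW (isT : (1 <= 2)%N) a2) (OtauZ (v * x / s) Otau_tau).
by apply: (Otau_ext _ h); apply: nearW => n; rewrite /=; ring.
Qed.

Let a01 n : (0 < l n)%N -> ((l n).+1 < k n)%N -> 0 < a n < 1.
Proof.
move=> l0 lk; have k0 : 0 < (k n)%:R :> R by rewrite ltr0n (ltn_trans _ lk).
have l0R : 0 < (l n)%:R :> R by rewrite ltr0n.
by rewrite /a divr_gt0//= ltr_pdivrMr// mul1r ltr_nat ltnW.
Qed.

(** Curvature of the relative entropy at [v]; the value [q0] at [a n = v] makes
    [2 * KL (a n) v = q n * (a n - v) ^ 2] hold there as well. *)
Let q0 : R := (v * (1 - v))^-1.
Let q (n : nat) : R := if a n == v then q0 else 2 * KL (a n) v / (a n - v) ^+ 2.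

(** Squeezed between the two quadratic bounds on the relative entropy. *)
Let q1 : Otau 1 (fun n => q n - q0).
Proof.
have v0n := lt0r_neq0 v0; have v1n := lt0r_neq0 v1.
have aV : Otau 1 (fun n => (a n)^-1 - v^-1) by exact: Otau_inv_approx a1.
have a1V : Otau 1 (fun n => (1 - a n)^-1 - (1 - v)^-1).
  apply: Otau_inv_approx => //.
  by apply: (Otau_ext _ (OtauN a1)); apply: nearW => n; ring.
pose U n := a n * (1 - a n)^-1 * v ^- 2; pose W n := (a n)^-1 * (1 - v)^-1.
have hU : Otau 1 (fun n => U n - q0).
  have h := OtauM (Otau_mul_approx a1 a1V (Otau_bounded a1V)) (Otau_cst (v ^- 2)).
  by apply: (Otau_ext _ h); apply: nearW => n; rewrite /U mulrBl; congr (_ - _);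
    rewrite /q0; field; rewrite v0n v1n.
have hW : Otau 1 (fun n => W n - q0).
  have h := OtauM aV (Otau_cst (1 - v)^-1).
  by apply: (Otau_ext _ h); apply: nearW => n; rewrite mulrBl /W /q0 [(v * _)^-1]invfM.
have [C hC] := hU; have [D hD] := hW; exists (C + D).
apply: filterS3 near_scale hC hD => n [n0 l0 lk kn] hU' hW'.
rewrite mulrDl; apply: le_trans (lerD hU' hW').
have an := a01 l0 lk.
rewrite /q; case: eqVneq => [_|nav]; first by rewrite subrr normr0 addr_ge0.
have sq : 0 < (a n - v) ^+ 2 by rewrite exprn_even_gt0//= subr_eq0.
have e1 : U n * (a n - v) ^+ 2 = a n / (1 - a n) * ((v - a n) ^+ 2 / v ^+ 2).
  by rewrite /U; ring.
have e2 : W n * (a n - v) ^+ 2 = (v - a n) ^+ 2 / (a n * (1 - v)).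
  by rewrite /W [(a n * _)^-1]invfM; ring.
set Q := 2 * KL (a n) v / _.
have [av|va] := leP (a n) v.
  have h : a n <= v < 1 by rewrite av; case/andP: v01.
  have hu : U n <= Q by rewrite ler_pdivlMr// e1; exact: KL_ge_var.
  have hw : Q <= W n by rewrite ler_pdivrMr// e2; exact: KL_le_chi2.
  by apply: distr_between; rewrite hu.
have h : 0 < v <= a n by rewrite v0 ltW.
have hu : Q <= U n by rewrite ler_pdivrMr// e1; exact: KL_le_var.
have hw : W n <= Q by rewrite ler_pdivlMr// e2; exact: KL_ge_chi2.
by rewrite [leRHS]addrC; apply: distr_between; rewrite hw.
Qed.

(** Central limit theorem: the centred count [l - v k], at [k = s n + x sqrt n],
    in units of the standard deviation. *)
Definition scale_limit : R := Num.sqrt s * (- (v * x / s)) * Num.sqrt (v * (1 - v))^-1.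

Lemma zdev_limit : Otau 1 (fun n => zdev (k n) (l n) v - scale_limit).
Proof.
have sK := Otau_sqrt_approx s0 K1.
have q0p : 0 < q0 by rewrite invr_gt0 mulr_gt0.
have sq := Otau_sqrt_approx q0p q1.
have at1 : Otau 1 (fun n => (a n - v) / tau n - (- (v * x / s))).
  apply: (Otau_ext _ (Otau_div_tau a2)); apply: filterS (nbhs_infty_gt 0) => n n0.
  by field; rewrite !gt_eqF ?tau_gt0.
have h := Otau_mul_approx (Otau_mul_approx sK at1 (Otau_bounded at1)) sq (Otau_bounded sq).
apply: (Otau_ext _ h); apply: filterS near_scale => n [n0 l0 lk kn].
congr (_ - _); have an := a01 l0 lk.
have kR : 0 < (k n)%:R :> R by rewrite ltr0n (ltn_trans _ lk).
have nR : 0 < n%:R :> R by rewrite ltr0n.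
have KE : Num.sqrt (K n) = Num.sqrt (k n)%:R * tau n.
  by rewrite /K sqrtrM ?ler0n// sqrt_inv_nat.
have -> : Num.sqrt (K n) * ((a n - v) / tau n) = Num.sqrt (k n)%:R * (a n - v).
  by rewrite KE; field; rewrite gt_eqF// tau_gt0.
rewrite /zdev -/(a n) /q; case: eqVneq => [->|nav].
  by rewrite subrr sgr0 mul0r mulr0 mul0r.
have sq2 : 0 < (a n - v) ^+ 2 by rewrite exprn_even_gt0//= subr_eq0.
have KL0 : 0 <= 2 * KL (a n) v.
  by rewrite mulr_ge0// KL_ge0//; case/andP: an => /ltW-> /ltW->.
rewrite sqrtrM// sqrtrV ?ltW// sqrtr_sqr.
have -> : 2 * (k n)%:R * KL (a n) v = (k n)%:R * (2 * KL (a n) v) by ring.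
rewrite [in RHS]sqrtrM ?ler0n//.
have av : a n - v != 0 by rewrite subr_eq0.
have -> : a n - v = Num.sg (a n - v) * `|a n - v| by rewrite -numEsg.
rewrite sgrM sgr_norm av mulr1 sgr_id !normrM normr_id normr_sg av mul1r.
by field; rewrite normr_eq0.
Qed.

End LocalLimit.

Section ConditionalLimit.
Context {R : realType}.
Variables (v s x : R) (k l : nat -> nat).
Hypotheses (v01 : 0 < v < 1) (s01 : 0 < s < 1).
Hypothesis Hk : Otau 2 (fun n => (k n)%:R / n%:R - (s + x * tau n)).
Hypothesis Hl : Otau 2 (fun n => (l n)%:R / n%:R - v * s).

Let v0 : 0 < v. Proof. by case/andP: v01. Qed.
Let v1 : 0 < 1 - v. Proof. by case/andP: v01 => _; rewrite subr_gt0. Qed.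
Let s0 : 0 < s. Proof. by case/andP: s01. Qed.

Let y : R := scale_limit v s x.

Let K (n : nat) : R := (k n)%:R / n%:R.
Let L (n : nat) : R := (l n)%:R / n%:R.

Let K1 : Otau 1 (fun n => K n - s).
Proof.
have h := OtauD (OtauW (isT : (1 <= 2)%N) Hk) (OtauZ x Otau_tau).
by apply: (Otau_ext _ h); apply: nearW => n; rewrite -/(K n); ring.
Qed.

Let L1 : Otau 1 (fun n => L n - v * s). Proof. exact: OtauW Hl. Qed.

Let scale := near_scale v01 s01 Hk Hl.

(** The upper normal bound is the lower one at [l + 1], a shift invisible at this
    order. *)
Lemma bcdf_limit : Otau 1 (fun n => bcdf v (k n) (l n) - Phi y).
Proof.
have HlS : Otau 2 (fun n => (l n).+1%:R / n%:R - v * s).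
  apply: (Otau_ext _ (OtauD Hl Otau_inv_nat)); apply: nearW => n.
  by rewrite -natr1; ring.
have [C hC] := Otau_lip (@Phi_lipschitz R) (zdev_limit v01 s01 Hk Hl).
have [D hD] := Otau_lip (@Phi_lipschitz R) (zdev_limit v01 s01 Hk HlS).
exists (C + D); apply: filterS3 scale hC hD => n [n0 l0 lk kn] h1 h2.
rewrite mulrDl; apply: le_trans (lerD h1 h2); apply: distr_between.
by rewrite bcdf_ge_Phi ?l0 ?(ltnW lk)//= bcdf_le_Phi.
Qed.

Let peak1 : Otau 1 (fun n => peak_factor (k n) (l n) - 1 : R).
Proof.
have vs0 : v * s != 0 by rewrite mulf_neq0 ?gt_eqF.
have LV := Otau_inv vs0 L1.
have inv1 : Otau 1 (fun n => n%:R^-1 : R) by exact: OtauW Otau_inv_nat.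
have L1' : Otau 1 (fun n => (L n + n%:R^-1) - v * s).
  by apply: (Otau_ext _ (OtauD L1 inv1)); apply: nearW => n; ring.
have D1 : Otau 1 (fun n => (K n - (L n + n%:R^-1)) - s * (1 - v)).
  by apply: (Otau_ext _ (OtauB K1 L1')); apply: nearW => n; ring.
have sv0 : 0 < s * (1 - v) by rewrite mulr_gt0.
have DV := Otau_inv_approx (lt0r_neq0 sv0) D1.
have M1 := Otau_mul_approx L1' DV (Otau_bounded DV).
have M2 := Otau_mul_approx K1 M1 (Otau_bounded M1).
have c0 : 0 < s * (v * s * (s * (1 - v))^-1).
  by rewrite !mulr_gt0// invr_gt0 mulr_gt0.
have S1 := Otau_bounded (Otau_sqrt_approx c0 M2).
have T1 := OtauZ 2 (OtauM Otau_tau (@OtauM _ 0 0 _ _ S1 LV)).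
have [C hC] := T1; exists C; apply: filterS2 scale hC => n [n0 l0 lk kn].
apply: le_trans; apply: le_trans (peak_factor_near1 l0 lk) _.
apply: le_trans (ler_norm _).
have kR : 0 < (k n)%:R :> R by rewrite ltr0n (ltn_trans _ lk).
have lR : 0 < (l n)%:R :> R by rewrite ltr0n.
have nR : 0 < n%:R :> R by rewrite ltr0n.
have klR : 0 < (k n - (l n).+1)%:R :> R by rewrite ltr0n subn_gt0.
have klE : (k n - (l n).+1)%:R = (k n)%:R - (l n)%:R - 1 :> R.
  by rewrite natrB 1?ltnW// -natr1; ring.
have klR' : (k n)%:R - (l n)%:R - 1 != 0 :> R by rewrite -klE gt_eqF.
have -> : K n * ((L n + n%:R^-1) / (K n - (L n + n%:R^-1))) =
    n%:R^-1 * ((k n)%:R * ((l n).+1%:R / (k n - (l n).+1)%:R)).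
  rewrite /K /L klE -natr1.
  move: (n%:R : R) (k n)%:R (l n)%:R (gt_eqF nR) klR' => N k' l' hN hkl.
  have -> : k' / N - (l' / N + N^-1) = (k' - l' - 1) / N by ring.
  by field; rewrite hN hkl.
have nV0 : 0 <= n%:R^-1 :> R by rewrite invr_ge0.
rewrite (sqrtrM _ nV0) sqrt_inv_nat /L.
have t0 : tau n * tau n = n%:R^-1 :> R by rewrite -expr2 tau_sqr.
set Q := Num.sqrt _; rewrite le_eqVlt; apply/predU1P; left.
transitivity (2 * (Q * (n%:R * (tau n * tau n)) / (l n)%:R)); last first.
  by field; rewrite !gt_eqF.
by rewrite t0 divff ?mulr1// gt_eqF.
Qed.

(** Limit of [sqrt n] times the probability that one more trial is the one that
    exceeds [l]. *)
Definition mass_limit : R :=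
  v / Num.sqrt s * Num.sqrt ((1 - v) / v) * phi y / (1 - v).

Lemma binp_limit : Otau 1 (fun n => v * binp v (k n).-1 (l n) / tau n - mass_limit).
Proof.
have sK := Otau_sqrt_approx s0 K1.
have ss0 : Num.sqrt s != 0 by rewrite gt_eqF// sqrtr_gt0.
have sKV := Otau_inv_approx ss0 sK.
have LV := Otau_inv_approx (lt0r_neq0 (mulr_gt0 v0 s0)) L1.
have KLV := Otau_mul_approx K1 LV (Otau_bounded LV).
have v0n := lt0r_neq0 v0; have s0n := lt0r_neq0 s0.
have ratio1 : Otau 1 (fun n => (K n / L n - 1) - (1 - v) / v).
  apply: (Otau_ext _ KLV); apply: nearW => n.
  have -> : s * (v * s)^-1 = v^-1 by field; rewrite v0n s0n.
  have -> : (1 - v) / v = v^-1 - 1 by field.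
  by ring.
have S1 := Otau_sqrt_approx (divr_gt0 v1 v0) ratio1.
have P1 := Otau_lip phi_lipschitz (zdev_limit v01 s01 Hk Hl).
have M1 := Otau_mul_approx S1 P1 (Otau_bounded P1).
have M2 := Otau_mul_approx peak1 sKV (Otau_bounded sKV).
have M3 := OtauZ (v / (1 - v)) (Otau_mul_approx M2 M1 (Otau_bounded M1)).
apply: (Otau_ext _ M3); apply: filterS scale => n [n0 l0 lk kn].
have kR : 0 < (k n)%:R :> R by rewrite ltr0n (ltn_trans _ lk).
have lR : 0 < (l n)%:R :> R by rewrite ltr0n.
have nR : 0 < n%:R :> R by rewrite ltr0n.
have t0 := @tau_gt0 R n n0.
rewrite binp_normal ?l0 ?(ltnW lk)//.
have -> : (1 - (l n)%:R / (k n)%:R) / ((l n)%:R / (k n)%:R) = K n / L n - 1 :> R.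
  by rewrite /K /L; field; rewrite !gt_eqF.
have -> : Num.sqrt (K n) = Num.sqrt (k n)%:R * tau n.
  by rewrite /K (sqrtrM _ (ltW kR)) sqrt_inv_nat.
rewrite mulrBr; congr (_ - _); last by rewrite /mass_limit mul1r -/y; ring.
by field; rewrite !gt_eqF// ?sqrtr_gt0.
Qed.

(** With [B = bcdf v (k - 1) l] and [eta = v * binp v (k - 1) l / B], the quotient
    is [k / (k + (n + 1 - k) * (1 - eta))]; [eta] is of order [1 / sqrt n] and its
    leading term adds to the drift [x] of [k]. *)
Lemma conditional_limit :
  Otau 2 (fun n => accept_bad v n (l n) (k n) / accept_prob v n (l n) (k n) -
    (s + (x + s * (1 - s) * (mass_limit / Phi y)) * tau n)).
Proof.
have Py : 0 < Phi y.
  by apply: le_lt_trans (Phi_ge0 (y - 1)) _; apply: Phi_lt; lra.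
pose p n := v * binp v (k n).-1 (l n).
have p1 : Otau 1 p.
  apply: (Otau_ext _ (@OtauM _ 0 1 _ _ (Otau_bounded binp_limit) Otau_tau)).
  apply: filterS (nbhs_infty_gt 0) => n n0.
  by rewrite divfK// gt_eqF// tau_gt0.
pose B n := bcdf v (k n).-1 (l n).
have B1 : Otau 1 (fun n => B n - Phi y).
  apply: (Otau_ext _ (OtauD bcdf_limit p1)).
  apply: filterS scale => n [n0 l0 lk kn]; rewrite /B /p.
  have -> : bcdf v (k n) (l n) = bcdf v (k n).-1 (l n) - v * binp v (k n).-1 (l n).
    by rewrite -bcdf_trialS prednK// (ltn_trans _ lk).
  by ring.
have BV1 := Otau_inv_approx (lt0r_neq0 Py) B1.
pose e0 := mass_limit / Phi y; pose eta n := p n / B n.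
have eta1 : Otau 1 (fun n => eta n / tau n - e0).
  apply: (Otau_ext _ (Otau_mul_approx binp_limit BV1 (Otau_bounded BV1))).
  by apply: nearW => n; congr (_ - _); exact: mulrAC.
have eta2 : Otau 2 (fun n => eta n - e0 * tau n).
  apply: (Otau_ext _ (@OtauM _ 1 1 _ _ eta1 Otau_tau)).
  apply: filterS (nbhs_infty_gt 0) => n n0.
  by rewrite mulrBl divfK// gt_eqF// tau_gt0.
have e1 : Otau 1 eta.
  have h := OtauD (OtauW (isT : (1 <= 2)%N) eta2) (OtauZ e0 Otau_tau).
  by apply: (Otau_ext _ h); apply: nearW => n; ring.
pose D n := 1 + n%:R^-1 - (1 + n%:R^-1 - K n) * eta n.
have inv2 : Otau 2 (fun n => n%:R^-1 : R) := Otau_inv_nat.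
have inv0 := OtauW (leq0n 2) inv2.
have K0 := Otau_bounded K1.
have D2 : Otau 2 (fun n => D n - (1 - (1 - s) * e0 * tau n)).
  have h1 : Otau 2 (fun n => n%:R^-1 * (1 - eta n)).
    apply: (@OtauM _ 2 0) => //; apply: OtauB; first exact: Otau_cst.
    exact: OtauW e1.
  have h2 : Otau 2 (fun n => (1 - K n) * (eta n - e0 * tau n)).
    by apply: (@OtauM _ 0 2) => //; apply: OtauB => //; exact: Otau_cst.
  have h3 := OtauZ e0 (@OtauM _ 1 1 _ _ K1 Otau_tau).
  apply: (Otau_ext _ (OtauD (OtauB h1 h2) h3)); apply: nearW => n.
  by rewrite /D; ring.
have D1 : Otau 1 (fun n => D n - 1).
  have h := OtauB (OtauW (isT : (1 <= 2)%N) D2) (OtauZ ((1 - s) * e0) Otau_tau).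
  by apply: (Otau_ext _ h); apply: nearW => n; ring.
have DV := Otau_inv (oner_neq0 _) D1.
pose C := x + s * (1 - s) * e0.
have sC : Otau 0 (fun n => s + C * tau n).
  by apply: OtauD; [exact: Otau_cst|exact/OtauZ/(OtauW _ Otau_tau)].
have num : Otau 2 (fun n => K n - (s + C * tau n) * D n).
  have h1 := OtauZ (C * (1 - s) * e0) (@Otau_tauX R 2).
  have h2 := @OtauM _ 0 2 _ _ sC D2.
  apply: (Otau_ext _ (OtauB (OtauD Hk h1) h2)); apply: nearW => n.
  by rewrite -/(K n) /C; ring.
apply: (Otau_ext _ (@OtauM _ 2 0 _ _ num DV)).
apply: filterS2 scale (near_far0 (oner_neq0 _) D1) => n [n0 l0 lk kn] hD.
have Dn : D n != 0 by rewrite -normr_gt0 (lt_le_trans _ hD)// normr1 divr_gt0.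
have nR : 0 < n%:R :> R by rewrite ltr0n.
have Bn : 0 < B n by apply: bcdf_gt0; rewrite (ltW v0)/= -subr_gt0.
have BE : bcdf v (k n) (l n) = B n - p n.
  by rewrite /p -bcdf_trialS prednK// (ltn_trans _ lk).
have DE : D n = ((k n)%:R * B n + (n.+1%:R - (k n)%:R) * (B n - p n)) / (n%:R * B n).
  by rewrite /D /K /eta -natr1; field; rewrite !gt_eqF.
have Dn' : (k n)%:R * B n + (n.+1%:R - (k n)%:R) * (B n - p n) != 0.
  by move: Dn; rewrite DE mulf_eq0 negb_or => /andP[].
rewrite mulrBl mulfK// -/e0 -/C; congr (_ - _).
rewrite /accept_bad /accept_prob BE -/(B n) DE /K.
have nS : n.+1%:R != 0 :> R by rewrite pnatr_eq0.
move: (n.+1%:R : R) nS Dn' => N nS Dn'.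
by field; rewrite nS Dn' !gt_eqF.
Qed.

End ConditionalLimit.

(** * The lossy case at fixed significance *)

Section FixedSignificance.
Context {R : realType}.
Implicit Types (s delta lam v x : R).

Lemma Otau_squeeze j (f g h e : nat -> R) :
  (\forall n \near \oo, f n <= g n <= h n) ->
  Otau j (fun n => f n - e n) -> Otau j (fun n => h n - e n) ->
  Otau j (fun n => g n - e n).
Proof.
move=> sq [C hC] [D hD]; exists (C + D); apply: filterS3 sq hC hD => n hn h1 h2.
rewrite mulrDl; apply: le_trans (lerD h1 h2); exact: distr_between.
Qed.

Definition clt_count s x n : nat := ceil_nat (s * n%:R + x * Num.sqrt n%:R).

Lemma near_clt_pos s x (J : R) : 0 < s ->
  \forall n \near \oo, J <= s * n%:R + x * Num.sqrt n%:R.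
Proof.
move=> s0; have x0 : 0 < `|x| + 1 by rewrite ltr_wpDl.
have e0 : 0 < s / 2 / (`|x| + 1) by rewrite !divr_gt0.
apply: filterS3 (tau_near_lt e0) (near_nat_gt (`|J| * (2 / s))) (nbhs_infty_gt 0).
move=> n ht hJ n0; have sn0 : 0 < Num.sqrt n%:R :> R by rewrite sqrtr_gt0 ltr0n.
have nE : n%:R = Num.sqrt n%:R * Num.sqrt n%:R :> R by rewrite -expr2 sqr_sqrtr ?ler0n.
have h1 : `|x| + 1 <= s / 2 * Num.sqrt n%:R.
  move: ht; rewrite /tau ltr_pdivlMr// mulrC => /ltW.
  by rewrite ler_pdivrMr.
have h2 : `|J| <= s / 2 * n%:R.
  by move/ltW: hJ; rewrite -ler_pdivlMr ?divr_gt0// invf_div mulrC.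
have h3 : - x <= s / 2 * Num.sqrt n%:R.
  by apply: le_trans h1; rewrite (le_trans (ler_norm _))// normrN lerDl.
have h4 : - x * Num.sqrt n%:R <= s / 2 * n%:R.
  by rewrite {2}nE mulrA ler_wpM2r// ltW.
by have := ler_norm J; lra.
Qed.

Lemma clt_shift s x (k : nat -> nat) (C : R) :
  (\forall n \near \oo, `|(k n)%:R - (s * n%:R + x * Num.sqrt n%:R)| <= C) ->
  Otau 2 (fun n => (k n)%:R / n%:R - (s + x * tau n)).
Proof.
move=> h; exists C; apply: filterS2 h (nbhs_infty_gt 0) => n hn n0.
have n0R : 0 < n%:R :> R by rewrite ltr0n.
have sn0 : 0 < Num.sqrt n%:R :> R by rewrite sqrtr_gt0.
have nE : Num.sqrt n%:R ^+ 2 = n%:R :> R by rewrite sqr_sqrtr ?ler0n.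
have -> : (k n)%:R / n%:R - (s + x * tau n) =
   ((k n)%:R - (s * n%:R + x * Num.sqrt n%:R)) * tau n ^+ 2.
  by rewrite /tau; field: nE; rewrite !gt_eqF.
rewrite normrM [`|tau n ^+ 2|]ger0_norm ?exprn_ge0 ?tau_ge0//.
by rewrite ler_wpM2r ?exprn_ge0 ?tau_ge0.
Qed.

Lemma clt_count_near s x : 0 < s -> \forall n \near \oo,
  `|(clt_count s x n)%:R - (s * n%:R + x * Num.sqrt n%:R)| <= 1.
Proof.
move=> s0; apply: filterS (near_clt_pos x 0 s0) => n h.
have /andP[h1 h2] := ceil_nat_itv h.
by rewrite /clt_count ler_norml; apply/andP; split; lra.
Qed.

Lemma clt_count_add s x j : 0 < s ->
  Otau 2 (fun n => (clt_count s x n + j)%:R / n%:R - (s + x * tau n)).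
Proof.
move=> s0; apply: (@clt_shift s x _ (1 + j%:R)).
apply: filterS (clt_count_near x s0) => n h.
by rewrite natrD addrAC (le_trans (ler_normD _ _))// lerD// normr_nat.
Qed.

Lemma clt_count_sub s x j : 0 < s ->
  Otau 2 (fun n => (clt_count s x n - j)%:R / n%:R - (s + x * tau n)).
Proof.
move=> s0; apply: (@clt_shift s x _ (1 + j%:R)).
apply: filterS2 (clt_count_near x s0) (near_clt_pos x (1 + j%:R) s0) => n h hj.
have jn : (j <= clt_count s x n)%N.
  by rewrite -(ler_nat R); move: h; rewrite ler_norml => /andP[h _]; lra.
by rewrite natrB// addrAC (le_trans (ler_normB _ _))// lerD// normr_nat.
Qed.

Lemma ceil_nat_Otau (r : R) : 0 <= r ->
  Otau 2 (fun n => (ceil_nat (r * n%:R))%:R / n%:R - r).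
Proof.
move=> r0; exists 1; apply: filterS (nbhs_infty_gt 0) => n n0.
have n0R : 0 < n%:R :> R by rewrite ltr0n.
have /andP[h1 h2] := ceil_nat_itv (mulr_ge0 r0 (ler0n R n)).
have -> : (ceil_nat (r * n%:R))%:R / n%:R - r =
  ((ceil_nat (r * n%:R))%:R - r * n%:R) / n%:R by field; rewrite gt_eqF.
rewrite tau_sqr normrM [`|n%:R^-1|]ger0_norm ?invr_ge0//.
by rewrite ler_wpM2r ?invr_ge0// ler_norml; apply/andP; split; lra.
Qed.

Section Shift.
Variables (v s x : R) (l : nat -> nat).
Hypotheses (v01 : 0 < v < 1) (s01 : 0 < s < 1).
Hypothesis Hl : Otau 2 (fun n => (l n)%:R / n%:R - v * s).
Let s0 : 0 < s. Proof. by case/andP: s01. Qed.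
Let c : R := mass_limit v s x.

Let c0 : 0 < c.
Proof.
have v0 : 0 < v by case/andP: v01.
have v1 : 0 < 1 - v by case/andP: v01 => _; rewrite subr_gt0.
have hs : 0 < Num.sqrt s by rewrite sqrtr_gt0.
have hv : 0 < Num.sqrt ((1 - v) / v) by rewrite sqrtr_gt0 divr_gt0.
by have := phi_gt0 (scale_limit v s x) => hp; rewrite /c /mass_limit; sign_tac.
Qed.

(** Each step of [k] changes the distribution function by at least a fixed multiple
    of [1 / sqrt n]. Its deviation from the limit is of that order too, so finitely
    many steps overcome it. *)
Let mass_ge (k : nat -> nat) :
  Otau 2 (fun n => (k n)%:R / n%:R - (s + x * tau n)) ->
  \forall n \near \oo, c / 2 * tau n <= v * binp v (k n).-1 (l n).
Proof.
move=> Hk; have c20 : 0 < c / 2 by rewrite divr_gt0.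
apply: filterS2 (Otau_near_lt (binp_limit v01 s01 Hk Hl) c20) (nbhs_infty_gt 0).
move=> n h n0; have t0 := @tau_gt0 R n n0.
move: h; rewrite ltr_norml => /andP[h _].
rewrite -ler_pdivlMr//; apply: ltW; move: h; rewrite -/c.
by move: (v * binp _ _ _ / _) c => z c'; lra.
Qed.

Let shift_down M : \forall n \near \oo,
  bcdf v (clt_count s x n) (l n) + M%:R * (c / 2 * tau n) <=
  bcdf v (clt_count s x n - M) (l n).
Proof.
elim: M => [|M IH]; first by apply: nearW => n; rewrite mul0r addr0 subn0.
have Hk := @clt_count_sub s x M s0.
apply: filterS3 IH (mass_ge Hk) (near_scale v01 s01 Hk Hl) => n h1 h2 [n0 l0 lk kn].
have -> : bcdf v (clt_count s x n - M.+1) (l n) =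
    bcdf v (clt_count s x n - M) (l n) + v * binp v (clt_count s x n - M).-1 (l n).
  rewrite subnS -{2}(@prednK (clt_count s x n - M)) ?(ltn_trans _ lk)//.
  by rewrite bcdf_trialS subrK.
by rewrite -natr1 mulrDl mul1r addrA lerD.
Qed.

Let shift_up M : \forall n \near \oo,
  bcdf v (clt_count s x n + M) (l n) + M%:R * (c / 2 * tau n) <=
  bcdf v (clt_count s x n) (l n).
Proof.
elim: M => [|M IH]; first by apply: nearW => n; rewrite mul0r addr0 addn0.
have Hk := @clt_count_add s x M.+1 s0.
apply: filterS2 IH (mass_ge Hk) => n h1; rewrite addnS /= => h2.
apply: le_trans h1; rewrite bcdf_trialS -natr1 mulrDl mul1r.
move: h2; move: (c / 2 * tau n) (v * _) => z w h; lra.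
Qed.

Lemma clt_lower : exists M, \forall n \near \oo,
  Phi (scale_limit v s x) <= bcdf v (clt_count s x n - M) (l n).
Proof.
have Hk := @clt_count_add s x 0 s0.
have [C hC] := bcdf_limit v01 s01 Hk Hl.
have [M /ltW hM] : exists M : nat, `|C| / (c / 2) < M%:R.
  by exists (Num.truncn (`|C| / (c / 2))).+1; exact: truncnS_gt.
exists M; apply: filterS2 hC (shift_down M) => n; rewrite addn0 expr1 => h1.
apply: le_trans; move: h1; rewrite ler_norml => /andP[h1 _].
have h2 : C * tau n <= M%:R * (c / 2 * tau n).
  rewrite mulrA ler_wpM2r ?tau_ge0//.
  have cc : 0 < c / 2 by rewrite divr_gt0.
  have := hM; rewrite (ler_pdivrMr _ _ cc); exact: le_trans (ler_norm _).
by lra.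
Qed.

Lemma clt_upper : exists M, \forall n \near \oo,
  bcdf v (clt_count s x n + M) (l n) < Phi (scale_limit v s x).
Proof.
have Hk := @clt_count_add s x 0 s0.
have [C hC] := bcdf_limit v01 s01 Hk Hl.
have [M hM] : exists M : nat, `|C| / (c / 2) < M%:R.
  by exists (Num.truncn (`|C| / (c / 2))).+1; exact: truncnS_gt.
exists M; apply: filterS3 hC (shift_up M) (nbhs_infty_gt 0) => n; rewrite addn0 expr1 => h1 h3 n0.
have t0 := @tau_gt0 R n n0; move: h1; rewrite ler_norml => /andP[_ h1].
have h2 : C * tau n < M%:R * (c / 2 * tau n).
  rewrite mulrA ltr_pM2r//.
  have cc : 0 < c / 2 by rewrite divr_gt0.
  have := hM; rewrite (ltr_pdivrMr _ _ cc); exact: le_lt_trans (ler_norm _).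
by lra.
Qed.

End Shift.

(** The drift [x] for which the limiting acceptance probability is [delta]. *)
Definition clt_drift s v delta : R := - (Phi_inv delta * Num.sqrt (s * (1 - v) / v)).

Lemma scale_limit_drift s v delta : 0 < s -> 0 < v < 1 ->
  scale_limit v s (clt_drift s v delta) = Phi_inv delta.
Proof.
move=> s0 /andP[v0 v1]; have v1' : 0 < 1 - v by rewrite subr_gt0.
rewrite /scale_limit /clt_drift !sqrtrM ?sqrtrV ?ltW ?invr_ge0 ?mulr_gt0//.
have hs : 0 < Num.sqrt s by rewrite sqrtr_gt0.
have hv : 0 < Num.sqrt v by rewrite sqrtr_gt0.
have hl : 0 < Num.sqrt (1 - v) by rewrite sqrtr_gt0.
have es : Num.sqrt s ^+ 2 = s by rewrite sqr_sqrtr// ltW.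
have ev : Num.sqrt v ^+ 2 = v by rewrite sqr_sqrtr// ltW.
rewrite sqrtrM ?ltW//.
field: es ev; by rewrite !gt_eqF.
Qed.

Lemma drift_coef s lam delta : 0 < s < 1 -> 0 < lam < 1 -> 0 < delta < 1 ->
  clt_drift s (1 - lam) delta + s * (1 - s) *
    (mass_limit (1 - lam) s (clt_drift s (1 - lam) delta) / delta) =
  coef_sqrt lam s delta.
Proof.
move=> /andP[s0 s1] lam01 /andP[d0 d1]; have /andP[l0 l1] := lam01.
have v0 : 0 < 1 - lam by rewrite subr_gt0.
have v01 : 0 < 1 - lam < 1 by rewrite v0 gtrBl.
rewrite /mass_limit scale_limit_drift// /coef_sqrt /clt_drift subKr.
set v := 1 - lam in v0 *.
have hs : 0 < Num.sqrt s by rewrite sqrtr_gt0.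
have hv : 0 < Num.sqrt v by rewrite sqrtr_gt0.
have hl : 0 < Num.sqrt lam by rewrite sqrtr_gt0.
have vV : 0 <= v^-1 by rewrite invr_ge0 ltW.
have sl : 0 <= s * lam by rewrite mulr_ge0 ?ltW.
rewrite (sqrtrM _ sl) (sqrtrM _ (ltW s0)) (sqrtrM _ (ltW l0)) (sqrtrM _ (ltW v0)).
rewrite (sqrtrV (ltW v0)).
have es : Num.sqrt s ^+ 2 = s by rewrite sqr_sqrtr// ltW.
have ev : Num.sqrt v ^+ 2 = v by rewrite sqr_sqrtr// ltW.
have el : Num.sqrt lam ^+ 2 = lam by rewrite sqr_sqrtr// ltW.
have s1n : 1 - s != 0 by rewrite subr_eq0 gt_eqF.
move: (Num.sqrt s) (Num.sqrt v) (Num.sqrt lam) hs hv hl es ev el => S V L hs hv hl es ev el.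
have [hs' hv' hl'] : [/\ S != 0, V != 0 & L != 0] by rewrite !gt_eqF.
rewrite -el -ev -[in LHS]es; rewrite -es in s1n *.
by field; rewrite s1n hs' hv' hl' gt_eqF.
Qed.

(** Counts moved by [M] in either direction bracket [delta], hence [epsbar], and
    have the same expansion. *)
Lemma epsbar_lossy_pos s lam delta : 0 < s < 1 -> 0 < lam < 1 -> 0 < delta < 1 ->
  Otau 2 (fun n => epsbar lam (ceil_nat ((1 - lam) * s * n%:R)) n delta -
    (s + coef_sqrt lam s delta * tau n)).
Proof.
move=> s01 lam01 d01; have /andP[s0 s1] := s01; have /andP[d0 d1] := d01.
have v01 : 0 < 1 - lam < 1 by lra.
set v := 1 - lam in v01 *; have /andP[v0 v1] := v01.
pose l n := ceil_nat (v * s * n%:R); pose x := clt_drift s v delta.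
have vs0 : 0 <= v * s by rewrite mulr_ge0 ?ltW.
have Hl : Otau 2 (fun n => (l n)%:R / n%:R - v * s) by exact: ceil_nat_Otau.
have yE : Phi (scale_limit v s x) = delta.
  by rewrite /x scale_limit_drift// Phi_invK.
have [M hM] := clt_lower x v01 s01 Hl; have [M' hM'] := clt_upper x v01 s01 Hl.
have Hk := clt_count_sub x M s0; have Hk' := clt_count_add x M'.+1 s0.
have cl := conditional_limit v01 s01 Hk Hl; have cl' := conditional_limit v01 s01 Hk' Hl.
rewrite yE /x /v drift_coef// in cl; rewrite yE /x /v drift_coef// in cl'.
have d01' : 0 < delta <= 1 by rewrite d0 ltW.
apply: (Otau_squeeze _ cl cl').
have sc := near_scale v01 s01 Hk Hl; have sc' := near_scale v01 s01 Hk' Hl.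
apply: filterS2 (filterI hM hM') (filterI sc sc') => n [h1 h2] [[n0 l0 lk kn] [_ _ lk' kn']].
have ln : (l n < n)%N by rewrite (ltn_trans _ kn)// (ltn_trans _ lk).
apply/andP; split.
  apply: epsbar_ge => //; first exact: leqW (ltnW kn).
  rewrite yE in h1; apply: (le_trans h1); apply: accept_prob_ge => //.
  exact: leqW (ltnW kn).
have kb : (0 < clt_count s x n + M'.+1 <= n.+1)%N.
  by rewrite (leq_ltn_trans (leq0n _) lk') (leqW (ltnW kn')).
apply: epsbar_le => //.
rewrite yE in h2; apply: le_lt_trans h2.
by have := @accept_prob_le R v n (l n) v01 _ kb; rewrite {2}addnS.
Qed.

(** Here [l = 0], and [k] ones are accepted with probability about [lam ^ k]: a
    bounded [k] already falls below [delta], and given acceptance with [k] ones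
    the last outcome is a one with probability of order [k / n]. *)
Lemma epsbar_lossy_0 lam delta : 0 < lam < 1 -> 0 < delta < 1 ->
  Otau 2 (fun n => epsbar lam 0 n delta).
Proof.
move=> lam01 /andP[d0 d1]; have /andP[l0 l1] := lam01.
have v01 : 0 < 1 - lam < 1 by lra.
have d01' : 0 < delta <= 1 by rewrite d0 ltW.
have [k hk] : exists k, lam ^+ k < delta.
  have nl : `|lam| < 1 by rewrite gtr0_norm.
  have /cvgrPdist_lt/(_ _ d0)[N _ hN] := cvg_expr nl.
  exists N; have := hN N (leqnn _); rewrite /= sub0r normrN.
  by rewrite ger0_norm// exprn_ge0// ltW.
have Bk i : bcdf (1 - lam) i 0 = lam ^+ i by rewrite bcdf0 subKr.
exists (2 * k.+1%:R / lam).
apply: filterS2 (nbhs_infty_gt 0) (near_nat_gt (2 * k.+1%:R)) => n n0 hn.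
have nR : 0 < n%:R :> R by rewrite ltr0n.
have kn : (0 < k.+1 <= n.+1)%N.
  rewrite /= ltnW// ltnS -(ltr_nat R); apply: le_lt_trans hn.
  by have := ler0n R k.+1; lra.
have e0 : 0 <= epsbar lam 0 n delta.
  have := @epsbar_ge R lam delta n 0 lam01 n0 d01' 0 (leq0n _).
  by rewrite accept_prob0 ?(ltW d1)// => /(_ isT); rewrite /accept_bad !mul0r.
rewrite ger0_norm// tau_sqr.
have ap : accept_prob (1 - lam) n 0 k.+1 < delta.
  by have := @accept_prob_le R (1 - lam) n 0 v01 _ kn; rewrite Bk => /le_lt_trans; apply.
apply: le_trans (epsbar_le lam01 n0 d01' kn ap) _.
have nS : 0 < n.+1%:R :> R by rewrite ltr0n.
have lk : 0 < lam ^+ k by rewrite exprn_gt0.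
have kR : 0 < k.+1%:R :> R by rewrite ltr0n.
rewrite /accept_bad /accept_prob !Bk exprS /=.
have {}hn : (2 : R) * (k.+1%:R : R) < (n%:R : R) := hn.
rewrite -(natr1 n) in nS *; move: (n%:R : R) (k.+1%:R : R) (lam ^+ k) nR kR lk hn nS
  => N K P nR kR lk hn nS.
have D0 : 0 < K + (N + 1 - K) * lam by rewrite addr_gt0// mulr_gt0//; lra.
have -> : K * P / (N + 1) / ((K * P + (N + 1 - K) * (lam * P)) / (N + 1)) =
    K / (K + (N + 1 - K) * lam).
  have -> : K * P + (N + 1 - K) * (lam * P) = (K + (N + 1 - K) * lam) * P by ring.
  by field; rewrite !gt_eqF.
rewrite ler_pdivrMr//.
have -> : 2 * K / lam * N^-1 * (K + (N + 1 - K) * lam) =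
  K * (2 * (K + (N + 1 - K) * lam) / (lam * N)).
  by field; rewrite !gt_eqF.
rewrite ler_peMr ?(ltW kR)// ler_pdivlMr ?mulr_gt0// mul1r.
have : 0 <= (2 * (N + 1 - K) - N) * lam by rewrite mulr_ge0 ?(ltW l0)//; lra.
by lra.
Qed.

Lemma epsbar_lossy_asymp s lam delta : 0 <= s < 1 -> 0 < lam < 1 -> 0 < delta < 1 ->
  Otau 2 (fun n => epsbar lam (ceil_nat ((1 - lam) * s * n%:R)) n delta -
    (s + coef_sqrt lam s delta * tau n)).
Proof.
move=> /andP[s0 s1] lam01 d01; move: s0; rewrite le_eqVlt => /predU1P[<-|s0].
  apply: (Otau_ext _ (epsbar_lossy_0 lam01 d01)); apply: nearW => n.
  rewrite mulr0 mul0r /ceil_nat ceil0 /coef_sqrt mulr0 sqrtr0 !mul0r.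
  by rewrite add0r subr0.
by apply: epsbar_lossy_pos => //; rewrite s0.
Qed.

(** Where [Phi_inv delta > 0] the claim is that [phi / (delta * Phi_inv delta)],
    which decreases in [delta], has not yet fallen below its value at
    [psi_inv]. *)
Lemma coef_sqrt_ge0 s lam delta : 0 <= s < 1 -> 0 < lam < 1 -> 0 < delta < 1 ->
  delta <= psi_inv (lam / ((1 - lam) * (1 - s))) -> 0 <= coef_sqrt lam s delta.
Proof.
move=> /andP[s0 s1] /andP[l0 l1] d01; have /andP[d0 d1] := d01.
have s1' : 0 < 1 - s by rewrite subr_gt0.
have v0 : 0 < 1 - lam by rewrite subr_gt0.
set u := lam / _; have u0 : 0 < u by rewrite divr_gt0// mulr_gt0.
rewrite /psi_inv; case: xgetP => [d _ [/andP[d2 dlt1] pd]|_ h]; last first.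
  by move: d0; rewrite ltNge h.
move=> dd; rewrite /coef_sqrt -/u mulr_ge0//.
  by rewrite divr_ge0 ?mulr_ge0 ?sqrtr_ge0 ?(ltW s1').
have d'0 : 0 < d by exact: lt_le_trans dd.
have d'01 : 0 < d < 1 by rewrite d'0.
have zz : Phi_inv delta <= Phi_inv d by rewrite -ler_Phi !Phi_invK.
rewrite subr_ge0; have [z0|z0] := leP (Phi_inv delta) 0.
  apply: (@le_trans _ _ 0); first by rewrite mulr_le0_ge0// ltW.
  by rewrite divr_ge0 ?(ltW (phi_gt0 _))// ltW.
have z'0 := lt_le_trans z0 zz.
have e : u * (d * Phi_inv d) = phi (Phi_inv d).
  by rewrite -pd /psi divfK// mulf_neq0// gt_eqF.
rewrite ler_pdivlMr//.
apply: (@le_trans _ _ (phi (Phi_inv d))); last by rewrite phi_le// ltW.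
rewrite -e mulrAC mulrC ler_pM2l// mulrC ler_pM// ltW//.
Qed.

End FixedSignificance.

(** * Large deviations of the binomial law *)

Lemma binp_tilting (R : realType) (v al : R) k j : 0 < al < 1 -> (j <= k)%N ->
  binp v k j = binp al k j * ((v / al) ^+ j * ((1 - v) / (1 - al)) ^+ (k - j)).
Proof.
move=> /andP[a0 a1] jk; have a1' : 0 < 1 - al by rewrite subr_gt0.
rewrite /binp !expr_div_n; field.
by rewrite !expf_neq0 ?gt_eqF.
Qed.

(** Chernoff bound: tilted to the success probability [al <= v], each of the terms
    [j <= l] is multiplied by at most the factor at [j = l]. *)
Lemma bcdf_chernoff (R : realType) (v al : R) k l : 0 < al <= v -> v < 1 -> (l <= k)%N ->
  bcdf v k l <= (v / al) ^+ l * ((1 - v) / (1 - al)) ^+ (k - l).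
Proof.
move=> /andP[a0 av] v1 lk; have v1' : 0 < 1 - v by rewrite subr_gt0.
have a1 : al < 1 := le_lt_trans av v1.
have a1' : 0 < 1 - al by rewrite subr_gt0.
have a01 : 0 < al < 1 by rewrite a0.
have a01W : 0 <= al <= 1 by rewrite !ltW.
have g1 : 1 <= v / al by rewrite ler_pdivlMr// mul1r.
have g0 : 0 <= (1 - v) / (1 - al) by rewrite divr_ge0 ?ltW.
have g2 : (1 - v) / (1 - al) <= 1 by rewrite ler_pdivrMr// mul1r lerD2l lerN2.
rewrite -[leRHS]mul1r; apply: le_trans (ler_wpM2r _ (bcdf_le1 k l a01W)); last first.
  by rewrite mulr_ge0// exprn_ge0// (le_trans ler01).
rewrite /bcdf mulr_suml; apply: ler_sum => j _.
have jl : (j <= l)%N by rewrite -ltnS.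
rewrite (@binp_tilting _ v al) ?(leq_trans jl)// ler_wpM2l ?binp_ge0//.
rewrite ler_pM ?exprn_ge0 ?(le_trans ler01 g1)//; first exact: ler_weXn2l.
by rewrite ler_wiXn2l// leq_sub2l.
Qed.

Lemma KL_le_sqr (R : realType) (a al : R) : 0 < a < 1 -> 0 < al < 1 ->
  KL a al <= (a - al) ^+ 2 / (al * (1 - al)).
Proof.
move=> /andP[a0 a1] /andP[b0 b1].
have a1' : 0 < 1 - a by rewrite subr_gt0. have b1' : 0 < 1 - al by rewrite subr_gt0.
have aux (p q : R) : 0 < p -> 0 < q -> p * ln (p / q) <= p * (p / q - 1).
  move=> p0 q0; rewrite ler_pM2l// -{1}[p / q](subrK 1) addrC.
  by apply: le_ln1Dx; have := divr_gt0 p0 q0; lra.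
have := lerD (aux a al a0 b0) (aux _ _ a1' b1'); congr (_ <= _).
by field; rewrite !gt_eqF.
Qed.

Section LargeDeviations.
Context {R : realType}.
Variables (v s : R).
Hypotheses (v01 : 0 < v < 1) (s01 : 0 <= s < 1).
Implicit Types (kap e : R).

Let v0 : 0 < v. Proof. by case/andP: v01. Qed.
Let v1 : 0 < 1 - v. Proof. by case/andP: v01 => _; rewrite subr_gt0. Qed.
Let s0 : 0 <= s. Proof. by case/andP: s01. Qed.

(** Decay rate, per sample, of the probability of at most [v s n] successes among
    [kap n] trials. *)
Definition decay kap : R := kap * KL (v * s / kap) v.

Let vs_lt kap : s <= kap -> 0 < kap -> v * s < kap.
Proof.
move=> sk k0; apply: (@le_lt_trans _ _ (v * kap)); first by rewrite ler_pM2l.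
by rewrite gtr_pMl// -subr_gt0.
Qed.

Let tilt01 kap : s <= kap -> 0 < kap -> 0 <= v * s / kap < 1.
Proof.
move=> sk k0; rewrite divr_ge0 ?mulr_ge0 ?(ltW v0) ?(ltW k0)//=.
by rewrite ltr_pdivrMr// mul1r vs_lt.
Qed.

(** The difference of the two sides is a relative entropy, namely
    [kap' * KL (v * s / kap') (v * s / kap)]. *)
Lemma decay_subgradient kap kap' : s <= kap -> 0 < kap -> s <= kap' -> 0 < kap' ->
  (kap' - kap) * ln ((kap - v * s) / (kap * (1 - v))) <= decay kap' - decay kap.
Proof.
move=> sk k0 sk' k0'.
have d0 : 0 < kap - v * s by rewrite subr_gt0 vs_lt.
have d0' : 0 < kap' - v * s by rewrite subr_gt0 vs_lt.
have e1 (t : R) : 0 < t -> 1 - v * s / t = (t - v * s) / t.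
  by move=> t0; field; rewrite gt_eqF.
have e2 (t : R) : 0 < t -> 0 < t - v * s ->
    decay t = v * s * ln (v * s / t / v) + (t - v * s) * (ln (t - v * s) - ln t - ln (1 - v)).
  move=> t0 dt; rewrite /decay /KL e1//.
  have -> : ln ((t - v * s) / t / (1 - v)) = ln (t - v * s) - ln t - ln (1 - v).
    by rewrite ln_div ?posrE ?divr_gt0// ln_div.
  by field; rewrite gt_eqF.
rewrite !e2// ln_div ?posrE ?mulr_gt0// lnM ?posrE//.
have key : 0 <= kap' * KL (v * s / kap') (v * s / kap) \/ s = 0.
  have [->|sn] := eqVneq s 0; [by right|left].
  have sp : 0 < s by rewrite lt_neqAle eq_sym sn.
  rewrite mulr_ge0 ?(ltW k0')// KL_ge0//.
    by have /andP[-> /ltW->] := tilt01 sk' k0'.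
  have /andP[_ ->] := tilt01 sk k0; rewrite andbT divr_gt0// mulr_gt0//.
case: key => [key|->]; last first.
  by rewrite !mulr0 !subr0 !mul0r !add0r !subrr; lra.
have [sz|sn] := eqVneq s 0.
  by rewrite sz !mulr0 !subr0 !mul0r !add0r !subrr; lra.
have sp : 0 < s by rewrite lt_neqAle eq_sym sn.
have vs0 : 0 < v * s by rewrite mulr_gt0.
move: key; rewrite /KL !e1// !ln_div ?posrE ?divr_gt0//.
set A := ln (kap - v * s); set A' := ln (kap' - v * s); set B := ln kap.
set B' := ln kap'; set D := ln (v * s); set Q := ln (1 - v).
have -> : kap' * (v * s / kap' * (D - B' - (D - B)) +
    (kap' - v * s) / kap' * (A' - B' - (A - B))) =
   v * s * (B - B') + (kap' - v * s) * (A' - B' - (A - B)).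
  by field; rewrite gt_eqF.
by move: (v * s) => z; lra.
Qed.

Lemma decay_lt kap kap' : s < kap -> kap < kap' -> decay kap < decay kap'.
Proof.
move=> sk kk; have k0 : 0 < kap := le_lt_trans s0 sk.
have k0' : 0 < kap' := lt_trans k0 kk.
have sk' : s <= kap' := ltW (lt_trans sk kk).
have := decay_subgradient (ltW sk) k0 sk' k0'; rewrite -subr_gt0; apply: lt_le_trans.
rewrite mulr_gt0 ?subr_gt0// ln_gt0// ltr_pdivlMr ?mulr_gt0// mul1r mulrBr mulr1.
by rewrite ltrD2l ltrN2 mulrC ltr_pM2r.
Qed.

Let l (n : nat) : nat := ceil_nat (v * s * n%:R).

Let l_itv n : v * s * n%:R <= (l n)%:R < v * s * n%:R + 1.
Proof. by apply: ceil_nat_itv; rewrite !mulr_ge0 ?(ltW v0). Qed.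

Variables (kap : R) (k : nat -> nat) (C : R).
Hypothesis sk : s < kap.
Hypothesis kC : \forall n \near \oo, `|(k n)%:R - kap * n%:R| <= C.

Let k0 : 0 < kap. Proof. exact: le_lt_trans s0 sk. Qed.

Lemma near_ld_scale : \forall n \near \oo, [/\ (0 < n)%N, (l n < k n)%N,
   (l n)%:R / (k n)%:R < v & kap / 2 * n%:R <= (k n)%:R].
Proof.
have g0 : 0 < v * (kap - s) by rewrite mulr_gt0// subr_gt0.
apply: filterS3 kC (near_nat_gt ((v * C + 1) / (v * (kap - s))))
  (filterI (nbhs_infty_gt 0) (near_nat_gt (C / (kap / 2)))) => n hk hn [n0 hn2].
have nR : 0 < n%:R :> R by rewrite ltr0n.
move: hk; rewrite ler_norml => /andP[h1 h2].
have /andP[l1 l2] := l_itv n.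
rewrite ltr_pdivrMr// in hn; rewrite ltr_pdivrMr ?divr_gt0// in hn2.
have hkk : kap / 2 * n%:R <= (k n)%:R by move: hn2 h1; lra.
have kR : 0 < (k n)%:R :> R by apply: lt_le_trans hkk; rewrite mulr_gt0// divr_gt0.
have lk : (l n)%:R < v * (k n)%:R.
  have : v * (kap * n%:R - C) <= v * (k n)%:R by rewrite ler_pM2l//; move: h1; lra.
  by move: hn l2; lra.
split => //; last by rewrite ltr_pdivrMr.
rewrite -(ltr_nat R); apply: lt_le_trans lk _.
by rewrite ler_piMl ?(ltW kR)// -subr_ge0 ltW.
Qed.

Let l_zero n : s = 0 -> l n = 0%N.
Proof. by move=> sz; rewrite /l sz mulr0 mul0r /ceil_nat ceil0. Qed.

Let decay_zero : s = 0 -> decay kap = - (kap * ln (1 - v)).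
Proof.
move=> sz; rewrite /decay /KL sz mulr0 !mul0r add0r subr0 mul1r div1r lnV ?posrE//.
by rewrite mulrN.
Qed.

Let ln1v : ln (1 - v) < 0.
Proof. by apply: ln_lt0; rewrite v1/= gtrBl. Qed.

(** For [s = 0] the distribution function is the power [(1 - v) ^ k]. *)
Let ld_zero e : 0 < e -> s = 0 -> \forall n \near \oo,
  expR (- (n%:R * (decay kap + e))) <= bcdf v (k n) (l n) <=
    expR (- (n%:R * (decay kap - e))).
Proof.
move=> e0 sz; apply: filterS2 kC (near_nat_gt (C * - ln (1 - v) / e)) => n hk hn.
rewrite l_zero// bcdf0 -[1 - v in X in _ <= X <= _]lnK ?posrE// -expRM_natl !ler_expR.
rewrite decay_zero//; move: hn; rewrite ltr_pdivrMr//.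
move: hk; rewrite ler_norml => /andP[h1 h2] hn.
have p1 : 0 <= (C - ((k n)%:R - kap * n%:R)) * - ln (1 - v).
  by rewrite mulr_ge0 ?subr_ge0// oppr_ge0 ltW.
have p2 : 0 <= (C + ((k n)%:R - kap * n%:R)) * - ln (1 - v).
  rewrite mulr_ge0//; last by rewrite oppr_ge0 ltW.
  by rewrite addrC -lerBlDr sub0r.
by apply/andP; split; lra.
Qed.

Let al : R := v * s / kap.
Let X : R := ln (al / v).
Let Y : R := ln ((1 - al) / (1 - v)).

(** The logarithm of the tilting factor at [l n] successes in [k n] trials, up to
    sign. It differs from [n * decay kap] by a bounded amount, because [al] is
    fixed and the counts are linear in [n] up to bounded errors. *)
Let exponent n : R := (l n)%:R * X + ((k n)%:R - (l n)%:R) * Y.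

Let exponent_near : exists D : R, 0 <= D /\ \forall n \near \oo,
  `|exponent n - n%:R * decay kap| <= D.
Proof.
exists (`|X| + (`|C| + 1) * `|Y|); split.
  by rewrite addr_ge0// mulr_ge0// addr_ge0.
apply: filterS kC => n hk; have /andP[l1 l2] := l_itv n.
have -> : exponent n - n%:R * decay kap = ((l n)%:R - v * s * n%:R) * X +
    (((k n)%:R - kap * n%:R) - ((l n)%:R - v * s * n%:R)) * Y.
  rewrite /exponent /decay /KL -/al -/X -/Y.
  have -> : n%:R * (kap * (al * X + (1 - al) * Y)) =
     n%:R * (kap * al * X + (kap - kap * al) * Y) by ring.
  have -> : kap * al = v * s by rewrite /al mulrC divfK// gt_eqF.
  by ring.
have hl : `|(l n)%:R - v * s * n%:R| <= 1.
  by rewrite ger0_norm ?subr_ge0//; move: l2; lra.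
apply: le_trans (ler_normD _ _) _; rewrite !normrM lerD//.
  by rewrite ler_piMl.
rewrite ler_wpM2r//; apply: le_trans (ler_normB _ _) _; rewrite lerD//.
exact: le_trans hk (ler_norm _).
Qed.

Let al01 : 0 < s -> 0 < al < v.
Proof.
move=> sp; rewrite /al divr_gt0 ?mulr_gt0//= ltr_pdivrMr// ltr_pM2l//.
Qed.

Let ld_upper_pos e : 0 < e -> 0 < s -> \forall n \near \oo,
  bcdf v (k n) (l n) <= expR (- (n%:R * (decay kap - e))).
Proof.
move=> e0 sp; have [D [D0 hD]] := exponent_near; have /andP[a0 av] := al01 sp.
have a1' : 0 < 1 - al by rewrite subr_gt0 (lt_trans av)// -subr_gt0.
apply: filterS3 near_ld_scale hD (near_nat_gt (D / e)) => n [n0 lk _ _] h hn.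
apply: (le_trans (@bcdf_chernoff R v al _ _ _ _ (ltnW lk))).
- by rewrite a0 ltW.
- by rewrite -subr_gt0.
have -> : v / al = expR (- X).
  by rewrite expRN /X lnK ?posrE ?(divr_gt0 a0 v0)// (invf_div al v).
have -> : (1 - v) / (1 - al) = expR (- Y).
  by rewrite expRN /Y lnK ?posrE ?(divr_gt0 a1' v1)// (invf_div (1 - al) (1 - v)).
rewrite -!expRM_natl -expRD ler_expR natrB ?(ltnW lk)//.
move: h; rewrite ler_norml => /andP[h _]; rewrite ltr_pdivrMr// in hn.
by move: h hn; rewrite /exponent; lra.
Qed.

Lemma ld_upper e : 0 < e -> \forall n \near \oo,
  bcdf v (k n) (l n) <= expR (- (n%:R * (decay kap - e))).
Proof.
move=> e0; have [sz|sn] := eqVneq s 0.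
  by apply: filterS (ld_zero e0 sz) => n /andP[].
by apply: ld_upper_pos => //; rewrite lt_neqAle eq_sym sn.
Qed.

(** The normal lower bound, whose exponent [k * KL (l / k) v] exceeds that at the
    tilting [al] by [k * KL (l / k) al]; this is bounded, as [l / k] and [al]
    differ by [O (1 / n)]. *)
Let ld_lower_pos e : 0 < e -> 0 < s -> \forall n \near \oo,
  expR (- (n%:R * (decay kap + e))) <= bcdf v (k n) (l n).
Proof.
move=> e0 sp; have [D [D0 hD]] := exponent_near; have /andP[a0 av] := al01 sp.
have v1' : v < 1 by rewrite -subr_gt0.
have a1 : al < 1 by exact: lt_trans av v1'.
have a1' : 0 < 1 - al by rewrite subr_gt0.
have dp : 0 < decay kap.
  rewrite /decay mulr_gt0// KL_gt0 -?/al ?a0//.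
  by rewrite gt_eqF.
pose eta := e / (2 * decay kap).
have eta0 : 0 < eta by rewrite divr_gt0// mulr_gt0.
pose D2 : R := (kap + v * s * `|C|) ^+ 2 / kap ^+ 2 / (al * (1 - al)).
have aal : 0 <= (al * (1 - al))^-1 by rewrite invr_ge0 mulr_ge0 ?(ltW a0) ?(ltW a1').
have kap2 : 0 <= (kap ^+ 2)^-1 by rewrite invr_ge0 sqr_ge0.
have D20 : 0 <= D2 by exact: mulr_ge0 (mulr_ge0 (sqr_ge0 _) kap2) aal.
pose Z : R := (1 + eta) * (D + D2) + (2 * eta)^-1 + 2^-1 - ln phi0.
apply: filterS3 (filterI near_ld_scale kC) hD (near_nat_gt (Z / (e / 2))).
move=> n [[n0 lk av' _] hk] h hn.
have nR : 0 < n%:R :> R by rewrite ltr0n.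
have kR : 0 < (k n)%:R :> R by rewrite ltr0n (leq_ltn_trans _ lk).
have l0 : (0 < l n)%N.
  rewrite -(ltr_nat R); have /andP[l1 _] := l_itv n.
  by apply: lt_le_trans l1; rewrite !mulr_gt0.
have lR : 0 < (l n)%:R :> R by rewrite ltr0n.
set a := (l n)%:R / (k n)%:R in av'.
have aa0 : 0 < a by rewrite divr_gt0.
have aa1 : a < 1 := lt_trans av' v1'.
have aa1' : 0 < 1 - a by rewrite subr_gt0.
have ka : (k n)%:R * a = (l n)%:R by rewrite /a mulrC divfK// gt_eqF.
have KLE : (k n)%:R * KL a v = exponent n + (k n)%:R * KL a al.
  have lnd (p q : R) : 0 < p -> 0 < q -> ln (p / q) = ln p - ln q.
    by move=> p0 q0; rewrite ln_div.
  rewrite /exponent /KL /X /Y (lnd a v)// (lnd (1 - a) (1 - v))// (lnd al v)//.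
  rewrite (lnd (1 - al) (1 - v))// (lnd a al)// (lnd (1 - a) (1 - al))// -ka.
  by move: (ln a) (ln (1 - a)) => *; ring.
have KL2 : (k n)%:R * KL a al <= D2.
  have a01 : 0 < a < 1 by rewrite aa0.
  have al01' : 0 < al < 1 by rewrite a0.
  apply: (le_trans (ler_wpM2l (ltW kR) (KL_le_sqr a01 al01'))).
  have dE : a - al = (((l n)%:R - v * s * n%:R) * kap - v * s * ((k n)%:R - kap * n%:R)) /
      (kap * (k n)%:R).
    by rewrite /a /al; field; rewrite !gt_eqF.
  set W := (_ * kap - _) in dE.
  have hW : `|W| <= kap + v * s * `|C|.
    have vs0 : 0 <= v * s by rewrite mulr_ge0 ?ltW.
    have /andP[l1 l2] := l_itv n.
    apply: le_trans (ler_normB _ _) _; rewrite !normrM lerD//.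
      by rewrite (ger0_norm (ltW k0)) ler_piMl ?(ltW k0)// ger0_norm ?subr_ge0//; lra.
    rewrite (ger0_norm (ltW v0)) (ger0_norm (ltW sp)) ler_wpM2l//.
    exact: le_trans hk (ler_norm _).
  have hW2 : W ^+ 2 <= (kap + v * s * `|C|) ^+ 2.
    rewrite -(real_normK (num_real W)) lerXn2r ?nnegrE//.
    exact: le_trans hW.
  have -> : (k n)%:R * ((a - al) ^+ 2 / (al * (1 - al))) =
     W ^+ 2 / kap ^+ 2 / (al * (1 - al)) / (k n)%:R.
    by rewrite dE; field; rewrite !gt_eqF.
  apply: (@le_trans _ _ (W ^+ 2 / kap ^+ 2 / (al * (1 - al)))).
    rewrite ler_piMr ?invf_le1 ?ler1n//; last by rewrite (leq_ltn_trans _ lk).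
    exact: mulr_ge0 (mulr_ge0 (sqr_ge0 W) kap2) aal.
  by apply: (ler_wpM2r aal); exact: (ler_wpM2r kap2).
have lkk : (0 < l n < k n)%N by rewrite l0.
apply: le_trans (bcdf_ge_Phi lkk v01).
rewrite /zdev -/a ltr0_sg ?subr_lt0// mulN1r.
set w := Num.sqrt _; have w0 : 0 <= w by rewrite sqrtr_ge0.
apply: le_trans (Phi_opp_ge w0).
rewrite -[phi0]lnK ?posrE ?phi0_gt0// -expRD ler_expR.
have w2 : w ^+ 2 / 2 <= n%:R * decay kap + (D + D2).
  have -> : w ^+ 2 / 2 = (k n)%:R * KL a v.
    rewrite /w sqr_sqrtr; first by field.
    by rewrite mulr_ge0 ?KL_ge0 ?mulr_ge0// ?(ltW aa0) ?(ltW aa1).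
  rewrite KLE addrA lerD//; move: h; rewrite ler_norml => /andP[_ h].
  by move: h; lra.
(* Absorbs the linear term [w] of the tail bound into a small multiple of the
   exponent [w ^ 2 / 2]. *)
have wle : w <= eta * (w ^+ 2 / 2) + (2 * eta)^-1.
  rewrite -subr_ge0.
  have -> : eta * (w ^+ 2 / 2) + (2 * eta)^-1 - w = (eta * w - 1) ^+ 2 / (2 * eta).
    by field; rewrite gt_eqF.
  by rewrite divr_ge0 ?sqr_ge0// mulr_ge0 ?ltW.
have w3 : (1 + eta) * (w ^+ 2 / 2) <= (1 + eta) * (n%:R * decay kap + (D + D2)).
  by rewrite ler_wpM2l// addr_ge0// ltW.
have eE : eta * (n%:R * decay kap) = n%:R * (e / 2).
  by rewrite /eta; field; rewrite gt_eqF.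
rewrite ltr_pdivrMr ?divr_gt0// /Z in hn.
have -> : - (n%:R * (decay kap + e)) =
  - ((n%:R * decay kap + eta * (n%:R * decay kap)) + n%:R * (e / 2)).
  by rewrite eE; field.
have -> : - ((w + 1) ^+ 2 / 2) = - (w ^+ 2 / 2 + w + 2^-1) by field.
move: w3 hn wle; rewrite mulrDl mul1r [(1 + eta) * (_ + (D + D2))]mulrDr.
rewrite [(1 + eta) * (n%:R * _)]mulrDl mul1r.
move: (eta * (w ^+ 2 / 2)) (w ^+ 2 / 2) (eta * (n%:R * decay kap)) (n%:R * decay kap)
  ((1 + eta) * (D + D2)) (n%:R * (e / 2)) ((2 * eta)^-1) (ln phi0) => q1 q2 q3 q4 q5 q6 q7 q8.
move=> g1 g2 g3; lra.
Qed.

Lemma ld_lower e : 0 < e -> \forall n \near \oo,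
  expR (- (n%:R * (decay kap + e))) <= bcdf v (k n) (l n).
Proof.
move=> e0; have [sz|sn] := eqVneq s 0.
  by apply: filterS (ld_zero e0 sz) => n /andP[].
by apply: ld_lower_pos => //; rewrite lt_neqAle eq_sym sn.
Qed.

End LargeDeviations.

(** * Conditional probability at a fixed proportion of ones *)

Section RatioLimit.
Context {R : realType}.
Variables (v s kap C : R) (k : nat -> nat).
Hypotheses (v01 : 0 < v < 1) (s01 : 0 <= s < 1) (sk : s < kap) (kap1 : kap <= 1).
Hypothesis kC : \forall n \near \oo, `|(k n)%:R - kap * n%:R| <= C.

Let v0 : 0 < v. Proof. by case/andP: v01. Qed.
Let v1 : 0 < 1 - v. Proof. by case/andP: v01 => _; rewrite subr_gt0. Qed.
Let s0 : 0 <= s. Proof. by case/andP: s01. Qed.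
Let k0 : 0 < kap. Proof. exact: le_lt_trans s0 sk. Qed.
Let v01W : 0 <= v <= 1. Proof. by rewrite (ltW v0) -subr_ge0 ltW. Qed.

Let l (n : nat) : nat := ceil_nat (v * s * n%:R).
Let scale := near_ld_scale v01 s01 sk kC.

Let d0 : 0 < kap - v * s.
Proof.
rewrite subr_gt0; apply: le_lt_trans sk.
by rewrite ler_piMl// -subr_ge0 ltW.
Qed.

(** Limit of [bcdf v (m + 1) l / bcdf v m l] at [m = kap n] and [l = v s n]. *)
Definition tail_ratio : R := (1 - v) * kap / (kap - v * s).

Let q := tail_ratio.
Let q0 : 0 < q. Proof. by rewrite /q /tail_ratio divr_gt0// mulr_gt0. Qed.
Let q1 : q < 1.
Proof.
rewrite /q /tail_ratio ltr_pdivrMr// mul1r mulrBl mul1r ltrD2l ltrN2 ltr_pM2l//.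
Qed.

Let cvg_inv_nat : n%:R^-1 @[n --> \oo] --> (0 : R).
Proof.
apply/cvgrPdist_le => e e0; apply: filterS2 (nbhs_infty_gt 0) (near_nat_gt e^-1).
move=> n n0 hn; rewrite sub0r normrN ger0_norm ?invr_ge0//.
by rewrite -[leRHS]invrK lef_pV2 ?posrE ?invr_gt0 ?ltr0n// ltW.
Qed.

Let cvg_k j : (k n + j)%:R / n%:R @[n --> \oo] --> kap.
Proof.
apply/cvgrPdist_le => e e0.
apply: filterS3 kC (nbhs_infty_gt 0) (near_nat_gt ((`|C| + j%:R) / e)) => n hk n0 hn.
have nR : 0 < n%:R :> R by rewrite ltr0n.
have -> : kap - (k n + j)%:R / n%:R = - (((k n)%:R - kap * n%:R) + j%:R) / n%:R.
  by rewrite natrD; field; rewrite gt_eqF.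
rewrite normrM normrN normfV (gtr0_norm nR) ler_pdivrMr//.
rewrite ltr_pdivrMr// in hn; rewrite [leRHS]mulrC; apply: le_trans (ltW hn).
apply: le_trans (ler_normD _ _) _; rewrite lerD ?normr_nat//.
exact: le_trans hk (ler_norm _).
Qed.

Let cvg_l : (l n)%:R / n%:R @[n --> \oo] --> v * s.
Proof.
have vs0 : 0 <= v * s by rewrite mulr_ge0 ?(ltW v0).
apply/cvgrPdist_le => e e0.
apply: filterS2 (nbhs_infty_gt 0) (near_nat_gt e^-1) => n n0 hn.
have nR : 0 < n%:R :> R by rewrite ltr0n.
have /andP[h1 h2] := ceil_nat_itv (mulr_ge0 vs0 (ler0n R n)).
have -> : v * s - (l n)%:R / n%:R = - ((l n)%:R - v * s * n%:R) / n%:R.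
  by field; rewrite gt_eqF.
rewrite normrM normrN normfV (gtr0_norm nR) ler_pdivrMr// ger0_norm ?subr_ge0//.
have : 1 < n%:R * e by rewrite -ltr_pdivrMr// div1r.
by move: h2; rewrite -/(l n); lra.
Qed.

(** Growth factor of [binp v m (l n)] from [m = k n + j - 1] to [m = k n + j]. *)
Let r j n : R := (1 - v) * (k n + j)%:R / ((k n + j)%:R - (l n)%:R).

Let cvg_r j : r j n @[n --> \oo] --> q.
Proof.
have h : (1 - v) * ((k n + j)%:R / n%:R) /
    ((k n + j)%:R / n%:R - (l n)%:R / n%:R) @[n --> \oo] --> q.
  apply: cvgM; first by apply: cvgM; [exact: cvg_cst|exact: cvg_k].
  by apply: cvgV; [rewrite gt_eqF|apply: cvgB; [exact: cvg_k|exact: cvg_l]].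
apply: cvg_trans h; apply: near_eq_cvg; apply: filterS scale => n [n0 lk _ _].
have nR : 0 < n%:R :> R by rewrite ltr0n.
have dR : 0 < (k n + j)%:R - (l n)%:R :> R.
  by rewrite subr_gt0 ltr_nat (leq_trans lk)// leq_addr.
rewrite /r; move: ((k n + j)%:R : R) ((l n)%:R : R) dR => a b dR.
have -> : a / n%:R - b / n%:R = (a - b) / n%:R by ring.
by field; rewrite !gt_eqF.
Qed.

Let rho n : R := bcdf v (k n) (l n) / bcdf v (k n).-1 (l n).

Let rho_le n : (l n < k n)%N -> rho n <= r 0 n.
Proof.
move=> lk; rewrite /rho /r addn0 ler_pdivrMr; last by rewrite bcdf_gt0// (ltW v0) -subr_gt0.
have dR : 0 < (k n)%:R - (l n)%:R :> R by rewrite subr_gt0 ltr_nat.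
rewrite mulrAC ler_pdivlMr//.
have km : (k n).-1.+1 = k n by rewrite prednK// (leq_ltn_trans _ lk).
have lm : (l n <= (k n).-1)%N by rewrite -ltnS km.
by have := bcdf_trialS_le v01W lm; rewrite km natrB ?(ltnW lk)//.
Qed.

Let binp_growth J n i : (l n < k n)%N -> (i <= J)%N ->
  r J n ^+ i * binp v (k n).-1 (l n) <= binp v ((k n).-1 + i) (l n).
Proof.
move=> lk; elim: i => [|i IH] iJ; first by rewrite expr0 mul1r addn0.
have km : (k n).-1.+1 = k n by rewrite prednK// (leq_ltn_trans _ lk).
have rJ0 : 0 <= r J n.
  rewrite /r divr_ge0 ?mulr_ge0 ?(ltW v1)// subr_ge0 ler_nat.
  by rewrite (leq_trans (ltnW lk))// leq_addr.
rewrite exprS -mulrA; apply: le_trans (ler_wpM2l rJ0 (IH (ltnW iJ))) _.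
have lm : (l n <= (k n).-1 + i)%N by rewrite (leq_trans _ (leq_addr _ _))// -ltnS km.
have e1 : ((k n).-1 + i).+1 = (k n + i)%N by rewrite -addSn km.
rewrite addnS; have h := @binp_trialS R v _ _ lm; rewrite e1 in h.
have dR j : 0 < (k n + j)%:R - (l n)%:R :> R.
  by rewrite subr_gt0 ltr_nat (leq_trans lk)// leq_addr.
have lki : (l n <= k n + i)%N by rewrite (leq_trans (ltnW lk))// leq_addr.
rewrite natrB// in h.
rewrite e1 -(ler_pM2r (dR i)) h mulrAC ler_wpM2r ?binp_ge0//.
rewrite /r mulrAC ler_pdivrMr// -!mulrA ler_pM2l//.
rewrite !natrD; have ij : i%:R <= J%:R :> R by rewrite ler_nat ltnW.
have : 0 <= (J%:R - i%:R) * (l n)%:R :> R by rewrite mulr_ge0 ?subr_ge0.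
by lra.
Qed.

(** [1 - rho n] is [v * binp / bcdf], and [bcdf] is at least the sum of its next [J]
    decrements [v * binp], which dominate a geometric progression of ratio
    [r J n]. *)
Let rho_ge J n : (l n < k n)%N -> (0 < J)%N ->
  1 - (\sum_(i < J) r J n ^+ i)^-1 <= rho n.
Proof.
move=> lk J0; have km : (k n).-1.+1 = k n by rewrite prednK// (leq_ltn_trans _ lk).
have B0 m : 0 < bcdf v m (l n) by rewrite bcdf_gt0// (ltW v0) -subr_gt0.
have lm : (l n <= (k n).-1)%N by rewrite -ltnS km.
have b0 : 0 < binp v (k n).-1 (l n) by exact: binp_gt0.
have rJ0 : 0 <= r J n.
  rewrite /r divr_ge0 ?mulr_ge0 ?(ltW v1)// subr_ge0 ler_nat.
  by rewrite (leq_trans (ltnW lk))// leq_addr.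
set S := \sum_(i < J) _; have S0 : 0 < S.
  rewrite /S; case: J J0 rJ0 @S => // J _ rJ0 /=; rewrite big_ord_recl expr0.
  by rewrite ltr_pwDl// sumr_ge0// => i _; rewrite exprn_ge0.
have h : v * binp v (k n).-1 (l n) * S <= bcdf v (k n).-1 (l n).
  have := @bcdf_sub R v (k n).-1 J (l n).
  move/eqP; rewrite subr_eq => /eqP ->.
  apply: (@le_trans _ _ (\sum_(j < J) v * binp v ((k n).-1 + j) (l n))); last first.
    by rewrite lerDl ltW.
  rewrite /S mulr_sumr; apply: ler_sum => i _.
  by rewrite -mulrA ler_pM2l// mulrC binp_growth// ltnW.
have e := bcdf_trialS v (k n).-1 (l n); rewrite km in e.
rewrite /rho e ler_pdivlMr// mulrBl mul1r lerD2l lerN2.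
by rewrite [leRHS]mulrC ler_pdivlMr.
Qed.

(** The lower bound tends to [1 - (1 - q) / (1 - q ^ J)], which is close to [q] for
    large [J]. *)
Let cvg_rho : rho n @[n --> \oo] --> q.
Proof.
apply/cvgrPdist_le => e e0.
have hu : \forall n \near \oo, rho n <= q + e.
  have /cvgrPdist_le/(_ e e0) := cvg_r 0.
  apply: filterS2 scale => n [n0 lk _ _] hr; apply: le_trans (rho_le lk) _.
  by move: hr; rewrite ler_norml; lra.
have hl : \forall n \near \oo, q - e <= rho n.
  have e20 : 0 < e / 2 by rewrite divr_gt0.
  have d1 : 0 < 1 - q by rewrite subr_gt0.
  have g1 : 0 < 1 - q + e / 2 by rewrite (addr_gt0 d1).
  have g0 : 0 < e / 2 / (1 - q + e / 2) by rewrite divr_gt0.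
  have nq : `|q| < 1 by rewrite gtr0_norm.
  have /cvgrPdist_lt/(_ _ g0)[N _ hN] := cvg_expr nq.
  have := hN N.+1 (leqnSn _); rewrite /= sub0r normrN ger0_norm ?exprn_ge0 ?(ltW q0)//.
  set P := q ^+ N.+1; rewrite (ltr_pdivlMr _ _ g1) => hP.
  have P1 : P < 1 by rewrite /P exprn_ilt1// ltW.
  have P0 : 0 < 1 - P by rewrite subr_gt0.
  have cs m : \sum_(i < m) r N.+1 n ^+ i @[n --> \oo] --> \sum_(i < m) q ^+ i.
    elim: m => [|m IH].
      under eq_cvg do rewrite big_ord0; rewrite big_ord0; exact: cvg_cst.
    under eq_cvg do rewrite big_ord_recr /=; rewrite big_ord_recr /=.
    apply: (cvgD IH); exact: (cvg_comp _ _ (cvg_r N.+1) (@exprn_continuous _ m q)).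
  have qs : \sum_(i < N.+1) q ^+ i = (1 - P) / (1 - q).
    apply: (mulIf (lt0r_neq0 d1)); rewrite divfK ?gt_eqF//.
    by have := subrX1 q N.+1; rewrite -/P; move: (\sum_(i < N.+1) _) => z; lra.
  have qs0 : \sum_(i < N.+1) q ^+ i != 0 by rewrite qs gt_eqF// divr_gt0.
  have cl : 1 - (\sum_(i < N.+1) r N.+1 n ^+ i)^-1 @[n --> \oo] --> 1 - (1 - q) / (1 - P).
    apply: cvgB; first exact: cvg_cst.
    by rewrite -(invf_div (1 - P)) -qs; exact: cvgV qs0 (cs _).
  have /cvgrPdist_le/(_ _ e20) := cl.
  apply: filterS2 scale => n [n0 lk _ _] hr; apply: le_trans (rho_ge lk (ltn0Sn N)).
  have h2 : (1 - q) / (1 - P) <= 1 - q + e / 2.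
    by rewrite ler_pdivrMr//; move: hP; lra.
  by move: hr h2; rewrite ler_norml; move: (_ / (1 - P)) => z; lra.
apply: filterS2 hu hl => n h1 h2; rewrite ler_norml; apply/andP; split; lra.
Qed.

(** The quotient is [k / (k + (n + 1 - k) * rho)] with [rho] the ratio of
    successive values of [bcdf]. *)
Lemma conditional_ld_limit :
  accept_bad v n (l n) (k n) / accept_prob v n (l n) (k n) @[n --> \oo] -->
  (kap - v * s) / ((1 - v) - v * s + v * kap).
Proof.
have ck : (k n)%:R / n%:R @[n --> \oo] --> kap.
  by have := cvg_k 0; under eq_cvg do rewrite addn0.
have D0 : 0 < kap + (1 + 0 - kap) * q.
  by rewrite ltr_pwDl// mulr_ge0 ?(ltW q0)// addr0 subr_ge0.
have h : (k n)%:R / n%:R / ((k n)%:R / n%:R + (1 + n%:R^-1 - (k n)%:R / n%:R) * rho n)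
    @[n --> \oo] --> kap / (kap + (1 + 0 - kap) * q).
  apply: cvgM => //; apply: cvgV; first by rewrite gt_eqF.
  apply: cvgD => //; apply: cvgM => //; apply: cvgB => //.
  by apply: cvgD; [exact: cvg_cst|exact: cvg_inv_nat].
have -> : (kap - v * s) / ((1 - v) - v * s + v * kap) = kap / (kap + (1 + 0 - kap) * q).
  move: D0; rewrite /q /tail_ratio addr0 => D0.
  have E : kap + (1 - kap) * ((1 - v) * kap / (kap - v * s)) =
     kap * ((1 - v) - v * s + v * kap) / (kap - v * s) by field; rewrite gt_eqF.
  have E0 : 0 < 1 - v - v * s + v * kap.
    move: D0; rewrite E pmulr_lgt0 ?invr_gt0// pmulr_rgt0//.
  by rewrite E; field; rewrite !gt_eqF.
apply: cvg_trans h; apply: near_eq_cvg; apply: filterS scale => n [n0 lk _ _].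
have nR : 0 < n%:R :> R by rewrite ltr0n.
have B0 : 0 < bcdf v (k n).-1 (l n) by rewrite bcdf_gt0// (ltW v0) -subr_gt0.
rewrite /accept_bad /accept_prob /rho -(natr1 n).
set B := bcdf v _.-1 _ in B0 *; set B' := bcdf v (k n) _.
have n1 : n%:R + 1 != 0 :> R by rewrite natr1 pnatr_eq0.
move: (n%:R : R) ((k n)%:R : R) nR n1 => N K nR n1.
have -> : K / N + (1 + N^-1 - K / N) * (B' / B) = (K * B + (N + 1 - K) * B') / (N * B).
  by field; rewrite !gt_eqF.
have [->|nz] := eqVneq (K * B + (N + 1 - K) * B') 0.
  by rewrite !mul0r !invr0 !mulr0.
by field; rewrite nz n1 !gt_eqF.
Qed.

End RatioLimit.

(** * Exponentially small significance *)

Section ExponentialSignificance.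
Context {R : realType}.
Implicit Types (v s kap r e lam : R) (n : nat).

(** [epsbar0_one] applies as soon as [delta <= 1 / (n + 1)]. *)
Lemma epsbar0_ld s r : 0 <= s < 1 -> 0 < r ->
  \forall n \near \oo, epsbar 0 (ceil_nat (s * n%:R)) n (expR (- (r * n%:R))) = 1.
Proof.
move=> s01 r0; apply: filterS2 (ceil_nat_lt_near s01) (near_nat_gt (2 / r ^+ 2)) => n ln hn.
apply: epsbar0_one; first exact: ltnW.
rewrite expR_gt0 expRN ler_pdivlMr ?ltr0n// mulrC ler_pdivrMr ?expR_gt0//.
apply: (@le_trans _ _ (expR (r * n%:R))); last first.
  by rewrite ler_peMl ?expR_ge0// ler1n.
apply: le_trans (expR_ge1Dxn 1 (mulr_ge0 (ltW r0) (ler0n R n))).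
rewrite ltr_pdivrMr ?exprn_gt0// in hn.
rewrite -natr1 addrC lerD2l ler_pdivlMr// exprMn [X in _ <= _ * X]expr2 mulrA [leLHS]mulrC.
by rewrite ler_wpM2r// mulrC ltW.
Qed.

Lemma near_ceil_nat_scale kap : 0 <= kap ->
  \forall n \near \oo, `|(ceil_nat (kap * n%:R))%:R - kap * n%:R| <= 1.
Proof.
move=> k0; apply: nearW => n.
have /andP[h1 h2] := ceil_nat_itv (mulr_ge0 k0 (ler0n R n)).
by rewrite ger0_norm ?subr_ge0//; move: h2; lra.
Qed.

Lemma signif_itv r n : 0 < r -> 0 < expR (- (r * n%:R)) <= 1.
Proof. by move=> r0; rewrite expR_gt0 expR_le1 oppr_le0 mulr_ge0// ltW. Qed.

Lemma decay1 v s : decay v s 1 = KL (v * s) v.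
Proof. by rewrite /decay mul1r divr1. Qed.

Lemma decay_s v s : 0 < v < 1 -> 0 <= s -> decay v s s = 0.
Proof.
move=> v01; rewrite /decay le_eqVlt => /predU1P[<-|s0]; first by rewrite mul0r.
by rewrite mulfK ?gt_eqF// KL_refl// mulr0.
Qed.

Lemma vs_lt1 v s : 0 < v < 1 -> 0 <= s < 1 -> 0 <= v * s < 1.
Proof.
move=> /andP[v0 v1] /andP[s0 s1]; rewrite mulr_ge0 ?(ltW v0)//=.
by apply: le_lt_trans v1; rewrite ler_piMr ?ltW.
Qed.

(** The law with [n + 1] ones is accepted with a probability of exponential order
    [decay 1], which is more than [delta]. *)
Lemma epsbar_lossy_one lam s r : 0 <= s < 1 -> 0 < lam < 1 -> KL (s * (1 - lam)) (1 - lam) < r ->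
  \forall n \near \oo,
    epsbar lam (ceil_nat ((1 - lam) * s * n%:R)) n (expR (- (r * n%:R))) = 1.
Proof.
move=> s01 lam01 hr; have v01 : 0 < 1 - lam < 1 by lra.
set v := 1 - lam in hr v01 *.
have s1 : s < 1 by case/andP: s01.
have hr1 : decay v s 1 < r by rewrite decay1 mulrC.
have r0 : 0 < r.
  apply: le_lt_trans hr; apply: KL_ge0 => //.
  by rewrite mulrC; have /andP[-> /ltW->] := vs_lt1 v01 s01.
have kC : \forall n \near \oo, `|n%:R - 1 * n%:R| <= 0 :> R.
  by apply: nearW => n; rewrite mul1r subrr normr0.
have e0 : 0 < r - decay v s 1 by rewrite subr_gt0.
apply: filterS (ld_lower v01 s01 s1 kC e0) => n h.
apply: epsbar_one => //; first exact: signif_itv.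
by apply: le_trans h; rewrite addrC subrK mulrC.
Qed.

Lemma decay_continuous v s kap : 0 < v < 1 -> 0 < s -> s <= kap ->
  {for kap, continuous (decay v s)}.
Proof.
move=> v01 s0 sk; have /andP[v0 v1] := v01.
have k0 : 0 < kap := lt_le_trans s0 sk.
have vs0 : 0 < v * s by rewrite mulr_gt0.
have v1' : 0 < 1 - v by rewrite subr_gt0.
have a0 : 0 < v * s / kap by rewrite divr_gt0.
have a1 : 0 < 1 - v * s / kap.
  rewrite subr_gt0 ltr_pdivrMr// mul1r; apply: lt_le_trans sk.
  by rewrite gtr_pMl.
have d1 := derive_ptZ (k := v * s) (derive_ptV (derive_pt_id kap) (lt0r_neq0 k0) erefl) erefl.
have d2 := derive_ptB (derive_pt_cst 1 kap) d1 erefl.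
have d3 := derive_ptM d1 (derive_pt_cst v^-1 kap) erefl.
have d4 := derive_ptM d2 (derive_pt_cst (1 - v)^-1 kap) erefl.
have l3 := derive_pt_comp (g := fun y => v * s / y / v)
  (is_derive1_ln (divr_gt0 a0 v0)) d3 erefl.
have l4 := derive_pt_comp (g := fun y => (1 - v * s / y) / (1 - v))
  (is_derive1_ln (divr_gt0 a1 v1')) d4 erefl.
exact: is_derive1_continuous (derive_ptM (derive_pt_id kap)
  (derive_ptD (derive_ptM d1 l3 erefl) (derive_ptM d2 l4 erefl) erefl) erefl).
Qed.

(** The rate vanishes at [s]; for [s = 0] it is linear in [kap]. *)
Lemma decay_attained v s r : 0 < v < 1 -> 0 <= s < 1 -> 0 < r <= decay v s 1 ->
  exists2 kap, s <= kap & decay v s kap = r.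
Proof.
move=> v01 /andP[s0 s1] /andP[r0 r1]; have /andP[v0 v1] := v01.
have [sz|sn] := eqVneq s 0.
  have L0 : 0 < - ln (1 - v) by rewrite oppr_gt0 ln_lt0// subr_gt0 v1 gtrBl.
  exists (r / - ln (1 - v)); first by rewrite sz divr_ge0 ?ltW.
  rewrite /decay /KL sz mulr0 !mul0r add0r subr0 mul1r div1r lnV ?posrE ?subr_gt0//.
  by rewrite divfK// gt_eqF.
have sp : 0 < s by rewrite lt_neqAle eq_sym sn.
have [||c] := @IVT R (decay v s) s 1 r (ltW s1).
- apply: continuous_in_subspaceT => x; rewrite inE/= in_itv/= => /andP[sx _].
  exact: decay_continuous.
- by rewrite decay_s// (min_idPl _) ?(le_trans (ltW r0))// (max_idPr _) ?(le_trans (ltW r0)).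
- by rewrite in_itv/= => /andP[sc _] ce; exists c.
Qed.

(** [t_D] inverts the decay rate, up to the factor [r]. A solution exists by
    [decay_attained]; whichever is chosen lies in [(s, 1]], since the rate is zero
    at [s] and beyond [1] exceeds its value at [1]. *)
Lemma decay_t_D v s r : 0 < v < 1 -> 0 <= s < 1 -> 0 < r <= decay v s 1 ->
  let kap := r * t_D (v * s / r) v in
  s < kap <= 1 /\ decay v s kap = r.
Proof.
move=> v01 s01 hr; have /andP[v0 v1] := v01; have /andP[s0 s1] := s01.
have /andP[r0 r1] := hr.
have scaleE t : v * s / (r * t) = v * s / r / t by rewrite invfM mulrA.
have [k0 sk0 k0E] := decay_attained v01 s01 hr.
rewrite /t_D; case: xgetP => [t _ [ht tE]|/(_ (k0 / r))]; last first.
  case; split.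
    by rewrite mulrAC [v * s]mulrC mulfK ?gt_eqF// ler_pM2r ?invr_gt0.
  have rn : r != 0 by rewrite gt_eqF.
  by rewrite -scaleE mulrC mulrC [r * _]mulrC divfK// mulrAC -/(decay v s k0) k0E divff.
have sE : s <= r * t.
  by rewrite mulrC -ler_pdivrMr//; move: ht; rewrite mulrAC [v * s]mulrC mulfK ?gt_eqF.
have dE : decay v s (r * t) = r by rewrite /decay scaleE -mulrA tE mulr1.
split=> //; rewrite lt_neqAle sE andbT; apply/andP; split.
  by apply/eqP => h; move: r0; rewrite -dE -h decay_s ?ltxx.
rewrite leNgt; apply/negP => h; have := decay_lt v01 s01 s1 h.
by rewrite dE ltNge r1.
Qed.

Let limit_ratio v s kap : R := (kap - v * s) / (1 - v - v * s + v * kap).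

Let limit_ratio_continuous v s kap : 0 < v < 1 -> s < kap ->
  {for kap, continuous (limit_ratio v s)}.
Proof.
move=> /andP[v0 v1] sk; rewrite /limit_ratio.
have d0 : 0 < 1 - v - v * s + v * kap.
  have : v * s < v * kap by rewrite ltr_pM2l.
  by lra.
apply: cvgM; first by apply: cvgB; [exact: cvg_id|exact: cvg_cst].
apply: cvgV; first by rewrite gt_eqF.
apply: cvgD; first exact: cvg_cst.
by apply: cvgM; [exact: cvg_cst|exact: cvg_id].
Qed.

Let near_ratio v s kap e : 0 < v < 1 -> 0 <= s < 1 -> s < kap -> kap <= 1 -> 0 < e ->
  let k n := ceil_nat (kap * n%:R) in let l n := ceil_nat (v * s * n%:R) in
  \forall n \near \oo,
    `|limit_ratio v s kap - accept_bad v n (l n) (k n) / accept_prob v n (l n) (k n)| <= e.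
Proof.
move=> v01 s01 sk k1 e0 k l; have /andP[s0 _] := s01.
have k0 : 0 <= kap := ltW (le_lt_trans s0 sk).
by have /cvgrPdist_le/(_ e e0) := conditional_ld_limit v01 s01 sk k1 (near_ceil_nat_scale k0).
Qed.

Let ceil_scale_le kap n : 0 <= kap <= 1 -> (ceil_nat (kap * n%:R) <= n.+1)%N.
Proof.
move=> /andP[k0 k1]; have /andP[_ h] := ceil_nat_itv (mulr_ge0 k0 (ler0n R n)).
rewrite -(ler_nat R) (le_trans (ltW h))// -natr1 lerD2r.
by rewrite ler_piMl.
Qed.

Let epsbar_ld_ge lam s r kap e : 0 < lam < 1 -> 0 <= s < 1 -> 0 < r ->
  s < kap -> kap <= 1 -> decay (1 - lam) s kap < r -> 0 < e ->
  \forall n \near \oo, limit_ratio (1 - lam) s kap - e <=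
    epsbar lam (ceil_nat ((1 - lam) * s * n%:R)) n (expR (- (r * n%:R))).
Proof.
move=> lam01 s01 r0 sk k1 hd e0; have v01 : 0 < 1 - lam < 1 by lra.
have s0 : 0 <= s by case/andP: s01.
have k0 : 0 <= kap := ltW (le_lt_trans s0 sk).
have k01 : 0 <= kap <= 1 by rewrite k0.
have e'0 : 0 < r - decay (1 - lam) s kap by rewrite subr_gt0.
apply: filterS3 (ceil_nat_lt_near (vs_lt1 v01 s01))
  (near_ratio v01 s01 sk k1 e0) (ld_lower v01 s01 sk (near_ceil_nat_scale k0) e'0).
move=> n ln hr hl; have kn := ceil_scale_le n k01.
have : expR (- (r * n%:R)) <= accept_prob (1 - lam) n (ceil_nat ((1 - lam) * s * n%:R)) (ceil_nat (kap * n%:R)).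
  apply: le_trans (accept_prob_ge _ v01 kn); apply: le_trans hl.
  by rewrite addrC subrK mulrC.
move=> /(epsbar_ge lam01 ln (signif_itv n r0) kn); apply: le_trans.
by move: hr; rewrite ler_norml => /andP[_]; lra.
Qed.

Let epsbar_ld_le lam s r kap e : 0 < lam < 1 -> 0 <= s < 1 -> 0 < r ->
  s < kap -> kap <= 1 -> r < decay (1 - lam) s kap -> 0 < e ->
  \forall n \near \oo, epsbar lam (ceil_nat ((1 - lam) * s * n%:R)) n (expR (- (r * n%:R)))
    <= limit_ratio (1 - lam) s kap + e.
Proof.
move=> lam01 s01 r0 sk k1 hd e0; have v01 : 0 < 1 - lam < 1 by lra.
have s0 : 0 <= s by case/andP: s01.
have k0 : 0 <= kap := ltW (le_lt_trans s0 sk).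
have k01 : 0 <= kap <= 1 by rewrite k0.
pose k n := ceil_nat (kap * n%:R).
have kC : \forall n \near \oo, `|(k n).-1%:R - kap * n%:R| <= 2.
  apply: filterS (near_ceil_nat_scale k0) => n; rewrite -/(k n).
  have : `|(k n).-1%:R - (k n)%:R| <= 1 :> R.
    case: (k n) => [|m] /=; first by rewrite subrr normr0.
    by rewrite -natr1 opprD addNKr normrN normr1.
  have := ler_normD ((k n).-1%:R - (k n)%:R) ((k n)%:R - kap * n%:R).
  rewrite addrA subrK; lra.
have e'0 : 0 < (decay (1 - lam) s kap - r) / 2 by rewrite divr_gt0// subr_gt0.
have scale := near_ld_scale v01 s01 sk (near_ceil_nat_scale k0).
apply: filterS3 (filterI scale (ceil_nat_lt_near (vs_lt1 v01 s01)))
  (near_ratio v01 s01 sk k1 e0) (ld_upper v01 s01 sk kC e'0).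
move=> n [[n0 lk _ _] ln] hr hl; have nR : 0 < n%:R :> R by rewrite ltr0n.
have kn : (0 < k n <= n.+1)%N by rewrite (leq_ltn_trans _ lk)//= ceil_scale_le.
have : accept_prob (1 - lam) n (ceil_nat ((1 - lam) * s * n%:R)) (k n) < expR (- (r * n%:R)).
  apply: le_lt_trans (accept_prob_le _ v01 kn) _; apply: le_lt_trans hl _.
  rewrite ltr_expR ltrN2 mulrC ltr_pM2l//; move: hd; lra.
move=> /(epsbar_le lam01 ln (signif_itv n r0) kn) /le_trans; apply.
by move: hr; rewrite ler_norml => /andP[+ _]; lra.
Qed.

(** Proportions slightly below and above [kap] give bounds whose limits tend to
    [rateE]. At [kap = 1] there is no room above, but there [rateE = 1]. *)
Lemma epsbar_lossy_ld lam s r e : 0 <= s < 1 -> 0 < lam < 1 ->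
  0 < r <= KL (s * (1 - lam)) (1 - lam) -> 0 < e ->
  \forall n \near \oo,
    `|epsbar lam (ceil_nat ((1 - lam) * s * n%:R)) n (expR (- (r * n%:R))) - rateE lam s r| <= e.
Proof.
move=> s01 lam01; have v01 : 0 < 1 - lam < 1 by lra.
rewrite [s * _]mulrC -decay1 => hr e0; have r0 : 0 < r by case/andP: hr.
have [] := decay_t_D v01 s01 hr.
have -> : rateE lam s r = limit_ratio (1 - lam) s (r * t_D ((1 - lam) * s / r) (1 - lam)).
  by rewrite /rateE /limit_ratio subKr mulrA.
set kap := r * _ => /andP[sk k1] dE.
have e20 : 0 < e / 2 by rewrite divr_gt0.
have lower : \forall n \near \oo, limit_ratio (1 - lam) s kap - e <=
    epsbar lam (ceil_nat ((1 - lam) * s * n%:R)) n (expR (- (r * n%:R))).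
  have [k' [[sk' kk'] hk']] : exists k', (s < k' /\ k' < kap) /\
      `|limit_ratio (1 - lam) s kap - limit_ratio (1 - lam) s k'| <= e / 2.
    have /cvgrPdist_le/(_ _ e20) nk := cvg_at_left_filter (limit_ratio_continuous v01 sk).
    by have [k' []] := filter_ex (filterI (filterI (nbhs_left_gt sk) (nbhs_left_lt kap)) nk); exists k'.
  have hd : decay (1 - lam) s k' < r by rewrite -dE decay_lt.
  apply: filterS (epsbar_ld_ge lam01 s01 r0 sk' (le_trans (ltW kk') k1) hd e20) => n.
  by move: hk'; rewrite ler_norml => /andP[_]; lra.
suff upper : \forall n \near \oo,
    epsbar lam (ceil_nat ((1 - lam) * s * n%:R)) n (expR (- (r * n%:R))) <=
    limit_ratio (1 - lam) s kap + e.
  apply: filterS2 lower upper => n h1 h2.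
  by rewrite ler_norml; apply/andP; split; lra.
have [k1'|k1'] := ltP kap 1; last first.
  have -> : kap = 1 by apply/eqP; rewrite eq_le k1.
  have -> : limit_ratio (1 - lam) s 1 = 1.
    rewrite /limit_ratio mulr1 addrAC subrK divff// gt_eqF// subr_gt0.
    by case/andP: (vs_lt1 v01 s01).
  apply: filterS (ceil_nat_lt_near (vs_lt1 v01 s01)) => n ln.
  by rewrite (le_trans (epsbar_le1 lam01 ln (signif_itv n r0)))// lerDl ltW.
have [k' [[kk' k1''] hk']] : exists k', (kap < k' /\ k' < 1) /\
    `|limit_ratio (1 - lam) s kap - limit_ratio (1 - lam) s k'| <= e / 2.
  have /cvgrPdist_le/(_ _ e20) nk := cvg_at_right_filter (limit_ratio_continuous v01 sk).
  by have [k' []] := filter_ex (filterI (filterI (nbhs_right_gt kap) (nbhs_right_lt k1')) nk); exists k'.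
have hd : r < decay (1 - lam) s k' by rewrite -dE decay_lt.
apply: filterS (epsbar_ld_le lam01 s01 r0 (lt_trans sk kk') (ltW k1'') hd e20) => n.
by move: hk'; rewrite ler_norml => /andP[+ _]; lra.
Qed.

End ExponentialSignificance.

(** * The asymptotic expansions *)

Unset Implicit Arguments.

Theorem theorem3p1 (R : realType) :
  (forall s delta lam : R, 0 <= s < 1 -> 0 < delta < 1 -> 0 < lam < 1 ->
    let nu : R := 1 - lam in
    [/\ s < delta ->
          (fun n : nat => epsbar 0 (ceil_nat (s * n%:R)) n delta)
          = (fun n : nat =>
               s / delta
               + ((1 - s + s ^+ 2 - delta) / (delta * (1 - s))
                  + upsilon s n / delta) * n%:R^-1)
          +O_\oo (fun n : nat => (n%:R ^+ 2)^-1 : R),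
        forall n : nat, upsilon s n <= 1,
        delta <= s ->
          \forall n \near \oo, epsbar 0 (ceil_nat (s * n%:R)) n delta = 1,
        (fun n : nat => epsbar lam (ceil_nat (nu * s * n%:R)) n delta)
          = (fun n : nat => s + coef_sqrt lam s delta * Num.sqrt n%:R^-1)
          +O_\oo (fun n : nat => n%:R^-1 : R)
      & delta <= psi_inv (lam / (nu * (1 - s))) -> 0 <= coef_sqrt lam s delta])
  /\
  (forall s r lam : R, 0 <= s < 1 -> 0 < r -> 0 < lam < 1 ->
    let nu : R := 1 - lam in
    let delta (n : nat) : R := expR (- (r * n%:R)) in
    [/\ \forall n \near \oo, epsbar 0 (ceil_nat (s * n%:R)) n (delta n) = 1,
        KL (s * nu) nu < r ->
          \forall n \near \oo,
            epsbar lam (ceil_nat (nu * s * n%:R)) n (delta n) = 1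
      & 0 < r <= KL (s * nu) nu ->
          (fun n : nat => epsbar lam (ceil_nat (nu * s * n%:R)) n (delta n))
          = (fun _ : nat => rateE lam s r) +o_\oo (fun _ : nat => 1 : R)]).
Proof.
split=> [s delta lam s01 d01 lam01 nu|s r lam s01 r0 lam01 nu delta].
- have v01 : 0 < nu < 1 by rewrite /nu; lra.
  have /andP[s0 s1] := s01; have /andP[d0 d1] := d01.
  split.
  + move=> sd; apply: (@Otau_eqaddO R 4) (epsbar0_asymp s01 d01 sd) => n.
    by rewrite -exprVn -tau_sqr -exprM.
  + by move=> n; have /andP[] := upsilon_itv s n.
  + move=> ds; apply: filterS (ceil_nat_lt_near s01) => n ln.
    apply: epsbar0_one (ltnW ln) _; rewrite d0/=; apply: (le_trans ds).
    rewrite ler_pdivlMr ?ltr0n// -!natr1 ceil_natE// mulrDr mulr1.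
    have /andP[u0 _] := upsilon_itv s n; move: s1; lra.
  + apply: (@Otau_eqaddO R 2) => [n|]; first by rewrite tau_sqr.
    apply: Otau_ext (epsbar_lossy_asymp s01 lam01 d01); apply: nearW => n.
    by rewrite sqrt_inv_nat.
  + exact: coef_sqrt_ge0.
- split.
  + exact: epsbar0_ld.
  + exact: epsbar_lossy_one.
  + move=> hr; apply/eqaddoP => e e0.
    apply: filterS (epsbar_lossy_ld s01 lam01 hr e0) => n.
    by rewrite normr1 mulr1.
Qed.
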